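(* Let $(K,v)$ be a nontrivially valued henselian field. If $(K,v)$ is of mixed characteristic (i.e. $\operatorname{char} K\neq \operatorname{char} Kv$), assume moreover that the value group $vK$ is archimedean. Then $(K,v)$ is a tame field if and only if every algebraic extension of $(K,v)$ (equipped with the unique extension of $v$) is a defectless field.
   Context: For a valued field $(K,v)$, $vK$ denotes its value group and $Kv$ its residue field. A valued field is henselian if $v$ extends uniquely to the algebraic closure $\tilde K$. An algebraic extension is unibranched if $v$ has a unique extension to it. For a finite extension $L|K$ with $v_1,\dots,v_g$ the distinct extensions of $v$ to $L$, the fundamental inequality is $[L:K]\ge\sum_{i=1}^g (v_iL:vK)[Lv_i:Kv]$. The valued field $(K,v)$ is a defectless field if equality holds in it for every finite extension $L|K$. A finite unibranched extension $(L|K,v)$ is a defectless extension if $[L:K]=(vL:vK)[Lv:Kv]$. An algebraic extension $(L|K,v)$ of henselian fields is tame if every finite subextension $E|K$ satisfies: (i) if $p=\operatorname{char}Kv>0$, then $(vE:vK)$ is prime to $p$; (ii) the residue field extension $Ev|Kv$ is separable; (iii) $(E|K,v)$ is a defectless extension. A henselian field $(K,v)$ is a tame field if $(\tilde K|K,v)$ is a tame extension. Equivalently, a henselian $(K,v)$ is tame if and only if $vK$ is $p$-divisible whenever $p=\operatorname{char}Kv>0$, $Kv$ is perfect, and $(K,v)$ is a defectless field. *)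

(* Defs.v *)
From HB Require Import structures.
From mathcomp Require Import all_boot all_order all_algebra all_field.

Set Implicit Arguments.
Unset Strict Implicit.
Unset Printing Implicit Defensive.

Import Order.TTheory GRing.Theory Num.Theory.
Local Open Scope ring_scope.
Local Open Scope quotient_scope.

(* Totally ordered abelian groups, written additively. Totality is an axiom   *)
(* here, not the inherited [Order.Total] structure, because a join of         *)
(* [Order.Total] and [GRing.Zmodule] cannot be declared on top of [ssrnum].   *)

HB.mixin Record isOrderedGroup (G : Type) of Num.POrderedZmodule G := {
  oag_total : total (<=%R : rel G);
  oag_leD : forall a b c : G, a <= b -> a + c <= b + c
}.

#[short(type="ogroupType")]
HB.structure Definition OrderedGroup :=
  {G of isOrderedGroup G & Num.POrderedZmodule G}.

Section OrderedGroupTheory.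
Variable G : ogroupType.
Implicit Types a b c : G.

Lemma oag_comparable a b : a >=< b.
Proof. exact: oag_total. Qed.

Lemma oag_leNgt a b : (a <= b) = ~~ (b < a).
Proof. exact/comparable_leNgt/oag_comparable. Qed.

Lemma oag_leDr a b c : (a + c <= b + c) = (a <= b).
Proof.
by apply/idP/idP => [/(oag_leD _ _ (- c))|/(oag_leD _ _ c)//]; rewrite !addrK.
Qed.

Lemma oag_addr_ge0 a b : 0 <= a -> 0 <= b -> 0 <= a + b.
Proof.
by move=> a0 b0; apply: le_trans b0 _; rewrite -[X in X <= _]add0r oag_leDr.
Qed.

Lemma oag_addr_gt0 a b : 0 <= a -> 0 < b -> 0 < a + b.
Proof.
move=> a0 b0; apply: lt_le_trans b0 _.
by rewrite -[X in X <= _]add0r oag_leDr.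
Qed.

Lemma oag_double0 a : a + a = 0 -> a = 0.
Proof.
move=> aa; have [a0|a0] := orP (oag_total 0 a); apply: le_anti; rewrite a0 ?andbT /=.
  by rewrite -aa -[X in X <= _]add0r oag_leDr.
by rewrite -aa -[X in _ <= X]add0r oag_leDr.
Qed.

End OrderedGroupTheory.

(* Only the values at nonzero arguments are meaningful: v 0, which should be  *)
(* infinity, is left arbitrary, and every use of a value is guarded. The map  *)
(* need not be onto [vgrp]: the value group vK is [value_group v].            *)
Record valuation (K : fieldType) := Valuation {
  vgrp : ogroupType;
  vfun :> K -> vgrp;
  val_mul : forall x y : K, x != 0 -> y != 0 -> vfun (x * y) = vfun x + vfun y;
  val_add : forall x y : K, x != 0 -> y != 0 -> x + y != 0 ->
    Num.min (vfun x) (vfun y) <= vfun (x + y)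
}.

Definition value_group (K : fieldType) (v : valuation K) : vgrp v -> Prop :=
  fun a => exists2 x : K, x != 0 & v x = a.
Arguments value_group {K} v _.

Definition nontrivial (K : fieldType) (v : valuation K) : Prop :=
  exists2 a, value_group v a & a != 0.

Definition archimedean_value_group (K : fieldType) (v : valuation K) : Prop :=
  forall a b, value_group v a -> value_group v b -> 0 < a ->
    exists n : nat, b <= a *+ n.

Section ResidueField.
Variables (K : fieldType) (v : valuation K).

Definition val_ring : {pred K} := fun x => (x == 0) || (0 <= v x).

Lemma val1 : v 1 = 0.
Proof.
by apply: (addrI (v 1)); rewrite addr0 -val_mul ?oner_neq0 // mulr1.
Qed.

Lemma valN1 : v (- 1) = 0.
Proof.
by apply: oag_double0; rewrite -val_mul ?oppr_eq0 ?oner_neq0 // mulrNN mulr1 val1.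
Qed.

Lemma valN x : x != 0 -> v (- x) = v x.
Proof.
by move=> x0; rewrite -mulN1r val_mul ?oppr_eq0 ?oner_neq0 // valN1 add0r.
Qed.

Lemma valV x : x != 0 -> v x^-1 = - v x.
Proof.
move=> x0; apply: (addrI (v x)).
by rewrite -val_mul ?invr_eq0 // divff // val1 subrr.
Qed.

Lemma val_ring_subring : subring_closed val_ring.
Proof.
split=> [|x y|x y]; rewrite !unfold_in ?val1 ?lexx ?orbT //.
- have [->|x0] := eqVneq x 0 => /= [_|vx].
    have [->|y0] := eqVneq y 0 => /= [_|vy]; first by rewrite subr0 eqxx.
    by rewrite sub0r valN // vy orbT.
  have [->|y0] := eqVneq y 0 => /= [_|vy]; first by rewrite subr0 vx orbT.
  have [//|s0] := eqVneq (x - y) 0 => /=.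
  have ny0 : - y != 0 by rewrite oppr_eq0.
  apply: le_trans (val_add v x0 ny0 s0).
  by rewrite comparable_le_min ?oag_comparable // vx valN.
have [->|x0] := eqVneq x 0 => /= [_|vx]; first by rewrite mul0r eqxx.
have [->|y0] := eqVneq y 0 => /= [_|vy]; first by rewrite mulr0 eqxx.
by rewrite val_mul // oag_addr_ge0 ?orbT.
Qed.

HB.instance Definition _ :=
  GRing.isSubringClosed.Build K val_ring val_ring_subring.

Record vring := VRing { vring_val :> K; vring_valP : vring_val \in val_ring }.

HB.instance Definition _ := [isSub for vring_val].
HB.instance Definition _ := [Choice of vring by <:].
HB.instance Definition _ := [SubChoice_isSubComNzRing of vring by <:].

Definition max_ideal : {pred vring} :=
  fun x => (val x == 0) || (0 < v (val x)).

Lemma max_ideal_closed : idealr_closed max_ideal.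
Proof.
split=> [||[a aP] [x xP] [y yP]]; rewrite !unfold_in /= ?eqxx //.
  by rewrite oner_eq0 val1 ltxx.
move: aP; rewrite unfold_in.
have [->|a0] := eqVneq a 0 => /= [_ _|va].
  by rewrite mul0r add0r.
have [->|x0] := eqVneq x 0 => /= [_|vx].
  by rewrite mulr0 add0r.
have ax0 : a * x != 0 by rewrite mulf_neq0.
have vax : 0 < v (a * x) by rewrite val_mul // oag_addr_gt0.
have [->|y0] := eqVneq y 0 => /= [_|vy].
  by rewrite addr0 vax orbT.
have [//|s0] := eqVneq (a * x + y) 0 => /=.
apply: lt_le_trans (val_add v ax0 y0 s0).
by rewrite comparable_lt_min ?oag_comparable // vax.
Qed.

HB.instance Definition _ := isIdealr.Build vring max_ideal max_ideal_closed.

Definition residue := {ideal_quot max_ideal}.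

HB.instance Definition _ := GRing.ComNzRing.on residue.
HB.instance Definition _ := Quotient.on residue.

Lemma vring_inv_subproof (x : vring) :
  (if x \in max_ideal then 0 else (val x)^-1) \in val_ring.
Proof.
case: ifP => [_|]; first exact: rpred0.
rewrite !unfold_in invr_eq0; have [//|x0] := eqVneq (val x) 0 => /= nx.
rewrite valV // -(oag_leDr _ _ (v (val x))) add0r addNr.
by rewrite oag_leNgt nx.
Qed.

Definition vring_inv (x : vring) : vring := VRing (vring_inv_subproof x).

Definition residue_inv (x : residue) : residue := \pi_residue (vring_inv (repr x)).

Lemma residue_mulV (x : residue) : x != 0 -> residue_inv x * x = 1.
Proof.
rewrite /residue_inv -[x in x != 0]reprK -[x in _ * x]reprK.
move: (repr x) => y; rewrite piE Quotient.equivE subr0 => ny.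
rewrite -[X in X = _](rmorphM (\pi_residue)).
have -> : vring_inv y * y = 1; last exact: rmorph1.
apply: val_inj => /=; rewrite (negPf ny) mulVf //.
by apply: contra ny => y0; rewrite unfold_in y0.
Qed.

Lemma residue_inv0 : residue_inv 0 = 0.
Proof.
rewrite /residue_inv.
have h : repr (0 : residue) \in max_ideal.
  rewrite -[repr _]subr0 -Quotient.equivE.
  by have := erefl (0 : residue); rewrite -{1}[0]reprK => /eqP; rewrite piE.
have -> : vring_inv (repr (0 : residue)) = 0; last exact: rmorph0.
by apply: val_inj => /=; rewrite h.
Qed.

HB.instance Definition _ :=
  GRing.ComNzRing_isField.Build residue residue_mulV residue_inv0.

End ResidueField.
Arguments max_ideal {K} v _.

Definition mixed_characteristic (K : fieldType) (v : valuation K) : Prop :=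
  ~ ([pchar K] =i [pchar (residue v)]).

(* Equivalent valuations are identified, as usual. *)
Definition val_equiv (K : fieldType) (v w : valuation K) : Prop :=
  val_ring v =i val_ring w.

Section Extensions.
Variables (K L : fieldType) (iota : {rmorphism K -> L}).

Section Restriction.
Variable w : valuation L.

Lemma restrict_mul (x y : K) : x != 0 -> y != 0 ->
  w (iota (x * y)) = w (iota x) + w (iota y).
Proof. by move=> x0 y0; rewrite rmorphM val_mul ?fmorph_eq0. Qed.

Lemma restrict_add (x y : K) : x != 0 -> y != 0 -> x + y != 0 ->
  Num.min (w (iota x)) (w (iota y)) <= w (iota (x + y)).
Proof. by move=> x0 y0 s0; rewrite rmorphD val_add -?rmorphD ?fmorph_eq0. Qed.

Definition restrict : valuation K := Valuation restrict_mul restrict_add.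

Lemma vring_map_subproof (x : vring restrict) : iota (val x) \in val_ring w.
Proof. by have := valP x; rewrite !unfold_in /= fmorph_eq0. Qed.

Definition vring_map (x : vring restrict) : vring w :=
  VRing (vring_map_subproof x).

(* The canonical embedding Kw -> Lw, induced by the inclusion of the          *)
(* valuation rings.                                                           *)
Definition residue_map (x : residue restrict) : residue w :=
  \pi_(residue w) (vring_map (repr x)).

Lemma residue_map_pi (x : vring restrict) :
  residue_map (\pi_(residue restrict) x) = \pi_(residue w) (vring_map x).
Proof.
apply/eqP; rewrite /residue_map piE Quotient.equivE.
have : repr (\pi_(residue restrict) x) - x \in max_ideal restrict.
  by rewrite Quotient.idealrBE reprK.
by rewrite !unfold_in /= -rmorphB fmorph_eq0.
Qed.

Lemma residue_map_zmod : zmod_morphism residue_map.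
Proof.
move=> x y; rewrite -[x]reprK -[y]reprK -[X in residue_map X]rmorphB.
rewrite !residue_map_pi -[RHS]rmorphB; congr (\pi _).
by apply: val_inj; rewrite /= rmorphB.
Qed.

Lemma residue_map_monoid : monoid_morphism residue_map.
Proof.
split=> [|x y].
  rewrite -[X in residue_map X](rmorph1 (\pi_(residue restrict))).
  rewrite residue_map_pi -[RHS](rmorph1 (\pi_(residue w))); congr (\pi _).
  by apply: val_inj; rewrite /= rmorph1.
rewrite -[x]reprK -[y]reprK -[X in residue_map X]rmorphM.
rewrite !residue_map_pi -[RHS]rmorphM; congr (\pi _).
by apply: val_inj; rewrite /= rmorphM.
Qed.

HB.instance Definition _ :=
  GRing.isZmodMorphism.Build _ _ residue_map residue_map_zmod.
HB.instance Definition _ :=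
  GRing.isMonoidMorphism.Build _ _ residue_map residue_map_monoid.

End Restriction.

Definition extends (v : valuation K) (w : valuation L) : Prop :=
  val_equiv (restrict w) v.

Definition unibranched (v : valuation K) : Prop :=
  exists2 w : valuation L, extends v w &
    forall w' : valuation L, extends v w' -> val_equiv w w'.

Definition algebraic_extension : Prop :=
  forall y : L, algebraicOver iota y.

(* The irreducible p below is the minimal polynomial of y, up to a scalar. *)
Definition separable_extension : Prop :=
  forall y : L, exists p : {poly K},
    [/\ irreducible_poly p, root (map_poly iota p) y & separable_poly p].

(* [L : K] = n *)
Definition field_degree (n : nat) : Prop :=
  exists b : 'I_n -> L, forall y : L,
    exists! c : {ffun 'I_n -> K}, y = \sum_(i < n) iota (c i) * b i.

(* (wL : wK) = n: the b i are representatives of the cosets of wK in wL. *)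
Definition ramification_index (w : valuation L) (n : nat) : Prop :=
  exists2 b : 'I_n -> vgrp w, forall i, value_group w (b i) &
    forall a : vgrp w, value_group w a ->
      exists! i : 'I_n, value_group (restrict w) (a - b i).

End Extensions.
Arguments residue_map {K L} iota w _.

(* [Lw : Kw] = n *)
Definition residue_degree (K L : fieldType) (iota : {rmorphism K -> L})
    (w : valuation L) (n : nat) : Prop :=
  field_degree (residue_map iota w : {rmorphism _ -> _}) n.

(* Finite extensions of K are objects of [fieldExtType K]. *)
Definition base_emb (K : fieldType) (L : fieldExtType K) : {rmorphism K -> L} :=
  in_alg L.

(* w 0, ..., w (g - 1) are the distinct extensions of v to L. *)
Definition defectless_field (K : fieldType) (v : valuation K) : Prop :=
  forall L : fieldExtType K,
    exists (g : nat) (w : 'I_g -> valuation L) (e f : 'I_g -> nat),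
      [/\ forall i, extends (base_emb L) v (w i),
          forall i j, val_equiv (w i) (w j) -> i = j,
          forall u, extends (base_emb L) v u -> exists i, val_equiv u (w i),
          forall i, ramification_index (base_emb L) (w i) (e i) /\
                    residue_degree (base_emb L) (w i) (f i)
        & \dim {:L} = (\sum_(i < g) e i * f i)%N].

(* (L|K, w) is a (unibranched) defectless extension; here and below the       *)
(* ground field carries the restriction of the valuation of the extension.    *)
Definition defectless_extension (K : fieldType) (L : fieldExtType K)
    (w : valuation L) : Prop :=
  unibranched (base_emb L) (restrict (base_emb L) w) /\
  exists e f : nat,
    [/\ ramification_index (base_emb L) w e,
        residue_degree (base_emb L) w f & \dim {:L} = (e * f)%N].

Section Tame.
Variables (K L : fieldType) (iota : {rmorphism K -> L}).

(* Meant for henselian K. The finite subextensions of L|K are presented as    *)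
(* finite extensions E|K with an embedding j of E in L over K.                *)
Definition tame_extension (w : valuation L) : Prop :=
  algebraic_extension iota /\
  forall (E : fieldExtType K) (j : {rmorphism E -> L}),
    j \o base_emb E =1 iota ->
    let u := restrict j w in
    [/\ forall p : nat, p \in [pchar (residue (restrict (base_emb E) u))] ->
          exists2 e : nat, ramification_index (base_emb E) u e & coprime e p,
        separable_extension (residue_map (base_emb E) u : {rmorphism _ -> _})
      & defectless_extension u].

End Tame.

(* In the next two definitions iota : K -> Kt is an algebraic closure of K. *)
Definition henselian (K : fieldType) (Kt : closedFieldType)
    (iota : {rmorphism K -> Kt}) (v : valuation K) : Prop :=
  unibranched iota v.

Definition tame_field (K : fieldType) (Kt : closedFieldType)
    (iota : {rmorphism K -> Kt}) (v : valuation K) : Prop :=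
  henselian iota v /\
  forall w : valuation Kt, extends iota v w -> tame_extension iota w.

(* Main.v *)
Require Import Defs.
From HB Require Import structures.
From mathcomp Require Import fingroup perm pgroup.
From mathcomp Require Import all_boot all_order all_algebra all_field.
From mathcomp Require Import boolp classical_sets ring.

(** From tame to defectless. Let L be an algebraic extension of the tame field
    K, and M a finite extension of L, of degree n. As K is henselian, v extends
    uniquely to M, and the elements of nonnegative value are integral over
    K ([henselian_integral]). Let t_i represent the e cosets of the value
    group, and let the residues of the s_j form a basis of the residue field
    extension, of degree f. The products t_i s_j are valuation independent over L
    ([standard_val_indep]), and every element of M has the leading term of one of
    their combinations ([standard_leading]). They are a basis of M, so that
    n = e * f, as soon as M contains an integral element z whose trace over L is
    a unit: an element y orthogonal to all the t_i s_j for the trace form gives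
    an x = z / y and a combination s with x - s of larger value than x, and then
    the trace of z is that of (x - s) y, which lies in the maximal ideal, because
    the trace maps the maximal ideal to the maximal ideal
    ([unit_trace_defectless]). In a finite extension of K itself such a z exists by
    tameness: modulo the maximal ideal the trace of z is e times the trace of its
    residue, e is prime to the residue characteristic, and the trace
    of a separable extension does not vanish ([tame_unit_trace]). In general M
    comes by extension of scalars from a finite extension S of a finite extension E
    of K in L, and transitivity of the trace for S, E and K gives the
    element z ([tame_unit_trace_above]).

    From defectless to tame. For a finite extension E of K, the equality n = e * f
    is the hypothesis for K, so it remains to see, for a residue characteristic
    p > 0, that the value group is p-divisible and the residue field perfect.
    In other words, that there is no nonzero b such that v (b - c ^+ p) <= v b for
    all c. The lack of such an approximate p-th root has the key property of
    being inherited by y = b ^ (1 / p) over K(y), as one sees by taking norms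
    ([no_pth_root_root]).

    Suppose that an element a of an algebraic extension has no approximate p-th
    root there, and that - v p <= v a < 0. Let theta be a root of X ^ p - X - a.
    No c satisfies v (theta - c) >= 0, otherwise c would be an approximate p-th
    root of a. By Zorn's lemma some algebraic extension L of K is maximal with
    this property. In L no approximation c of theta is optimal: for
    d = theta - c one has d ^+ p = b + d up to integral elements with b in L, and
    either an approximate p-th root of b in L improves c, or y = b ^ (1 / p)
    generates a larger field, in which some c' has v (theta - c') >= 0; then
    c' - c - y is an approximate p-th root of y, against the key property
    ([no_best_approximation]). But the valuation basis of the defectless extension
    L(theta) of L gives an optimal approximation ([best_approximation]).

    In equal characteristic p the bound - v p <= v a is void, and v a < 0 is
    obtained by multiplying a by a p-th power. In mixed characteristic, if
    v a <> 0 the bound is reached by taking iterated p-th roots of a, as the value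
    group is archimedean. If only elements of value 0 lack an approximate p-th
    root, then p itself has one, say c, and a / c ^+ p will do
    ([approximate_pth_root]). *)

Set Implicit Arguments.
Unset Strict Implicit.
Unset Printing Implicit Defensive.

Import Order.TTheory GRing.Theory Num.Theory.
Local Open Scope ring_scope.

(** * Divisibility with respect to a valuation *)

Section ValuationDivisibility.
Variables (K : fieldType) (v : valuation K).
Implicit Types x y z : K.

(** This is v x <= v y with v 0 infinite. It is phrased with the valuation ring
    alone, so that it is insensitive to the value of v at 0 and to the
    replacement of v by an equivalent valuation. *)
Definition vdvd x y := if x == 0 then y == 0 else y / x \in val_ring v.

Definition vsdvd x y := ~~ vdvd y x.

Lemma val_ring_total x : (x \in val_ring v) || (x^-1 \in val_ring v).
Proof.
rewrite !unfold_in invr_eq0; have [//|x0] := eqVneq x 0 => /=.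
rewrite valV //; have [->//|] := orP (oag_total 0 (v x)).
by move=> /(oag_leD _ _ (- v x)); rewrite add0r subrr => ->; rewrite orbT.
Qed.

Lemma vdvdE x y : x != 0 -> y != 0 -> vdvd x y = (v x <= v y).
Proof.
move=> x0 y0; rewrite /vdvd (negPf x0) unfold_in mulf_eq0 invr_eq0.
rewrite (negPf x0) (negPf y0) /= val_mul ?invr_eq0 // valV //.
by rewrite -[in LHS](oag_leDr _ _ (v x)) add0r subrK.
Qed.

Lemma vdvd0 x : vdvd x 0.
Proof. by rewrite /vdvd mul0r rpred0 eqxx if_same. Qed.

Lemma vdvd0x y : vdvd 0 y = (y == 0).
Proof. by rewrite /vdvd eqxx. Qed.

Lemma vdvd1 x : vdvd 1 x = (x \in val_ring v).
Proof. by rewrite /vdvd oner_eq0 divr1. Qed.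

Lemma vdvdxx x : vdvd x x.
Proof. by rewrite /vdvd; case: eqVneq => // x0; rewrite divff // rpred1. Qed.

Lemma vdvd_total x y : vdvd x y || vdvd y x.
Proof.
have [->|x0] := eqVneq x 0; first by rewrite vdvd0 orbT.
have [->|y0] := eqVneq y 0; first by rewrite vdvd0.
rewrite /vdvd (negPf x0) (negPf y0).
by have := val_ring_total (y / x); rewrite invf_div.
Qed.

Lemma vdvd_trans : transitive vdvd.
Proof.
move=> y x z; have [->|x0] := eqVneq x 0.
  by rewrite !vdvd0x => /eqP->; rewrite vdvd0x.
have [->|y0] := eqVneq y 0; first by rewrite !vdvd0x => _ /eqP->; apply: vdvd0.
rewrite /vdvd (negPf x0) (negPf y0) => xy yz.
by have := rpredM yz xy; rewrite mulrA divfK.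
Qed.

Lemma vsdvdW x y : vsdvd x y -> vdvd x y.
Proof. by rewrite /vsdvd; have /orP[->|->] := vdvd_total x y. Qed.

Lemma vdvd_sdvd_trans x y z : vdvd x y -> vsdvd y z -> vsdvd x z.
Proof. by move=> xy; apply: contra => zx; apply: vdvd_trans xy. Qed.

Lemma vsdvd_dvd_trans x y z : vsdvd x y -> vdvd y z -> vsdvd x z.
Proof. by move=> + yz; apply: contra; apply: vdvd_trans. Qed.

Lemma vsdvd_trans x y z : vsdvd x y -> vsdvd y z -> vsdvd x z.
Proof. by move=> xy /vsdvdW; apply: vsdvd_dvd_trans. Qed.

Lemma vsdvdxx x : vsdvd x x = false.
Proof. by rewrite /vsdvd vdvdxx. Qed.

Lemma vsdvd_neq0 x y : vsdvd x y -> x != 0.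
Proof. by apply: contraNneq => ->; apply: vdvd0. Qed.

Lemma vsdvdx0 x : vsdvd x 0 = (x != 0).
Proof. by rewrite /vsdvd vdvd0x. Qed.

Lemma vdvd_neq0 x y : vdvd x y -> y != 0 -> x != 0.
Proof. by move=> + y0; apply: contraTneq => ->; rewrite vdvd0x. Qed.

Lemma vdvdD x y z : vdvd x y -> vdvd x z -> vdvd x (y + z).
Proof.
rewrite /vdvd; case: eqP => [_ /eqP-> /eqP->|_]; first by rewrite addr0.
by rewrite mulrDl; apply: rpredD.
Qed.

Lemma vdvdNr x y : vdvd x (- y) = vdvd x y.
Proof. by rewrite /vdvd oppr_eq0 mulNr rpredN. Qed.

Lemma vdvdNl x y : vdvd (- x) y = vdvd x y.
Proof. by rewrite /vdvd oppr_eq0 invrN mulrN rpredN. Qed.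

Lemma vdvdB x y z : vdvd x y -> vdvd x z -> vdvd x (y - z).
Proof. by move=> xy xz; rewrite vdvdD ?vdvdNr. Qed.

Lemma vdvd_sum (I : Type) (r : seq I) (P : pred I) (F : I -> K) x :
  (forall i, P i -> vdvd x (F i)) -> vdvd x (\sum_(i <- r | P i) F i).
Proof.
by move=> xF; apply: (big_ind (vdvd x)) => //; [apply: vdvd0|apply: vdvdD].
Qed.

Lemma vdvd_mul2l a x y : a != 0 -> vdvd (a * x) (a * y) = vdvd x y.
Proof.
move=> a0; rewrite /vdvd !mulf_eq0 (negPf a0) /=; case: eqVneq => // x0.
by rewrite invfM mulrACA divff // mul1r.
Qed.

Lemma vdvd_mul2r a x y : a != 0 -> vdvd (x * a) (y * a) = vdvd x y.
Proof. by move=> a0; rewrite ![_ * a]mulrC vdvd_mul2l. Qed.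

Lemma vdvdMl a x y : vdvd x y -> vdvd (a * x) (a * y).
Proof.
have [->|a0] := eqVneq a 0; first by rewrite !mul0r vdvdxx.
by rewrite vdvd_mul2l.
Qed.

Lemma vdvdM a b x y : vdvd a b -> vdvd x y -> vdvd (a * x) (b * y).
Proof.
move=> ab xy; apply: vdvd_trans (vdvdMl b xy).
by rewrite ![_ * x]mulrC vdvdMl.
Qed.

Lemma vsdvd_mul2l a x y : a != 0 -> vsdvd (a * x) (a * y) = vsdvd x y.
Proof. by move=> a0; rewrite /vsdvd vdvd_mul2l. Qed.

Lemma vsdvd_mul2r a x y : a != 0 -> vsdvd (x * a) (y * a) = vsdvd x y.
Proof. by move=> a0; rewrite /vsdvd vdvd_mul2r. Qed.

Lemma vsdvdMr a b x y : vsdvd a b -> vdvd x y -> x != 0 -> vsdvd (a * x) (b * y).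
Proof.
move=> ab xy x0; apply: vsdvd_dvd_trans (vdvdMl b xy).
by rewrite vsdvd_mul2r.
Qed.

Lemma vsdvdMl a b x y : vdvd a b -> vsdvd x y -> a != 0 -> vsdvd (a * x) (b * y).
Proof. by move=> ab xy a0; rewrite mulrC [b * y]mulrC vsdvdMr. Qed.

Lemma vdvdX n x y : vdvd x y -> vdvd (x ^+ n) (y ^+ n).
Proof.
by move=> xy; elim: n => [|n IHn]; rewrite ?expr0 ?vdvdxx // !exprS vdvdM.
Qed.

Lemma vsdvdX n x y : (0 < n)%N -> vsdvd x y -> vsdvd (x ^+ n) (y ^+ n).
Proof.
case: n => // n _ xy; rewrite !exprS vsdvdMr ?vdvdX 1?vsdvdW //.
by rewrite expf_neq0 // (vsdvd_neq0 xy).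
Qed.

Lemma vdvd_exp n x y : (0 < n)%N -> vdvd (x ^+ n) (y ^+ n) = vdvd x y.
Proof.
move=> n0; apply/idP/idP; last exact: vdvdX.
by apply: contraTT => /(vsdvdX n0).
Qed.

Lemma vsdvd_exp n x y : (0 < n)%N -> vsdvd (x ^+ n) (y ^+ n) = vsdvd x y.
Proof. by move=> n0; rewrite /vsdvd vdvd_exp. Qed.

Lemma vdvdV x y : x != 0 -> y != 0 -> vdvd x^-1 y^-1 = vdvd y x.
Proof.
move=> x0 y0; rewrite -(vdvd_mul2l _ _ (mulf_neq0 x0 y0)).
by rewrite mulfK // mulrAC divff // mul1r.
Qed.

Lemma vsdvdV x y : x != 0 -> y != 0 -> vsdvd x^-1 y^-1 = vsdvd y x.
Proof. by move=> x0 y0; rewrite /vsdvd vdvdV. Qed.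

Lemma vsdvdNr x y : vsdvd x (- y) = vsdvd x y.
Proof. by rewrite /vsdvd vdvdNl. Qed.

Lemma vsdvdD x y z : vsdvd x y -> vsdvd x z -> vsdvd x (y + z).
Proof.
move=> xy xz; have /orP[yz|zy] := vdvd_total y z.
  by apply: vsdvd_dvd_trans xy _; rewrite vdvdD // vdvdxx.
by apply: vsdvd_dvd_trans xz _; rewrite vdvdD // vdvdxx.
Qed.

Lemma vsdvdB x y z : vsdvd x y -> vsdvd x z -> vsdvd x (y - z).
Proof. by move=> xy xz; rewrite vsdvdD ?vsdvdNr. Qed.

Lemma vsdvd_sum (I : Type) (r : seq I) (P : pred I) (F : I -> K) x :
  x != 0 -> (forall i, P i -> vsdvd x (F i)) -> vsdvd x (\sum_(i <- r | P i) F i).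
Proof.
move=> x0 xF; apply: (big_ind (vsdvd x)) => //; first by rewrite vsdvdx0.
exact: vsdvdD.
Qed.

Lemma vsdvd_addl x y : vsdvd x y -> vdvd (x + y) x.
Proof.
move=> xy; rewrite -[vdvd _ _]negbK; apply/negP => h.
by have := vsdvdB h xy; rewrite addrK vsdvdxx.
Qed.

Lemma vdvd1_nat n : vdvd 1 n%:R.
Proof. by rewrite vdvd1 rpred_nat. Qed.

Lemma vdvd1X n x : vdvd 1 x -> vdvd 1 (x ^+ n).
Proof. by move/(vdvdX n); rewrite expr1n. Qed.

Lemma vdvd1M x y : vdvd 1 x -> vdvd 1 y -> vdvd 1 (x * y).
Proof. by move=> x1 y1; rewrite -[1]mulr1 vdvdM. Qed.

Lemma max_idealE (x : vring v) : (x \in max_ideal v) = vsdvd 1 (val x).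
Proof.
rewrite unfold_in; have [->|x0] := eqVneq (val x) 0 => /=.
  by rewrite vsdvdx0 oner_neq0.
by rewrite /vsdvd vdvdE ?oner_neq0 // Defs.val1 oag_leNgt negbK.
Qed.

End ValuationDivisibility.

Lemma vdvd_equiv (K : fieldType) (v w : valuation K) :
  val_equiv v w -> vdvd v =2 vdvd w.
Proof. by move=> vw x y; rewrite /vdvd vw. Qed.

Lemma vsdvd_equiv (K : fieldType) (v w : valuation K) :
  val_equiv v w -> vsdvd v =2 vsdvd w.
Proof. by move=> vw x y; rewrite /vsdvd (vdvd_equiv vw). Qed.

Lemma vdvd_restrict (K L : fieldType) (iota : {rmorphism K -> L})
    (w : valuation L) x y :
  vdvd (restrict iota w) x y = vdvd w (iota x) (iota y).
Proof.
rewrite /vdvd fmorph_eq0; case: ifP => _; first by rewrite fmorph_eq0.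
by rewrite -fmorph_div !unfold_in /= fmorph_eq0.
Qed.

Lemma vsdvd_restrict (K L : fieldType) (iota : {rmorphism K -> L})
    (w : valuation L) x y :
  vsdvd (restrict iota w) x y = vsdvd w (iota x) (iota y).
Proof. by rewrite /vsdvd vdvd_restrict. Qed.

(** * The valuation of a valuation ring *)

Section ValuationOfRing.
Variables (F : fieldType) (V : {pred F}).
Hypotheses (V_ring : subring_closed V)
           (V_total : forall x : F, (x \in V) || (x^-1 \in V)).

Let V1 : 1 \in V. Proof. by case: V_ring. Qed.
Let VB : {in V &, forall x y, x - y \in V}. Proof. by case: V_ring. Qed.
Let VM : {in V &, forall x y, x * y \in V}. Proof. by case: V_ring. Qed.

(** Zero is given the class of 1, so that the classes can be multiplied through
    nonzero representatives. *)
Definition vg_rep (x : F) := if x == 0 then 1 else x.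

Lemma vg_rep_neq0 x : vg_rep x != 0.
Proof. by rewrite /vg_rep; case: (eqVneq x 0) => [_|//]; apply: oner_neq0. Qed.

Lemma vg_rep_id x : x != 0 -> vg_rep x = x.
Proof. by rewrite /vg_rep => /negPf->. Qed.

Definition vg_le (x y : F) := vg_rep y / vg_rep x \in V.

Lemma vg_le_refl : reflexive vg_le.
Proof. by move=> x; rewrite /vg_le divff ?vg_rep_neq0. Qed.

Lemma vg_le_trans : transitive vg_le.
Proof.
move=> y x z xy yz; have := VM yz xy.
by rewrite mulrA divfK // vg_rep_neq0.
Qed.

Lemma vg_le_total x y : vg_le x y || vg_le y x.
Proof. by have := V_total (vg_rep y / vg_rep x); rewrite invf_div. Qed.

Definition vg_equiv x y := vg_le x y && vg_le y x.

Lemma vg_equiv_is_equiv : equiv_class_of vg_equiv.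
Proof.
split=> [x|x y|y x z]; rewrite /vg_equiv ?vg_le_refl //.
  by rewrite andbC.
move=> /andP[xy yx] /andP[yz zy].
by rewrite (vg_le_trans xy yz) (vg_le_trans zy yx).
Qed.

Canonical vg_equiv_equiv := EquivRelPack vg_equiv_is_equiv.

Local Open Scope quotient_scope.

Definition vg := {eq_quot vg_equiv}.
HB.instance Definition _ := Choice.on vg.
HB.instance Definition _ := Quotient.on vg.

Lemma vg_pi_eq x y : (\pi_vg x = \pi_vg y) <-> vg_equiv x y.
Proof. by split=> [/eqmodP|?]; last apply/eqmodP. Qed.

Lemma vg_repr_pi x : vg_equiv (repr (\pi_vg x)) x.
Proof. by apply/vg_pi_eq; rewrite reprK. Qed.

Definition vg_add (a b : vg) : vg := \pi_vg (vg_rep (repr a) * vg_rep (repr b)).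
Definition vg_opp (a : vg) : vg := \pi_vg (vg_rep (repr a))^-1.
Definition vg_ord (a b : vg) := vg_le (repr a) (repr b).

Lemma vg_le_mul x y x' y' : vg_le x x' -> vg_le y y' ->
  vg_le (vg_rep x * vg_rep y) (vg_rep x' * vg_rep y').
Proof.
move=> xx yy; rewrite /vg_le !(@vg_rep_id (_ * _)) ?mulf_neq0 ?vg_rep_neq0 //.
by rewrite invfM mulrACA VM.
Qed.

Lemma vg_add_pi x y : x != 0 -> y != 0 ->
  vg_add (\pi_vg x) (\pi_vg y) = \pi_vg (x * y).
Proof.
move=> x0 y0; apply/vg_pi_eq; rewrite -[in X in vg_equiv _ X](vg_rep_id x0).
rewrite -[in X in vg_equiv _ X](vg_rep_id y0).
have /andP[h1 h2] := vg_repr_pi x; have /andP[h3 h4] := vg_repr_pi y.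
by rewrite /vg_equiv !vg_le_mul.
Qed.

Lemma vg_elim (P : vg -> Prop) : (forall x, x != 0 -> P (\pi_vg x)) ->
  forall a, P a.
Proof.
move=> Ppi a; rewrite -[a]reprK; have [r0|/Ppi//] := eqVneq (repr a) 0.
suff -> : \pi_vg (repr a) = \pi_vg 1 by apply: Ppi (oner_neq0 _).
apply/vg_pi_eq; rewrite r0 /vg_equiv /vg_le /vg_rep eqxx oner_eq0.
by rewrite divr1 V1.
Qed.

Lemma vg_addA : associative vg_add.
Proof.
elim/vg_elim=> x x0; elim/vg_elim=> y y0; elim/vg_elim=> z z0.
by rewrite !vg_add_pi ?mulf_neq0 // mulrA.
Qed.

Lemma vg_addC : commutative vg_add.
Proof. by move=> a b; rewrite /vg_add mulrC. Qed.

Lemma vg_add0 : left_id (\pi_vg 1) vg_add.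
Proof. by elim/vg_elim=> x x0; rewrite vg_add_pi ?oner_neq0 // mul1r. Qed.

Lemma vg_addN : left_inverse (\pi_vg 1) vg_opp vg_add.
Proof.
move=> a; rewrite -{2}[a]reprK /vg_opp.
suff -> : \pi_vg (repr a) = \pi_vg (vg_rep (repr a)).
  by rewrite vg_add_pi ?invr_eq0 ?vg_rep_neq0 // mulVf ?vg_rep_neq0.
apply/vg_pi_eq; rewrite /vg_equiv /vg_le (vg_rep_id (vg_rep_neq0 _)).
by rewrite divff ?vg_rep_neq0 // V1.
Qed.

HB.instance Definition _ := GRing.isZmodule.Build vg vg_addA vg_addC vg_add0 vg_addN.

Lemma vg_ord_pi x y : vg_ord (\pi_vg x) (\pi_vg y) = vg_le x y.
Proof.
rewrite /vg_ord; have /andP[h1 h2] := vg_repr_pi x.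
have /andP[h3 h4] := vg_repr_pi y; apply/idP/idP => h.
  exact: vg_le_trans (vg_le_trans h2 h) h3.
exact: vg_le_trans (vg_le_trans h1 h) h4.
Qed.

Lemma vg_ord_refl : reflexive vg_ord.
Proof. by move=> a; apply: vg_le_refl. Qed.

Lemma vg_ord_anti : antisymmetric vg_ord.
Proof.
move=> a b /andP[ab ba]; rewrite -[a]reprK -[b]reprK; apply/vg_pi_eq.
exact/andP.
Qed.

Lemma vg_ord_trans : transitive vg_ord.
Proof. by move=> b a c; apply: vg_le_trans. Qed.

HB.instance Definition _ := Order.Le_isPOrder.Build ring_display vg
  vg_ord_refl vg_ord_anti vg_ord_trans.

Lemma vg_total : total (<=%R : rel vg).
Proof. by move=> a b; apply: vg_le_total. Qed.

Lemma vg_leD (a b c : vg) : a <= b -> a + c <= b + c.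
Proof.
elim/vg_elim: a => x x0; elim/vg_elim: b => y y0; elim/vg_elim: c => z z0.
move=> xy; change (vg_ord (vg_add (\pi_vg x) (\pi_vg z)) (vg_add (\pi_vg y) (\pi_vg z))).
move: xy; rewrite !vg_add_pi // /Order.le /= !vg_ord_pi => xy.
rewrite -(vg_rep_id x0) -(vg_rep_id y0) -(vg_rep_id z0).
by rewrite vg_le_mul // vg_le_refl.
Qed.

HB.instance Definition _ := isOrderedGroup.Build vg vg_total vg_leD.

Lemma vg_val_mul (x y : F) : x != 0 -> y != 0 ->
  \pi_vg (x * y) = \pi_vg x + \pi_vg y :> vg.
Proof. by move=> x0 y0; rewrite -[RHS]/(vg_add _ _) vg_add_pi. Qed.

Lemma vg_val_add (x y : F) : x != 0 -> y != 0 -> x + y != 0 ->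
  Num.min (\pi_vg x : vg) (\pi_vg y) <= \pi_vg (x + y).
Proof.
move=> x0 y0 s0.
have VD a b : a \in V -> b \in V -> a + b \in V.
  by move=> aV bV; rewrite -[b]opprK VB // -[- b]add0r VB // -(subrr 1) VB.
suff H (a b : F) : a != 0 -> b != 0 -> a + b != 0 -> (\pi_vg a : vg) <= \pi_vg b ->
    (\pi_vg a : vg) <= \pi_vg (a + b).
  have [xy|yx] := orP (vg_total (\pi_vg x) (\pi_vg y)).
    by rewrite (min_l xy) H.
  by rewrite (min_r yx) addrC H // addrC.
move=> a0 b0 ab0; rewrite /Order.le /= !vg_ord_pi /vg_le !vg_rep_id // => ab.
by rewrite mulrDl divff // VD.
Qed.

Definition valuation_of_ring : valuation F := Valuation vg_val_mul vg_val_add.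

Lemma val_ring_of_ring : val_ring valuation_of_ring =i V.
Proof.
move=> x; rewrite unfold_in; have [->|x0] /= := eqVneq x 0.
  by rewrite -(subrr 1) VB.
rewrite -[0 in X in X = _]/(\pi_vg 1 : vg) /Order.le /= vg_ord_pi /vg_le.
by rewrite !vg_rep_id ?oner_neq0 // divr1.
Qed.

End ValuationOfRing.

(** * Chevalley's extension theorem *)

(** The base is adjoined to every chain, which makes all the chains to be
    considered nonempty. *)
Lemma zorn_above (T : Type) (good : set T -> Prop) (base : set T) :
    good base ->
    (forall C : set (set T), (exists X, C X) -> (forall X, C X -> good X) ->
      total_on C subset -> good (\bigcup_(X in C) X)%classic) ->
  exists M, [/\ subset base M, good M
    & forall B, subset M B -> good B -> subset B M].
Proof.
move=> good_base good_chain.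
have [|M [gM maxM]] := @Zorn_bigcup T (fun X => good (base `|` X)%classic).
  move=> C CP Ctot.
  pose D : set (set T) := fun Y => Y = base \/ exists2 X, C X & Y = (base `|` X)%classic.
  have -> : (base `|` \bigcup_(X in C) X = \bigcup_(Y in D) Y)%classic.
    apply/seteqP; split=> x /=.
      case=> [bx|[X CX Xx]]; first by exists base => //; left.
      by exists (base `|` X)%classic; [right; exists X|right].
    case=> Y [->|[X CX ->]]; first by left.
    by case=> [bx|Xx]; [left|right; exists X].
  apply: good_chain.
  - by exists base; left.
  - by move=> _ [->//|[X /CP + ->]].
  move=> _ _ [->|[X CX ->]] [->|[Y CY ->]].
  - by left.
  - by left; move=> x bx; left.
  - by right; move=> x bx; left.
  case: (Ctot _ _ CX CY) => XY; [left|right].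
    by move=> x [bx|Xx]; [left|right; apply: XY].
  by move=> x [bx|Xx]; [left|right; apply: XY].
exists (base `|` M)%classic; split=> //.
move=> B MB gB x Bx; apply: contrapT => nMx.
apply: (maxM B); last first.
  suff -> : (base `|` B = B)%classic by [].
  by apply/seteqP; split=> y; [case=> // by_; apply: MB; left|right].
split; first by move=> y My; apply: MB; right.
by move=> BM; apply: nMx; right; apply: BM.
Qed.

Section Chevalley.
Variable F : fieldType.

(** A subring A together with an ideal J of A not containing 1, coded as the
    set of the (true, a) and the (false, j), so that inclusion of pairs is
    inclusion of sets. *)
Definition subring_ideal (S : set (bool * F)) :=
  [/\ S (true, 1) /\ ~ S (false, 1),
      forall x y, S (true, x) -> S (true, y) -> S (true, x - y) /\ S (true, x * y),
      forall x, S (false, x) -> S (true, x),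
      S (false, 0) /\ (forall x y, S (false, x) -> S (false, y) -> S (false, x - y))
    & forall x y, S (true, x) -> S (false, y) -> S (false, x * y)].

Lemma subring_ideal_chain (C : set (set (bool * F))) :
  (exists X, C X) -> (forall X, C X -> subring_ideal X) -> total_on C subset ->
  subring_ideal (\bigcup_(X in C) X)%classic.
Proof.
move=> [X0 CX0] gC Ctot.
have two a b : (\bigcup_(X in C) X)%classic a -> (\bigcup_(X in C) X)%classic b ->
    exists2 X, C X & X a /\ X b.
  move=> [X CX Xa] [Y CY Yb]; case: (Ctot _ _ CX CY) => XY.
    by exists Y => //; split=> //; apply: XY.
  by exists X => //; split=> //; apply: XY.
split.
- split; first by exists X0 => //; case: (gC _ CX0) => [[]].
  by move=> [X CX X1]; case: (gC _ CX) => [[]].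
- move=> x y Sx Sy; have [X CX [Xx Xy]] := two _ _ Sx Sy.
  case: (gC _ CX) => _ /(_ x y Xx Xy)[h1 h2] _ _ _.
  by split; exists X.
- by move=> x [X CX Xx]; exists X => //; case: (gC _ CX) => _ _ h _ _; apply: h.
- split; first by exists X0 => //; case: (gC _ CX0) => _ _ _ [] //.
  move=> x y Sx Sy; have [X CX [Xx Xy]] := two _ _ Sx Sy.
  by exists X => //; case: (gC _ CX) => _ _ _ [_ h] _; apply: h.
- move=> x y Sx Sy; have [X CX [Xx Xy]] := two _ _ Sx Sy.
  by exists X => //; case: (gC _ CX) => _ _ _ _ h; apply: h.
Qed.

Section Maximal.
Variable S : set (bool * F).
Hypothesis S_good : subring_ideal S.
Hypothesis S_max : forall B, subset S B -> subring_ideal B -> subset B S.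

Let A x := S (true, x).
Let J x := S (false, x).

Let A1 : A 1. Proof. by case: S_good => [[]]. Qed.
Let AB x y : A x -> A y -> A (x - y).
Proof. by case: S_good => _ h _ _ _ Ax Ay; case: (h x y). Qed.
Let AM x y : A x -> A y -> A (x * y).
Proof. by case: S_good => _ h _ _ _ Ax Ay; case: (h x y). Qed.
Let A0 : A 0. Proof. by rewrite -(subrr 1); apply: AB. Qed.
Let AN x : A x -> A (- x). Proof. by rewrite -sub0r; apply: AB. Qed.
Let AD x y : A x -> A y -> A (x + y).
Proof. by move=> Ax Ay; rewrite -[y]opprK; apply/AB/AN. Qed.
Let JA x : J x -> A x. Proof. by case: S_good => _ _ h _ _; apply: h. Qed.
Let J0 : J 0. Proof. by case: S_good => _ _ _ [h _] _; apply: h. Qed.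
Let JB x y : J x -> J y -> J (x - y).
Proof. by case: S_good => _ _ _ [_ h] _; apply: h. Qed.
Let JN x : J x -> J (- x). Proof. by rewrite -sub0r; apply: JB. Qed.
Let JD x y : J x -> J y -> J (x + y).
Proof. by move=> Jx Jy; rewrite -[y]opprK; apply/JB/JN. Qed.
Let JM x y : A x -> J y -> J (x * y).
Proof. by case: S_good => _ _ _ _ h; apply: h. Qed.
Let JN1 : ~ J 1. Proof. by case: S_good => [[]]. Qed.

Let PA (p : {poly F}) := forall i, A p`_i.
Let PJ (p : {poly F}) := forall i, J p`_i.

Let Asum (I : Type) (r : seq I) (G : I -> F) :
  (forall i, A (G i)) -> A (\sum_(i <- r) G i).
Proof. by move=> AG; apply: big_ind => // *; apply: AD. Qed.
Let Jsum (I : Type) (r : seq I) (G : I -> F) :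
  (forall i, J (G i)) -> J (\sum_(i <- r) G i).
Proof. by move=> AG; apply: big_ind => // *; apply: JD. Qed.

Lemma adjoin_proper_ideal y :
  (forall g, PJ g -> g.[y] != 1) -> A y.
Proof.
move=> Hy; pose B : set (bool * F) := fun bx =>
  exists2 g, (if bx.1 then PA g else PJ g) & bx.2 = g.[y].
have PAC c : A c -> PA c%:P by move=> Ac i; rewrite coefC; case: (i == 0%N).
have PJC c : J c -> PJ c%:P by move=> Ac i; rewrite coefC; case: (i == 0%N).
have SB : subset S B.
  by move=> [[] x] Sx; exists x%:P; rewrite /= ?hornerC //; [apply: PAC|apply: PJC].
have By : B (true, y).
  by exists 'X; rewrite /= ?hornerX // => i; rewrite coefX; case: (i == 1%N).
apply: (S_max SB _ By); split=> /=.
- split; first exact: SB.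
  by move=> [g /= Pg g1]; have := Hy g Pg; rewrite -g1 eqxx.
- move=> _ _ [g /= Pg ->] [h /= Ph ->]; split.
    by exists (g - h); rewrite /= ?hornerD ?hornerN // => i; rewrite coefB; apply: AB.
  exists (g * h); rewrite /= ?hornerM // => i; rewrite coefM.
  by apply: Asum => j; apply: AM.
- by move=> _ [g /= Pg ->]; exists g => //= i; apply: JA.
- split; first exact: SB.
  move=> _ _ [g /= Pg ->] [h /= Ph ->].
  by exists (g - h); rewrite /= ?hornerD ?hornerN // => i; rewrite coefB; apply: JB.
- move=> _ _ [g /= Pg ->] [h /= Ph ->].
  exists (g * h); rewrite /= ?hornerM // => i; rewrite coefM.
  by apply: Jsum => j; apply: JM.
Qed.

Let horner_rev (g : {poly F}) (y : F) n : y != 0 -> (size g <= n.+1)%N ->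
  y ^+ n * g.[y^-1] = \sum_(i < n.+1) g`_i * y ^+ (n - i).
Proof.
move=> y0 sg; rewrite (horner_coef_wide _ sg) mulr_sumr; apply: eq_bigr => i _.
rewrite mulrCA; congr (_ * _); rewrite exprVn.
apply: (canLR (mulfK (expf_neq0 _ y0))).
by rewrite -exprD subnK // -ltnS.
Qed.

(** The inverse of s = 1 - j can be adjoined without making the ideal improper:
    a relation for 1 in 1/s, multiplied by a power of s, puts that power in J,
    while it is congruent to 1 modulo J. *)
Lemma maximal_unit j : J j -> A (1 - j)^-1.
Proof.
move=> Jj; have s0 : 1 - j != 0.
  by apply/eqP => /eqP; rewrite subr_eq0 => /eqP j1; apply: JN1; rewrite j1.
apply: adjoin_proper_ideal => g Pg; apply/eqP => g1.
have sg : (size g <= (size g).+1)%N by [].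
have As : A (1 - j) by apply: AB => //; apply: JA.
have AX n : A ((1 - j) ^+ n) by elim: n => [|n IH]; rewrite ?expr0 // exprS; apply: AM.
have JX n : J (1 - (1 - j) ^+ n).
  elim: n => [|n IH]; first by rewrite expr0 subrr.
  have -> : 1 - (1 - j) ^+ n.+1 = (1 - j) * (1 - (1 - j) ^+ n) + j.
    by rewrite exprS mulrBr mulr1 addrAC subrK.
  by apply: JD => //; apply: JM.
have := horner_rev s0 sg; rewrite g1 mulr1 => E.
have : J ((1 - j) ^+ size g).
  by rewrite E; apply: Jsum => i; rewrite mulrC; apply: JM.
by move=> /(JD (JX (size g))); rewrite subrK.
Qed.

(** If 1 is a combination with coefficients in J of powers of y and of powers
    of 1/y, the longer of the two can be shortened: the constant term of the
    shorter one can be divided out because 1 + J consists of units. *)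
Lemma shorten_relation n m (g h : {poly F}) y : y != 0 -> PJ g -> PJ h ->
  (m <= n)%N -> (0 < n)%N -> (size g <= n.+1)%N -> (size h <= m.+1)%N ->
  g.[y] = 1 -> h.[y^-1] = 1 ->
  exists2 g', PJ g' & (size g' <= n)%N /\ g'.[y] = 1.
Proof.
move=> y0 Pg Ph mn n0 sg sh g1 h1; pose u := (1 - h`_0)^-1.
have u0 : 1 - h`_0 != 0.
  by apply/eqP => /eqP; rewrite subr_eq0 => /eqP j1; apply: JN1; rewrite j1.
have Au : A u by apply: maximal_unit.
pose k := \poly_(i < n) (if (n - i <= m)%N then u * h`_(n - i) else 0).
pose g0 := \poly_(i < n) g`_i.
have Pg0 : PJ g0 by move=> i; rewrite coef_poly; case: ifP.
have Pk : PJ k.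
  move=> i; rewrite coef_poly; case: ifP => // _; case: ifP => // _.
  exact: JM.
have hE : y ^+ n = k.[y].
  have := horner_rev y0 (leq_trans sh (mn : (m.+1 <= n.+1)%N)).
  rewrite h1 mulr1 big_ord_recl subn0 => E.
  apply: (mulfI u0); rewrite mulrBl mul1r {1}E addrC addKr horner_poly mulr_sumr.
  rewrite (reindex_inj rev_ord_inj); apply: eq_bigr => i _ /=.
  rewrite /bump /= add1n subnSK // subKn; last exact: ltnW.
  case: leqP => mi; last by rewrite nth_default ?mul0r ?mulr0 // (leq_trans sh).
  by rewrite !mulrA mulfV // mul1r.
exists (g0 + g`_n *: k).
  move=> i; rewrite coefD coefZ; apply: JD => //; apply: JM => //.
  exact/JA.
split.
  rewrite (leq_trans (size_polyD _ _)) // geq_max size_poly /=.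
  by rewrite (leq_trans (size_scale_leq _ _)) // size_poly.
rewrite hornerD hornerZ -hE -g1 (horner_coef_wide _ sg) big_ord_recr /=.
by rewrite horner_poly.
Qed.

Lemma maximal_total y : y != 0 -> A y \/ A y^-1.
Proof.
move=> y0; apply: contrapT => /not_orP[nAy nAy'].
have ex z : ~ A z -> exists n, `[< exists2 g, PJ g & (size g <= n.+1)%N /\ g.[z] = 1 >].
  move=> nAz; apply: contrapT => nex; apply: nAz; apply: adjoin_proper_ideal.
  move=> g Pg; apply/eqP => g1; apply: nex; exists (size g); apply/asboolP.
  by exists g => //; split.
have [n /asboolP[g Pg [sg g1]] nmin] := ex_minnP (ex _ nAy).
have [m /asboolP[h Ph [sh h1]] mmin] := ex_minnP (ex _ nAy').
have pos z (q : {poly F}) k : PJ q -> (size q <= k.+1)%N -> q.[z] = 1 -> (0 < k)%N.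
  case: k => // Pq sq q1; case: JN1.
  by rewrite -q1 (size1_polyC sq) hornerC.
have n0 := pos _ _ _ Pg sg g1; have m0 := pos _ _ _ Ph sh h1.
have [mn|/ltnW nm] := leqP m n.
  have [g' Pg' [sg' g1']] := shorten_relation y0 Pg Ph mn n0 sg sh g1 h1.
  have : (n <= n.-1)%N.
    by apply: nmin; apply/asboolP; exists g' => //; rewrite prednK.
  by rewrite -ltnS prednK // ltnn.
have g1' : g.[y^-1^-1] = 1 by rewrite invrK.
have y0' : y^-1 != 0 by rewrite invr_eq0.
have [g' Pg' [sg' g1'']] := shorten_relation y0' Ph Pg nm m0 sh sg h1 g1'.
have : (m <= m.-1)%N.
  by apply: mmin; apply/asboolP; exists g' => //; rewrite prednK.
by rewrite -ltnS prednK // ltnn.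
Qed.

Lemma maximal_valuation : exists w : valuation F,
  (forall x, A x -> vdvd w 1 x) /\ (forall x, J x -> vsdvd w 1 x).
Proof.
pose V : {pred F} := fun x => `[< A x >].
have VP x : (x \in V) = `[< A x >] by [].
have V_ring : subring_closed V.
  split; rewrite ?VP; first exact/asboolP.
    by move=> x y /asboolP Ax /asboolP Ay; apply/asboolP; apply: AB.
  by move=> x y /asboolP Ax /asboolP Ay; apply/asboolP; apply: AM.
have V_total x : (x \in V) || (x^-1 \in V).
  have [->|x0] := eqVneq x 0; first by apply/orP; left; apply/asboolP.
  by case: (maximal_total x0) => ?; apply/orP; [left|right]; apply/asboolP.
exists (valuation_of_ring V_ring V_total); split=> x.
  by move=> Ax; rewrite vdvd1 val_ring_of_ring VP; apply/asboolP.
move=> Jx; rewrite /vsdvd /vdvd; have [_|x0] := eqVneq x 0; first exact: oner_neq0.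
rewrite val_ring_of_ring VP; apply/asboolP => Ax; apply: JN1.
by rewrite -(mulVf x0); apply: JM; rewrite // -div1r.
Qed.

End Maximal.

(** Chevalley's extension theorem: a maximal pair is a valuation ring with an
    ideal inside its maximal ideal. *)
Lemma chevalley (A J : F -> Prop) :
    A 1 -> (forall x y, A x -> A y -> A (x - y)) ->
    (forall x y, A x -> A y -> A (x * y)) ->
    (forall x, J x -> A x) -> J 0 -> (forall x y, J x -> J y -> J (x - y)) ->
    (forall x y, A x -> J y -> J (x * y)) -> ~ J 1 ->
  exists w : valuation F,
    (forall x, A x -> vdvd w 1 x) /\ (forall x, J x -> vsdvd w 1 x).
Proof.
move=> A1 AB AM JA J0 JB JM JN1.
pose S : set (bool * F) := fun bx => if bx.1 then A bx.2 else J bx.2.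
have S_good : subring_ideal S.
  by split=> //= x y Ax Ay; split; [apply: AB|apply: AM].
have [M [SM gM maxM]] := zorn_above S_good subring_ideal_chain.
have [w [wA wJ]] := maximal_valuation gM maxM.
exists w; split=> x ?; first by apply: wA; apply: (SM (true, x)).
by apply: wJ; apply: (SM (false, x)).
Qed.

End Chevalley.

(** * Integral elements over a henselian field *)

Section SumsOfTerms.
Variables (K : fieldType) (v : valuation K).

Lemma exists_vmin (I : eqType) (s : seq I) (G : I -> K) i : i \in s ->
  exists2 i0, i0 \in s & {in s, forall j, vdvd v (G i0) (G j)}.
Proof.
elim: s i => // a s IHs i _.
case: s IHs => [|b s] IHs.
  exists a; first exact: mem_head.
  by move=> j; rewrite inE => /eqP->; apply: vdvdxx.
have [i0 i0s Hi0] := IHs b (mem_head _ _).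
have /orP[ai|ia] := vdvd_total v (G a) (G i0).
  exists a; first exact: mem_head.
  move=> j; rewrite inE => /predU1P[->|js]; first exact: vdvdxx.
  exact: vdvd_trans ai (Hi0 _ js).
exists i0; first by rewrite inE i0s orbT.
by move=> j; rewrite inE => /predU1P[->|/Hi0].
Qed.

(** If the nonzero terms have pairwise distinct values, the term of least value
    dominates the sum. *)
Lemma vdvd_sum_distinct (I : finType) (G : I -> K) :
    (forall i j, i != j -> G i != 0 -> G j != 0 ->
       vdvd v (G i) (G j) -> vdvd v (G j) (G i) -> False) ->
  forall i, vdvd v (\sum_j G j) (G i).
Proof.
move=> dist i.
have [i0 _ Hi0] := exists_vmin G (mem_enum predT i : i \in enum I).
have {}Hi0 j : vdvd v (G i0) (G j) by apply: Hi0; rewrite mem_enum.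
apply: vdvd_trans (Hi0 i); have [Gi0|Gi0] := eqVneq (G i0) 0.
  by rewrite Gi0 vdvd0.
rewrite (bigD1 i0) //=; apply: vsdvd_addl; apply: vsdvd_sum => // j ji0.
have [Gj0|Gj0] := eqVneq (G j) 0; first by rewrite Gj0 vsdvdx0.
by apply/negP => h; apply: (dist i0 j) => //; rewrite eq_sym.
Qed.

End SumsOfTerms.

Section MinimalPolynomials.
Variables (K F : fieldType) (iota : {rmorphism K -> F}).

Lemma minpoly_exists y : algebraicOver iota y ->
  exists2 p : {poly K}, irreducible_poly p & root (map_poly iota p) y.
Proof.
move=> [p0 p00 rp0].
have ex : exists n, `[< exists p : {poly K}, [/\ p != 0, root (map_poly iota p) y & size p = n] >].
  by exists (size p0); apply/asboolP; exists p0.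
have [n /asboolP[p [p_n0 rp <-]] nmin] := ex_minnP ex.
exists p => //; apply/(subfx_irreducibleP rp p_n0) => q rq q0.
by apply: nmin; apply/asboolP; exists q.
Qed.

Lemma minpoly_dvd (p q : {poly K}) y : irreducible_poly p ->
  root (map_poly iota p) y -> root (map_poly iota q) y -> p %| q.
Proof.
move=> p_irr py qy; have [_ min_p] := p_irr; have p0 := irredp_neq0 p_irr.
suff : gcdp p q %= p by rewrite eqp_sym => /eqp_dvdl->; apply: dvdp_gcdr.
apply: min_p; rewrite ?dvdp_gcdl // -(size_map_poly iota) gtn_eqF //.
rewrite (@root_size_gt1 _ y) ?map_poly_eq0 ?gcdp_eq0 ?(negPf p0) //.
by rewrite gcdp_map root_gcd py.
Qed.

(** The homogenisation of f at (g : h). *)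
Definition homog (f g h : {poly K}) : {poly K} :=
  \sum_(i < size f) f`_i *: (g ^+ i * h ^+ ((size f).-1 - i)).

Lemma horner_homog f g h y : (map_poly iota h).[y] != 0 ->
  (map_poly iota (homog f g h)).[y] = (map_poly iota h).[y] ^+ (size f).-1
    * (map_poly iota f).[(map_poly iota g).[y] / (map_poly iota h).[y]].
Proof.
move=> h0; rewrite /homog rmorph_sum horner_sum.
rewrite (@horner_coef_wide _ (size f) (map_poly iota f)) ?size_map_poly // mulr_sumr.
apply: eq_bigr => i _; rewrite /= map_polyZ hornerZ rmorphM !rmorphXn hornerM.
rewrite !horner_exp coef_map [RHS]mulrCA; congr (_ * _).
have le : (i <= (size f).-1)%N by rewrite -ltnS prednK // (leq_ltn_trans _ (ltn_ord i)).
by rewrite expr_div_n mulrCA -expfB_cond ?mulr1 // (negPf h0).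
Qed.

End MinimalPolynomials.

(** After homogenisation an equation for g(y) / h(y) is a polynomial equation
    for y, which is a multiple of p and thus holds for the conjugate y' too. *)
Lemma conjugate_root (K F F' : fieldType) (iota : {rmorphism K -> F})
    (iota' : {rmorphism K -> F'}) (p f g h : {poly K}) y y' :
    irreducible_poly p -> root (map_poly iota p) y -> root (map_poly iota' p) y' ->
    (map_poly iota h).[y] != 0 ->
    root (map_poly iota f) ((map_poly iota g).[y] / (map_poly iota h).[y]) ->
  root (map_poly iota' f) ((map_poly iota' g).[y'] / (map_poly iota' h).[y']).
Proof.
move=> p_irr py py' hy; rewrite /root => /eqP fy.
have transfer (q : {poly K}) : (map_poly iota q).[y] == 0 -> (map_poly iota' q).[y'] == 0.
  move=> qy; have /dvdpP[r ->] := minpoly_dvd p_irr py qy.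
  by rewrite rmorphM hornerM (eqP py') mulr0.
have hy' : (map_poly iota' h).[y'] != 0.
  apply: contra hy => hy'; have /dvdpP[r ->] := minpoly_dvd p_irr py' hy'.
  by rewrite rmorphM hornerM (eqP py) mulr0.
have := transfer (homog f g h); rewrite !horner_homog // fy mulr0 eqxx => /(_ isT).
by rewrite mulf_eq0 expf_eq0 (negPf hy') andbF.
Qed.

Section Extension.
Variables (K F : fieldType) (iota : {rmorphism K -> F}) (v : valuation K).

Definition integral_over (y : F) := exists p : {poly K},
  [/\ p \is monic, p \is a polyOver (val_ring v) & root (map_poly iota p) y].

Lemma polyOver_val_ring p : p \is a polyOver (val_ring v) -> forall i, vdvd v 1 p`_i.
Proof. by move=> /polyOverP h i; rewrite vdvd1. Qed.

Lemma extends_vdvd w : extends iota v w ->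
  forall x y, vdvd w (iota x) (iota y) = vdvd v x y.
Proof. by move=> vw x y; rewrite -vdvd_restrict (vdvd_equiv vw). Qed.

Lemma extends_vsdvd w : extends iota v w ->
  forall x y, vsdvd w (iota x) (iota y) = vsdvd v x y.
Proof. by move=> vw x y; rewrite /vsdvd extends_vdvd. Qed.

Lemma extends_dominates w : (forall c, vdvd v 1 c -> vdvd w 1 (iota c)) ->
  (forall c, vsdvd v 1 c -> vsdvd w 1 (iota c)) -> extends iota v w.
Proof.
move=> hO hm c; rewrite -!vdvd1 vdvd_restrict rmorph1.
apply/idP/idP; last exact: hO.
apply: contraTT => hc.
have c0 : c != 0 by apply: contraNneq hc => ->; apply: vdvd0.
have : vsdvd v 1 c^-1 by rewrite -invr1 vsdvdV ?oner_neq0.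
move/hm; rewrite fmorphV -invr1 vsdvdV ?oner_neq0 // ?fmorph_eq0 //.
by rewrite invr1.
Qed.

Lemma extension_exists : exists w : valuation F, extends iota v w.
Proof.
have [||||||||w [wA wJ]] := @chevalley F (fun x => exists2 c, vdvd v 1 c & x = iota c)
  (fun x => exists2 c, vsdvd v 1 c & x = iota c).
- by exists 1; rewrite ?vdvdxx ?rmorph1.
- by move=> _ _ [a a1 ->] [b b1 ->]; exists (a - b); rewrite ?vdvdB ?rmorphB.
- by move=> _ _ [a a1 ->] [b b1 ->]; exists (a * b); rewrite ?vdvd1M ?rmorphM.
- by move=> _ [a a1 ->]; exists a; rewrite // vsdvdW.
- by exists 0; rewrite ?vsdvdx0 ?oner_neq0 ?rmorph0.
- by move=> _ _ [a a1 ->] [b b1 ->]; exists (a - b); rewrite ?vsdvdB ?rmorphB.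
- move=> _ _ [a a1 ->] [b b1 ->]; exists (a * b); rewrite ?rmorphM //.
  by rewrite -[1]mulr1 vsdvdMl ?oner_neq0.
- move=> [a a1 /esym/eqP]; rewrite fmorph_eq1 => /eqP a_1.
  by rewrite a_1 vsdvdxx in a1.
exists w; apply: extends_dominates => c c1; first by apply: wA; exists c.
by apply: wJ; exists c.
Qed.

(** If x is not integral, the maximal ideal of v and 1/x generate a proper ideal
    of the ring generated by 1/x, and Chevalley's theorem provides a valuation
    positive on that ideal. *)
Lemma not_integral_extension x : ~ integral_over x ->
  exists2 w : valuation F, extends iota v w & vsdvd w x 1.
Proof.
move=> nint.
have x0 : x != 0.
  apply/eqP => x0; apply: nint; exists 'X.
  by rewrite monicX polyOverX map_polyX x0 rootX.
pose ev (g : {poly K}) := (map_poly iota g).[x^-1].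
have evB g h : ev (g - h) = ev g - ev h by rewrite /ev rmorphB hornerD hornerN.
have evM g h : ev (g * h) = ev g * ev h by rewrite /ev rmorphM hornerM.
have evC c : ev c%:P = iota c by rewrite /ev map_polyC hornerC.
pose inO (g : {poly K}) := g \is a polyOver (val_ring v).
have [||||||||w [wA wJ]] := @chevalley F (fun y => exists2 g, inO g & y = ev g)
  (fun y => exists2 g, inO g && vsdvd v 1 g`_0 & y = ev g).
- by exists 1; rewrite /inO ?rpred1 // /ev rmorph1 hornerC.
- by move=> _ _ [a a1 ->] [b b1 ->]; exists (a - b); rewrite ?evB // /inO rpredB.
- by move=> _ _ [a a1 ->] [b b1 ->]; exists (a * b); rewrite ?evM // /inO rpredM.
- by move=> _ [a /andP[a1 _] ->]; exists a.
- exists 0; last by rewrite /ev rmorph0 horner0.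
  by rewrite /inO rpred0 coef0 vsdvdx0 oner_neq0.
- move=> _ _ [a /andP[a1 a2] ->] [b /andP[b1 b2] ->]; exists (a - b); rewrite ?evB //.
  by rewrite /inO rpredB // coefB vsdvdB.
- move=> _ _ [a a1 ->] [b /andP[b1 b2] ->]; exists (a * b); rewrite ?evM //.
  rewrite /inO rpredM //= coef0M -[1]mulr1 vsdvdMl ?oner_neq0 //.
  exact: polyOver_val_ring.
- move=> [g /andP[gO g0] /esym g1]; apply: nint.
  pose c := 1 - g`_0.
  have c1 : vdvd v c 1.
    by apply: vsdvd_addl; rewrite vsdvdNr.
  have c0 : c != 0 by apply: vdvd_neq0 c1 (oner_neq0 _).
  have n0 : (0 < size g)%N.
    rewrite lt0n size_poly_eq0; apply: contra_eq_neq g1 => ->.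
    by rewrite /ev rmorph0 horner0 eq_sym oner_neq0.
  pose n := (size g).-1.
  pose q : {poly K} := 'X^n - \sum_(i < n) (g`_i.+1 / c) *: 'X^(n - i.+1).
  have sq : (size (\sum_(i < n) (g`_i.+1 / c) *: 'X^(n - i.+1) : {poly K})%R < n.+1)%N.
    rewrite ltnS; apply: (leq_trans (size_sum _ _ _)); apply/bigmax_leqP => i _.
    rewrite (leq_trans (size_scale_leq _ _)) // size_polyXn.
    by rewrite subnSK // leq_subr.
  exists q; split.
  + by rewrite monicE lead_coefDl ?size_polyN ?size_polyXn // lead_coefXn.
  + rewrite rpredB ?rpredX ?polyOverX // rpred_sum // => i _.
    rewrite polyOverZ ?rpredX ?polyOverX // -vdvd1.
    apply: vdvd1M; first exact: polyOver_val_ring.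
    by rewrite -invr1 vdvdV ?oner_neq0.
  have ng : size g = n.+1 by rewrite prednK.
  have E : x ^+ n * iota c = \sum_(i < n) iota g`_i.+1 * x ^+ (n - i.+1).
    have : x ^+ n * ev g = \sum_(i < n.+1) iota g`_i * x ^+ (n - i).
      rewrite /ev (@horner_coef_wide _ n.+1) ?size_map_poly ?ng // mulr_sumr.
      apply: eq_bigr => i _; rewrite coef_map mulrCA; congr (_ * _).
      by rewrite exprVn -expfB_cond // (negPf x0) add0n -ltnS.
    rewrite g1 mulr1 big_ord_recl subn0 => E.
    by rewrite rmorphB rmorph1 mulrBr mulr1 {1}E [iota _ * _]mulrC addrC addKr.
  rewrite /root rmorphB rmorph_sum hornerD hornerN horner_sum subr_eq0.
  rewrite /= map_polyXn hornerXn; apply/eqP.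
  have ic0 : iota c != 0 by rewrite fmorph_eq0.
  apply: (mulIf ic0); rewrite E mulr_suml; apply: eq_bigr => i _.
  by rewrite /= map_polyZ hornerZ map_polyXn hornerXn fmorph_div mulrAC divfK.
exists w.
  apply: extends_dominates => c c1.
    by apply: wA; exists c%:P; rewrite ?evC // /inO polyOverC -vdvd1.
  apply: wJ; exists c%:P; rewrite ?evC // /inO polyOverC -vdvd1 coefC /= c1.
  by rewrite vsdvdW.
have : vsdvd w 1 x^-1.
  apply: wJ; exists 'X; rewrite /inO ?polyOverX ?coefX /= ?vsdvdx0 ?oner_neq0 //.
  by rewrite /ev map_polyX hornerX.
by rewrite -[1]invr1 vsdvdV ?oner_neq0 // invr1.
Qed.

Lemma vdvd_integral w y : extends iota v w -> integral_over y -> vdvd w 1 y.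
Proof.
move=> vw [p [p_mon pO /eqP py]]; rewrite -[vdvd _ _ _]negbK; apply/negP => y1.
have y0 := vsdvd_neq0 y1.
pose n := (size p).-1; have pn : size p = n.+1.
  by rewrite prednK // lt0n size_poly_eq0 monic_neq0.
have E : y ^+ n = - \sum_(i < n) iota p`_i * y ^+ i.
  apply/eqP; rewrite -addr_eq0 addrC; apply/eqP; rewrite -[RHS]py.
  rewrite (@horner_coef_wide _ n.+1) ?size_map_poly ?pn // big_ord_recr /= coef_map /=.
  have -> : p`_n = 1 by apply/monicP.
  rewrite rmorph1 mul1r; congr (_ + _).
  by apply: eq_bigr => i _; rewrite coef_map.
have : vsdvd w (y ^+ n) (y ^+ n).
  rewrite {2}E vsdvdNr vsdvd_sum ?expf_neq0 // => i _.
  have -> : y ^+ n = y ^+ (n - i) * y ^+ i by rewrite -exprD subnK // ltnW.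
  rewrite vsdvd_mul2r ?expf_neq0 //.
  apply: (vsdvd_dvd_trans (y := 1)).
    by rewrite -(expr1n _ (n - i)) vsdvdX // subn_gt0.
  by rewrite -(rmorph1 iota) (extends_vdvd vw); apply: polyOver_val_ring.
by rewrite vsdvdxx.
Qed.

(** Over an algebraic extension the value group is torsion modulo that of the
    base: otherwise the terms of an algebraic equation have distinct values
    and cannot cancel. *)
Lemma algebraic_torsion w y : extends iota v w -> algebraicOver iota y -> y != 0 ->
  exists n c, [/\ (0 < n)%N, c != 0, vdvd w (y ^+ n) (iota c) & vdvd w (iota c) (y ^+ n)].
Proof.
move=> vw [p p0 /eqP py] y0; apply: contrapT => H.
pose G (i : 'I_(size p)) := iota p`_i * y ^+ i.
have sumG : \sum_i G i = 0.
  rewrite -[RHS]py (@horner_coef_wide _ (size p)) ?size_map_poly //.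
  by apply: eq_bigr => i _; rewrite coef_map.
have step (i j : 'I_(size p)) : (i < j)%N -> G i != 0 -> G j != 0 ->
    vdvd w (G i) (G j) -> vdvd w (G j) (G i) -> False.
  move=> ij; rewrite !mulf_eq0 !negb_or !fmorph_eq0 => /andP[pi0 _] /andP[pj0 _].
  have Gj : G j = iota p`_j * y ^+ (j - i) * y ^+ i.
    by rewrite /G -mulrA -exprD subnK // ltnW.
  rewrite Gj !vdvd_mul2r ?expf_neq0 // => h1 h2; apply: H.
  exists (j - i)%N, (p`_i / p`_j); rewrite subn_gt0 ij mulf_neq0 ?invr_eq0 //.
  have ipj : iota p`_j != 0 by rewrite fmorph_eq0.
  by split=> //; rewrite -(vdvd_mul2l w _ _ ipj) fmorph_div mulrCA mulfV // mulr1.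
have distinct : forall i : 'I_(size p), vdvd w (\sum_j G j) (G i).
  apply: vdvd_sum_distinct => i j; rewrite -val_eqE /= neq_ltn => /orP[|] ij Gi Gj h1 h2.
    exact: (step i j).
  exact: (step j i).
have sp : ((size p).-1 < size p)%N by rewrite prednK // lt0n size_poly_eq0.
have := distinct (Ordinal sp); rewrite sumG vdvd0x /G /= mulf_eq0 fmorph_eq0.
by rewrite expf_eq0 (negPf y0) andbF orbF -lead_coefE lead_coef_eq0 (negPf p0).
Qed.

End Extension.

Section Henselian.
Variables (K : fieldType) (Kt : closedFieldType) (iota : {rmorphism K -> Kt}).
Hypothesis Kt_closure : algebraic_extension iota.
Variable v : valuation K.
Hypothesis v_henselian : henselian iota v.

Lemma henselian_closure_integral w y : extends iota v w -> vdvd w 1 y ->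
  integral_over iota v y.
Proof.
move=> vw y1; apply: contrapT => /not_integral_extension[w' vw' y1'].
have [w0 _ uniq0] := v_henselian.
have ww' : val_equiv w w'.
  by move=> x; rewrite -(uniq0 _ vw) -(uniq0 _ vw').
by move: y1'; rewrite -(vsdvd_equiv ww') /vsdvd y1.
Qed.

Variables (F : fieldType) (kappa : {rmorphism K -> F}).
Hypothesis F_alg : algebraic_extension kappa.

(** In the algebraic closure the valuation is unique, so the elements of
    nonnegative value are integral there. The element y of another algebraic
    extension behaves like a conjugate eta of it in the closure: if eta had a negative value, that of
    eta ^+ n = c * unit say, then c / eta ^+ n would be integral and so would
    c / y ^+ n, against v c < 0 <= u y. *)
Lemma henselian_integral u y : extends kappa v u -> vdvd u 1 y ->
  integral_over kappa v y.
Proof.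
move=> vu y1; have [w vw _] := v_henselian.
have [p p_irr py] := minpoly_exists (F_alg y).
have /closed_rootP[eta peta] : size (map_poly iota p) != 1.
  by rewrite size_map_poly; have [+ _] := p_irr; case: ltngtP.
have [eta1|eta1] := boolP (vdvd w 1 eta).
  have [f [f_mon fO feta]] := henselian_closure_integral vw eta1.
  exists f; split=> //; have /dvdpP[r ->] := minpoly_dvd p_irr peta feta.
  by rewrite rmorphM rootM py orbT.
have eta0 : eta != 0 by apply: contraNneq eta1 => ->; apply: vdvd0.
have [n [c [n0 c0 ec ce]]] := algebraic_torsion vw (Kt_closure eta) eta0.
have c1 : vsdvd v c 1.
  rewrite -(extends_vsdvd vw) rmorph1; apply: vdvd_sdvd_trans ce _.
  by rewrite -(expr1n _ n) vsdvdX.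
have : vdvd w 1 (iota c / eta ^+ n).
  by rewrite -(vdvd_mul2r w _ _ (expf_neq0 n eta0)) divfK ?expf_neq0 // mul1r.
move=> /(henselian_closure_integral vw)[f [f_mon fO feta]].
have y0 : y != 0.
  apply: contraNneq eta0 => y0; move: py peta; rewrite y0 => py.
  have /dvdpP[r Xr] : p %| 'X by apply: (minpoly_dvd p_irr py); rewrite map_polyX rootX.
  have h q : root (map_poly iota p) q -> q = 0.
    move=> pq; have : root (map_poly iota 'X) q by rewrite Xr rmorphM rootM pq orbT.
    by rewrite map_polyX rootX => /eqP.
  by move/h => ->.
have fy : root (map_poly kappa f) (kappa c / y ^+ n).
  have := @conjugate_root _ _ _ iota kappa p f c%:P 'X^n _ _ p_irr peta py.
  rewrite !map_polyC !map_polyXn !hornerC !hornerXn; apply=> //.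
  exact: expf_neq0.
have : vdvd u 1 (kappa c / y ^+ n) by apply: (vdvd_integral vu); exists f.
rewrite -(vdvd_mul2r u _ _ (expf_neq0 n y0)) divfK ?expf_neq0 // mul1r => yc.
have : vdvd u 1 (kappa c) by apply: vdvd_trans yc; rewrite vdvd1X.
by rewrite -(rmorph1 kappa) (extends_vdvd vu); move: c1; rewrite /vsdvd => /negPf->.
Qed.

Lemma henselian_unique u u' : extends kappa v u -> extends kappa v u' ->
  val_equiv u u'.
Proof.
move=> vu vu' x; rewrite -!vdvd1; apply/idP/idP.
  by move/(henselian_integral vu); apply: vdvd_integral.
by move/(henselian_integral vu'); apply: vdvd_integral.
Qed.

End Henselian.

(** * Bases, traces and norms *)

Section Bases.
Variables (L M : fieldType) (iota : {rmorphism L -> M}).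

(** The coordinate functions are part of the data, and the base field is given
    by a morphism, so that field extensions, residue field extensions and
    towers of such are treated alike. *)
Definition is_basis (I : finType) (b : I -> M) (c : M -> I -> L) :=
  (forall x, x = \sum_i iota (c x i) * b i) /\
  (forall (d : I -> L) i, c (\sum_j iota (d j) * b j) i = d i).

Section OneBasis.
Variables (I : finType) (b : I -> M) (c : M -> I -> L).
Hypothesis bP : is_basis b c.

Lemma basis_sum x : x = \sum_i iota (c x i) * b i.
Proof. by case: bP => h _; apply: h. Qed.

Lemma coord_basis_sum (d : I -> L) i : c (\sum_j iota (d j) * b j) i = d i.
Proof. by case: bP => _ h; apply: h. Qed.

Lemma coord_basisD x y i : c (x + y) i = c x i + c y i.
Proof.
rewrite {1}(basis_sum x) {1}(basis_sum y) -big_split /=.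
rewrite -(coord_basis_sum (fun i => c x i + c y i)); congr (c _ _).
by apply: eq_bigr => j _; rewrite rmorphD mulrDl.
Qed.

Lemma coord_basisZ a x i : c (iota a * x) i = a * c x i.
Proof.
rewrite {1}(basis_sum x) mulr_sumr -(coord_basis_sum (fun i => a * c x i)).
by congr (c _ _); apply: eq_bigr => j _; rewrite rmorphM mulrA.
Qed.

Lemma coord_basis0 i : c 0 i = 0.
Proof. by have := coord_basisZ 0 0 i; rewrite !mul0r rmorph0 mul0r. Qed.

Lemma coord_basisN x i : c (- x) i = - c x i.
Proof. by rewrite -mulN1r -(rmorphN1 iota) coord_basisZ mulN1r. Qed.

Lemma coord_basis_big (J : Type) (r : seq J) (G : J -> M) i :
  c (\sum_(j <- r) G j) i = \sum_(j <- r) c (G j) i.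
Proof.
elim: r => [|j r IHr]; first by rewrite !big_nil coord_basis0.
by rewrite !big_cons coord_basisD IHr.
Qed.

Lemma coord_basisE i j : c (b i) j = (i == j)%:R.
Proof.
rewrite -(coord_basis_sum (fun j => (i == j)%:R)); congr (c _ _).
rewrite (bigD1 i) //= eqxx rmorph1 mul1r big1 ?addr0 // => k /negPf ki.
by rewrite eq_sym ki rmorph0 mul0r.
Qed.

Lemma card_basis_gt0 : (0 < #|I|)%N.
Proof.
rewrite lt0n; apply/eqP => /card0_eq I0; have := oner_neq0 M.
by rewrite (basis_sum 1) big1 ?eqxx // => i; have := I0 i; rewrite !inE.
Qed.

End OneBasis.

Definition basis_trace (I : finType) (b : I -> M) (c : M -> I -> L) x :=
  \sum_i c (x * b i) i.

Lemma basis_traceD (I : finType) b c : @is_basis I b c ->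
  {morph basis_trace b c : x y / x + y}.
Proof.
move=> bP x y; rewrite -big_split; apply: eq_bigr => i _.
by rewrite mulrDl (coord_basisD bP).
Qed.

Lemma basis_traceZ (I : finType) b c : @is_basis I b c ->
  forall a x, basis_trace b c (iota a * x) = a * basis_trace b c x.
Proof.
move=> bP a x; rewrite mulr_sumr; apply: eq_bigr => i _.
by rewrite -mulrA (coord_basisZ bP).
Qed.

Lemma basis_trace_indep (I J : finType) b c (b' : J -> M) c' :
  @is_basis I b c -> is_basis b' c' -> basis_trace b c =1 basis_trace b' c'.
Proof.
move=> bP bP' x; rewrite /basis_trace.
transitivity (\sum_i \sum_j c' (x * b i) j * c (b' j) i).
  apply: eq_bigr => i _; rewrite {1}(basis_sum bP' (x * b i)) (coord_basis_big bP).
  by apply: eq_bigr => j _; rewrite (coord_basisZ bP).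
rewrite exchange_big; apply: eq_bigr => j _ /=.
rewrite [in RHS](basis_sum bP (b' j)) mulr_sumr (coord_basis_big bP').
by apply: eq_bigr => i _; rewrite mulrCA (coord_basisZ bP') mulrC.
Qed.

Lemma basis_reindex (I J : finType) (b : I -> M) c (f : J -> I) (g : I -> J) :
  is_basis b c -> cancel f g -> cancel g f ->
  is_basis (fun j => b (f j)) (fun x j => c x (f j)).
Proof.
move=> bP fK gK; split=> [x|d j].
  by rewrite {1}(basis_sum bP x) (reindex f) //=; exists g => i _; rewrite ?fK ?gK.
rewrite -{2}(fK j) -(coord_basis_sum bP (fun i => d (g i))); congr (c _ _).
rewrite [RHS](reindex f) /=; last by exists g => i _; rewrite ?fK ?gK.
by apply: eq_bigr => k _; rewrite fK.
Qed.

Lemma basis_ordinal (I : finType) (b : I -> M) c : is_basis b c ->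
  exists n b' c', #|I| = n.+1 /\ @is_basis 'I_n.+1 b' c'.
Proof.
move=> bP; have I0 := card_basis_gt0 bP.
have En : #|I| = #|I|.-1.+1 by rewrite prednK.
exists #|I|.-1.
pose f (i : 'I_#|I|.-1.+1) : I := enum_val (cast_ord (esym En) i).
pose g (i : I) : 'I_#|I|.-1.+1 := cast_ord En (enum_rank i).
exists (fun j => b (f j)), (fun x j => c x (f j)); split=> //.
apply: (basis_reindex (g := g) bP) => i; rewrite /f /g.
  by rewrite enum_valK cast_ordKV.
by rewrite cast_ordK enum_rankK.
Qed.

Definition mul_mx n (b : 'I_n -> M) (c : M -> 'I_n -> L) x : 'M[L]_n :=
  \matrix_(i, j) c (x * b i) j.

Section RegularRepresentation.
Variables (n : nat) (b : 'I_n.+1 -> M) (c : M -> 'I_n.+1 -> L).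
Hypothesis bP : is_basis b c.
Local Notation A := (mul_mx b c).

Lemma mul_mxD : {morph A : x y / x + y}.
Proof. by move=> x y; apply/matrixP => i j; rewrite !mxE mulrDl (coord_basisD bP). Qed.

Lemma mul_mxN : {morph A : x / - x}.
Proof. by move=> x; apply/matrixP => i j; rewrite !mxE mulNr (coord_basisN bP). Qed.

Lemma mul_mxM : {morph A : x y / x * y}.
Proof.
move=> x y; apply/matrixP => i j; rewrite !mxE.
rewrite mulrAC {1}(basis_sum bP (x * b i)) mulr_suml (coord_basis_big bP).
by apply: eq_bigr => k _; rewrite !mxE -mulrA (coord_basisZ bP) [b k * y]mulrC.
Qed.

Lemma mul_mxC a : A (iota a) = a%:M.
Proof.
apply/matrixP => i j; rewrite !mxE (coord_basisZ bP) (coord_basisE bP).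
by rewrite mulr_natr.
Qed.

Lemma mul_mx1 : A 1 = 1.
Proof. by rewrite -(rmorph1 iota) mul_mxC. Qed.

Lemma mul_mx_horner x (p : {poly L}) : A (map_poly iota p).[x] = horner_mx (A x) p.
Proof.
elim/poly_ind: p => [|p a IHp].
  by rewrite !rmorph0 horner0 -(rmorph0 iota) mul_mxC raddf0.
rewrite !rmorphD !rmorphM /= map_polyX map_polyC hornerMXaddC mul_mxD mul_mxM.
by rewrite IHp horner_mx_X horner_mx_C mul_mxC.
Qed.

Lemma trace_mul_mx x : \tr (A x) = basis_trace b c x.
Proof. by apply: eq_bigr => i _; rewrite mxE. Qed.

End RegularRepresentation.

End Bases.

Section BasisTower.
Variables (K L M : fieldType) (iota : {rmorphism K -> L}) (kappa : {rmorphism L -> M}).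
Variables (I J : finType) (b : I -> L) (c : L -> I -> K) (d : J -> M) (e : M -> J -> L).
Hypotheses (bP : is_basis iota b c) (dP : is_basis kappa d e).

Definition tower_basis (ij : I * J) := kappa (b ij.1) * d ij.2.
Definition tower_coord x (ij : I * J) := c (e x ij.2) ij.1.

Lemma tower_basisP :
  is_basis (kappa \o iota : {rmorphism K -> M}) tower_basis tower_coord.
Proof.
split=> [x|k [i0 j0]].
  rewrite -(pair_bigA _ (fun i j => kappa (iota (c (e x j) i)) * (kappa (b i) * d j))).
  rewrite exchange_big {1}(basis_sum dP x); apply: eq_bigr => j _ /=.
  rewrite {1}(basis_sum bP (e x j)) rmorph_sum mulr_suml.
  by apply: eq_bigr => i _; rewrite rmorphM mulrA.
rewrite /tower_coord /= -(coord_basis_sum bP (fun i => k (i, j0)) i0); congr (c _ _).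
rewrite -(coord_basis_sum dP (fun j => \sum_i iota (k (i, j)) * b i) j0).
congr (e _ _).
rewrite (eq_bigr (fun ij => kappa (iota (k (ij.1, ij.2))) * (kappa (b ij.1) * d ij.2)));
  last by case.
rewrite -(pair_bigA _ (fun i j => kappa (iota (k (i, j))) * (kappa (b i) * d j))).
rewrite exchange_big; apply: eq_bigr => j _ /=.
by rewrite rmorph_sum mulr_suml; apply: eq_bigr => i _; rewrite rmorphM mulrA.
Qed.

Lemma basis_trace_tower x : basis_trace tower_basis tower_coord x =
  basis_trace b c (basis_trace d e x).
Proof.
rewrite /basis_trace.
rewrite -(pair_bigA _ (fun i j => c (e (x * (kappa (b i) * d j)) j) i)) /=.
apply: eq_bigr => i _; rewrite mulr_suml (coord_basis_big bP).
apply: eq_bigr => j _; congr (c _ _).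
by rewrite mulrCA (coord_basisZ dP) mulrC.
Qed.

End BasisTower.

Lemma fieldExt_basis (L : fieldType) (M : fieldExtType L) :
  is_basis (base_emb M) (fun i : 'I_(\dim {:M}) => (vbasis {:M})`_i)
    (fun x i => coord (vbasis {:M}) i x).
Proof.
split=> [x|d i].
  rewrite {1}(coord_vbasis (memvf x)); apply: eq_bigr => i _.
  by rewrite /base_emb /= mulr_algl.
rewrite -(coord_sum_free d i (basis_free (vbasisP {:M}))); congr (coord _ _ _).
by apply: eq_bigr => j _; rewrite /base_emb /= mulr_algl.
Qed.

Section NilpotentReduction.
Variables (L : fieldType) (v : valuation L).

(** Monic polynomials with integral coefficients whose reduction is a power
    of the indeterminate. *)
Definition nil_monic (p : {poly L}) := [/\ p \is monic,
  forall i, vdvd v 1 p`_i & forall i, (i.+1 < size p)%N -> vsdvd v 1 p`_i].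

Lemma nil_monic_lower p i : nil_monic p -> i != (size p).-1 -> vsdvd v 1 p`_i.
Proof.
move=> [p_mon _ pm] ip; have [lt|le] := ltnP i.+1 (size p); first exact: pm.
rewrite nth_default ?vsdvdx0 ?oner_neq0 //.
move: le ip; rewrite leq_eqVlt => /orP[/eqP->|]; first by rewrite eqxx.
by rewrite ltnS.
Qed.

Lemma nil_monicM p q : nil_monic p -> nil_monic q -> nil_monic (p * q).
Proof.
move=> hp hq; have [p_mon pO pm] := hp; have [q_mon qO qm] := hq.
split=> [|i|i si]; first by rewrite monicMl.
  by rewrite coefM vdvd_sum // => j _; apply: vdvd1M.
rewrite coefM vsdvd_sum ?oner_neq0 // => j _.
have [jp|jp] := eqVneq (j : nat) (size p).-1; last first.
  by rewrite -[1]mulr1 vsdvdMr ?oner_neq0 // nil_monic_lower.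
rewrite -[1]mulr1 vsdvdMl ?oner_neq0 // nil_monic_lower //.
apply: contraTneq si => ij; rewrite -leqNgt size_Mmonic ?monic_neq0 //.
rewrite -[i](subnKC (leq_ord j)) ij jp.
have := size_poly_gt0 p; have := size_poly_gt0 q; rewrite !monic_neq0 //.
by case: (size p) => // a; case: (size q) => // b _ _; rewrite addnS.
Qed.

Lemma nil_monic1 : nil_monic 1.
Proof.
split=> [|i|i]; rewrite ?monic1 ?size_poly1 // coef1.
by case: (i == 0%N); rewrite ?vdvdxx ?vdvd0.
Qed.

Lemma nil_monicX p k : nil_monic p -> nil_monic (p ^+ k).
Proof.
move=> hp; elim: k => [|k IHk]; first exact: nil_monic1.
by rewrite exprS; apply: nil_monicM.
Qed.

Lemma first_vmin (p : {poly L}) : p != 0 -> exists i,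
  (forall j, vdvd v p`_i p`_j) /\ (forall j, (j < i)%N -> vsdvd v p`_i p`_j).
Proof.
move=> p0; have sp : 0%N \in iota 0 (size p).
  by rewrite mem_iota /= lt0n size_poly_eq0.
have [i0 i0s Hi0] := exists_vmin v (fun i => p`_i) sp.
have ex : exists i, `[< forall j, vdvd v p`_i p`_j >].
  exists i0; apply/asboolP => j; have [ji|ji] := ltnP j (size p).
    by apply: Hi0; rewrite mem_iota.
  by rewrite (nth_default _ ji) vdvd0.
have [i /asboolP iP imin] := ex_minnP ex; exists i; split=> // j ji.
rewrite /vsdvd; apply: contraL ji => h; rewrite -leqNgt; apply: imin.
by apply/asboolP => k; apply: vdvd_trans h (iP k).
Qed.

(** Gauss's lemma: the product of the first coefficients of least value of p
    and of q dominates a coefficient of the product. *)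
Lemma nil_monic_factor p q : p \is monic -> q \is monic -> nil_monic (p * q) ->
  nil_monic p.
Proof.
move=> p_mon q_mon hpq; have [p0 q0] := (monic_neq0 p_mon, monic_neq0 q_mon).
have [i [iP ilt]] := first_vmin p0; have [j [jP jlt]] := first_vmin q0.
have i1 : vdvd v p`_i 1 by rewrite -(monicP p_mon) lead_coefE.
have j1 : vdvd v q`_j 1 by rewrite -(monicP q_mon) lead_coefE.
have [pi0 qj0] := (vdvd_neq0 i1 (oner_neq0 _), vdvd_neq0 j1 (oner_neq0 _)).
have dom : vdvd v (p * q)`_(i + j) (p`_i * q`_j).
  have ik : (i < (i + j).+1)%N by rewrite ltnS leq_addr.
  rewrite coefM (bigD1 (Ordinal ik)) //= addKn.
  apply: vsdvd_addl; apply: vsdvd_sum => [|k]; first exact: mulf_neq0.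
  rewrite -val_eqE /= neq_ltn => /orP[ki|ik'].
    by rewrite vsdvdMr ?ilt.
  rewrite vsdvdMl ?iP // jlt // -(ltn_add2l k) subnKC ?ltn_add2r //.
  by rewrite -ltnS.
have ij : (i + j = (size (p * q)%R).-1)%N.
  apply/eqP; rewrite -[_ == _]negbK; apply/negP => /(nil_monic_lower hpq) h.
  have := vsdvd_dvd_trans h dom; apply/negP; rewrite /vsdvd negbK.
  by rewrite -[1]mulr1 vdvdM.
have leP (r : {poly L}) k : r`_k != 0 -> (k <= (size r).-1)%N.
  move=> rk; rewrite -ltnS; apply: (leq_trans _ (leqSpred _)).
  by rewrite ltnNge; apply: contra rk => /(nth_default 0) ->.
have ip : i = (size p).-1.
  apply/eqP; rewrite eqn_leq leP //=.
  have := leP _ _ qj0; rewrite -(leq_add2l i) ij size_Mmonic //.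
  have := size_poly_gt0 p; have := size_poly_gt0 q; rewrite p0 q0.
  case: (size p) => // a; case: (size q) => // b _ _ /=.
  by rewrite addnS /= leq_add2r.
have pi1 : p`_i = 1 by rewrite ip; apply/monicP.
split=> // [k|k kp]; first by rewrite -pi1.
by rewrite -pi1 ilt // ip -ltnS prednK // (leq_ltn_trans _ kp).
Qed.

(** The element 'X - A divides p('X) - p(A) = p('X) in the ring of matrices over
    the polynomials; take determinants. *)
Lemma char_poly_dvd_exp n (A : 'M[L]_n.+1) (p : {poly L}) : horner_mx A p = 0 ->
  exists q, char_poly A * q = p ^+ n.+1.
Proof.
move=> pA; pose B : 'M[{poly L}]_n.+1 := map_mx polyC A.
pose X : 'M[{poly L}]_n.+1 := 'X%:M.
have cXB : GRing.comm X B by apply/esym/scalar_mxC.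
pose G := \sum_(i < size p) (p`_i)%:P%:M *
  (\sum_(j < i) X ^+ (i.-1 - j) * B ^+ j).
have pX : p%:M = \sum_(i < size p) (p`_i)%:P%:M * X ^+ i :> 'M[{poly L}]_n.+1.
  rewrite -[p in LHS]coefK poly_def raddf_sum; apply: eq_bigr => i _ /=.
  by rewrite -mul_polyC scalar_mxM rmorphXn.
have pB : 0 = \sum_(i < size p) (p`_i)%:P%:M * B ^+ i :> 'M[{poly L}]_n.+1.
  transitivity (map_mx polyC (horner_mx A p)); first by rewrite pA map_mx0.
  rewrite -[p in LHS]coefK poly_def !raddf_sum; apply: eq_bigr => i _ /=.
  rewrite -mul_polyC rmorphM rmorphXn /= horner_mx_C horner_mx_X.
  by rewrite map_mxM map_scalar_mx rmorphXn.
exists (\det G); rewrite /char_poly /char_poly_mx -det_mulmx -[RHS]det_scalar.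
congr (\det _); transitivity (\sum_(i < size p) (p`_i)%:P%:M * X ^+ i
    - \sum_(i < size p) (p`_i)%:P%:M * B ^+ i); last by rewrite -pB subr0 -pX.
rewrite -sumrB -/X -/B [LHS]mulr_sumr.
apply: eq_bigr => i _; rewrite -mulrBr (subrXX_comm _ cXB) !mulrA.
by congr (_ * _); apply: scalar_mxC.
Qed.

Lemma char_poly_nil_monic n (A : 'M[L]_n.+1) (p : {poly L}) :
  nil_monic p -> horner_mx A p = 0 -> nil_monic (char_poly A).
Proof.
move=> hp /char_poly_dvd_exp[q Eq].
have hpn := nil_monicX n.+1 hp; have [pn_mon _ _] := hpn.
have A_mon := char_poly_monic A.
apply: (@nil_monic_factor _ q) => //; last by rewrite Eq.
by rewrite -(monicMl _ A_mon) Eq.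
Qed.

End NilpotentReduction.

Section TraceAndNorm.
Variables (L M : fieldType) (iota : {rmorphism L -> M}).
Variables (v : valuation L) (u : valuation M).
Hypothesis vu : extends iota v u.
Hypothesis M_alg : algebraic_extension iota.
Hypothesis u_int : forall y, vdvd u 1 y -> integral_over iota v y.

(** If x ^+ n = c * unit with c in the base, the equation of x ^+ n / c,
    homogenised at (x ^+ n : c), has all its lower coefficients in the
    maximal ideal. *)
Lemma nil_monic_root x : vsdvd u 1 x ->
  exists2 p, nil_monic v p & root (map_poly iota p) x.
Proof.
move=> x1; have [->|x0] := eqVneq x 0.
  exists 'X; last by rewrite map_polyX rootX.
  split=> [|i|[|i]]; rewrite ?monicX ?size_polyX ?coefX //.
    by case: (i == 1%N); rewrite ?vdvdxx ?vdvd0.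
  by rewrite vsdvdx0 oner_neq0.
have [n [c [n0 c0 xc cx]]] := algebraic_torsion vu (M_alg x) x0.
have ic0 : iota c != 0 by rewrite fmorph_eq0.
have c1 : vsdvd v 1 c.
  rewrite -(extends_vsdvd vu) rmorph1; apply: vsdvd_dvd_trans xc.
  by rewrite -(expr1n _ n) vsdvdX.
have [|f [f_mon fO froot]] := u_int (y := x ^+ n / iota c).
  by rewrite -(vdvd_mul2r u _ _ ic0) divfK // mul1r.
pose d := (size f).-1.
have fd : size f = d.+1 by rewrite prednK // lt0n size_poly_eq0 monic_neq0.
pose r : {poly L} := \sum_(i < d) (f`_i * c ^+ (d - i)) *: 'X^(n * i).
have E : homog f 'X^n c%:P = 'X^(n * d) + r.
  rewrite /homog -/d fd big_ord_recr /= addrC subnn expr0 mulr1.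
  have -> : f`_d = 1 by apply/monicP.
  rewrite scale1r -exprM; congr (_ + _); apply: eq_bigr => i _.
  by rewrite -exprM -polyC_exp mulrC mul_polyC scalerA.
have rk k : vsdvd v 1 r`_k.
  rewrite coef_sum vsdvd_sum ?oner_neq0 // => i _; rewrite coefZ coefXn.
  case: eqP => _; rewrite ?mulr0 ?vsdvdx0 ?oner_neq0 // mulr1.
  rewrite -[1]mulr1 vsdvdMl ?oner_neq0 //; first exact: polyOver_val_ring.
  by rewrite -(expr1n _ (d - i)) vsdvdX // subn_gt0.
have sr : (size r < size ('X^(n * d) : {poly L}))%N.
  rewrite size_polyXn ltnS; apply: (leq_trans (size_sum _ _ _)).
  apply/bigmax_leqP => i _; rewrite (leq_trans (size_scale_leq _ _)) //.
  by rewrite size_polyXn ltn_mul2l n0 /= ltn_ord.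
exists (homog f 'X^n c%:P); last first.
  rewrite /root horner_homog ?map_polyC ?map_polyXn ?hornerC ?hornerXn //.
  by rewrite (eqP froot) mulr0.
rewrite E; split=> [|i|i].
- by rewrite monicE lead_coefDl // lead_coefXn.
- by rewrite coefD vdvdD //; [rewrite coefXn vdvd1_nat|apply: vsdvdW].
rewrite size_polyDl // size_polyXn ltnS => id.
by rewrite coefD coefXn ltn_eqF // add0r.
Qed.

Lemma mul_mx_nil_monic n (b : 'I_n.+1 -> M) c x : is_basis iota b c ->
  vsdvd u 1 x -> nil_monic v (char_poly (mul_mx b c x)).
Proof.
move=> bP x1; have [p hp /eqP px] := nil_monic_root x1.
apply: (char_poly_nil_monic hp); rewrite -(mul_mx_horner bP) px.
by rewrite -(rmorph0 iota) (mul_mxC bP) raddf0.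
Qed.

Lemma trace_max_ideal (I : finType) (b : I -> M) c x : is_basis iota b c ->
  vsdvd u 1 x -> vsdvd v 1 (basis_trace b c x).
Proof.
move=> bP x1; have [n [b' [c' [_ bP']]]] := basis_ordinal bP.
rewrite (basis_trace_indep bP bP') -trace_mul_mx -vsdvdNr.
rewrite -char_poly_trace //; have [_ _] := mul_mx_nil_monic bP' x1.
by apply; rewrite size_char_poly.
Qed.

Lemma det_one_unit n (b : 'I_n.+1 -> M) c x : is_basis iota b c ->
  vsdvd u 1 x -> vsdvd v 1 (\det (mul_mx b c (1 + x)) - 1).
Proof.
move=> bP x1; have x1' : vsdvd u 1 (- x) by rewrite vsdvdNr.
have [p_mon pO pm] := mul_mx_nil_monic bP x1'.
have -> : \det (mul_mx b c (1 + x)) = (char_poly (mul_mx b c (- x))).[1].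
  rewrite /char_poly -[_.[1]]/(horner_eval 1 _) -det_map_mx; congr (\det _).
  rewrite (mul_mxD bP) (mul_mx1 bP) (mul_mxN bP); apply/matrixP => i j.
  rewrite !mxE /= /horner_eval hornerD hornerN hornerC opprK.
  by rewrite hornerMn hornerX.
rewrite horner_coef size_char_poly big_ord_recr /= expr1n mulr1.
have -> : (char_poly (mul_mx b c (- x)))`_n.+1 = 1.
  by have := monicP p_mon; rewrite lead_coefE size_char_poly.
rewrite addrK vsdvd_sum ?oner_neq0 // => i _; rewrite expr1n mulr1 pm //.
by rewrite size_char_poly ltnS ltn_ord.
Qed.

End TraceAndNorm.

(** * Ramification index and residue degree by elements *)

Section LinearAlgebra.
Variables (L M : fieldType) (iota : {rmorphism L -> M}).

Definition lin_indep (J : finType) (x : J -> M) := forall d : J -> L,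
  \sum_j iota (d j) * x j = 0 -> forall j, d j = 0.

Lemma lin_indep_reindex (J J' : finType) (x : J -> M) (f : J' -> J) :
  bijective f -> lin_indep x -> lin_indep (fun j => x (f j)).
Proof.
move=> [g fK gK] xP d; have -> : \sum_j iota (d j) * x (f j) =
    \sum_j iota (d (g j)) * x j.
  rewrite [RHS](reindex f) /=; last by exists g => i _; rewrite ?fK ?gK.
  by apply: eq_bigr => j _; rewrite fK.
by move=> /xP h j; rewrite -(fK j) h.
Qed.

Lemma kernel_exists n m (A : 'M[L]_(n, m)) : (m < n)%N ->
  exists2 y : 'rV_n, y != 0 & y *m A = 0.
Proof.
move=> mn; have : kermx A != 0.
  by rewrite -mxrank_eq0 mxrank_ker subn_eq0 -ltnNge (leq_ltn_trans (rank_leq_col A)).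
by move/rowV0Pn => [y /sub_kermxP yA y0]; exists y.
Qed.

Section Ordinal.
Variables (n : nat) (b : 'I_n -> M) (c : M -> 'I_n -> L).
Hypothesis bP : is_basis iota b c.

Lemma lin_indep_row_free m (x : 'I_m -> M) : lin_indep x ->
  row_free (\matrix_(j, i) c (x j) i).
Proof.
move=> xP; apply: inj_row_free => y yC; apply/rowP => j; rewrite mxE.
apply: (xP (fun j => y 0 j)); rewrite (basis_sum bP (\sum_j _)).
apply: big1 => i _; rewrite (coord_basis_big bP).
have := congr1 (fun A : 'rV_n => A 0 i) yC; rewrite !mxE => yC0.
suff -> : \sum_j0 c (iota (y 0 j0) * x j0) i = 0 by rewrite rmorph0 mul0r.
by rewrite -[RHS]yC0; apply: eq_bigr => k _; rewrite mxE (coord_basisZ bP).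
Qed.

(** The coordinates for x are those for b times the inverse of the matrix of the
    x j in the basis b. *)
Lemma lin_indep_basis (x : 'I_n -> M) : lin_indep x ->
  exists c', is_basis iota x c'.
Proof.
move=> xP; pose C := \matrix_(j, i) c (x j) i.
have Cu : C \in unitmx by rewrite -row_free_unit lin_indep_row_free.
pose c' y i := ((\row_i c y i) *m invmx C) 0 i.
have c'P y : y = \sum_i iota (c' y i) * x i.
  rewrite {1}(basis_sum bP y) [RHS](basis_sum bP).
  apply: eq_bigr => i _; congr (iota _ * _).
  rewrite (coord_basis_big bP).
  have -> : c y i = (\row_i c y i *m invmx C *m C) 0 i by rewrite mulmxKV // mxE.
  rewrite mxE; apply: eq_bigr => k _.
  by rewrite (coord_basisZ bP) [C k i]mxE.
exists c'; split=> // d i; apply/eqP; rewrite -subr_eq0; apply/eqP.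
apply: (xP (fun i => c' (\sum_j iota (d j) * x j) i - d i)).
rewrite (eq_bigr (fun j => iota (c' (\sum_j iota (d j) * x j) j) * x j -
  iota (d j) * x j)).
  by rewrite sumrB -c'P subrr.
by move=> j _; rewrite rmorphB mulrBl.
Qed.

End Ordinal.

Variables (I : finType) (b : I -> M) (c : M -> I -> L).
Hypothesis bP : is_basis iota b c.

Lemma basis_card_ordinal : exists b' c', @is_basis _ _ iota 'I_#|I| b' c'.
Proof.
exists (fun i => b (enum_val i)), (fun x i => c x (enum_val i)).
by apply: (basis_reindex (g := enum_rank) bP) => i; rewrite ?enum_valK ?enum_rankK.
Qed.

Lemma lin_indep_card (J : finType) (x : J -> M) : lin_indep x -> (#|J| <= #|I|)%N.
Proof.
move=> xP; have [b' [c' bP']] := basis_card_ordinal.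
have xP' : lin_indep (fun j : 'I_#|J| => x (enum_val j)).
  by apply: lin_indep_reindex xP; apply: enum_val_bij.
by have := lin_indep_row_free bP' xP'; rewrite /row_free => /eqP <-; apply: rank_leq_col.
Qed.

Lemma lin_indep_basis_card (J : finType) (x : J -> M) : lin_indep x ->
  #|J| = #|I| -> exists c', is_basis iota x c'.
Proof.
move=> xP JI; have [b' [c' bP']] := basis_card_ordinal.
pose f (i : 'I_#|I|) : J := enum_val (cast_ord (esym JI) i).
pose g (j : J) : 'I_#|I| := cast_ord JI (enum_rank j).
have fK : cancel f g by move=> i; rewrite /f /g enum_valK cast_ordKV.
have gK : cancel g f by move=> j; rewrite /f /g cast_ordK enum_rankK.
have [|c1 c1P] := lin_indep_basis bP' (x := fun i => x (f i)).
  by apply: lin_indep_reindex xP; exists g.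
exists (fun y j => c1 y (g j)).
have := basis_reindex (f := g) (g := f) c1P gK fK.
by congr is_basis; apply: funext => j; rewrite gK.
Qed.

End LinearAlgebra.

Definition veq (K : fieldType) (v : valuation K) x y := vdvd v x y && vdvd v y x.

Lemma veqE (K : fieldType) (v : valuation K) x y : x != 0 -> y != 0 ->
  veq v x y <-> v x = v y.
Proof.
move=> x0 y0; rewrite /veq !vdvdE //; split=> [|->]; last by rewrite lexx.
by move=> /andP[xy yx]; apply/le_anti/andP.
Qed.

Lemma veq_sym (K : fieldType) (v : valuation K) x y : veq v x y = veq v y x.
Proof. by rewrite /veq andbC. Qed.

Lemma veq_trans (K : fieldType) (v : valuation K) : transitive (veq v).
Proof.
move=> y x z /andP[xy yx] /andP[yz zy].
by rewrite /veq (vdvd_trans xy yz) (vdvd_trans zy yx).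
Qed.

Lemma veq_mul2l (K : fieldType) (v : valuation K) a x y : a != 0 ->
  veq v (a * x) (a * y) = veq v x y.
Proof. by move=> a0; rewrite /veq !vdvd_mul2l. Qed.

Section RamificationInertia.
Variables (K L : fieldType) (iota : {rmorphism K -> L}).

(** Elements whose values represent the cosets of the value group of K, and
    integral elements whose residues form a basis over the residue field of K.
    These notions refer to the valuation ring only, and so are invariant
    under equivalence of valuations. *)
Definition coset_reps (w : valuation L) e (t : 'I_e -> L) :=
  (forall i, t i != 0) /\ forall x, x != 0 ->
    exists! i, exists2 c, c != 0 & veq w x (iota c * t i).

Definition residue_indep (w : valuation L) f (s : 'I_f -> L) :=
  (forall j, vdvd w 1 (s j)) /\
  forall c : 'I_f -> K, (forall j, vdvd w 1 (iota (c j))) ->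
    vsdvd w 1 (\sum_j iota (c j) * s j) -> forall j, vsdvd w 1 (iota (c j)).

Definition residue_basis (w : valuation L) f (s : 'I_f -> L) :=
  residue_indep w s /\ forall x, vdvd w 1 x ->
    exists2 c : 'I_f -> K, forall j, vdvd w 1 (iota (c j)) &
      vsdvd w 1 (x - \sum_j iota (c j) * s j).

Lemma coset_reps_equiv (w w' : valuation L) e (t : 'I_e -> L) :
  val_equiv w w' -> coset_reps w t -> coset_reps w' t.
Proof.
move=> ww [t0 tP]; split=> // x /tP[i [[c c0 ci] iu]]; exists i; split.
  by exists c; rewrite // /veq -!(vdvd_equiv ww).
move=> j [d d0 dj]; apply: iu; exists d => //.
by rewrite /veq !(vdvd_equiv ww).
Qed.

Lemma residue_basis_equiv (w w' : valuation L) f (s : 'I_f -> L) :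
  val_equiv w w' -> residue_basis w s -> residue_basis w' s.
Proof.
move=> ww [[s1 sP] sb]; split; [split|].
- by move=> j; rewrite -(vdvd_equiv ww).
- move=> c cO cs j; rewrite -(vsdvd_equiv ww); apply: sP; last by rewrite (vsdvd_equiv ww).
  by move=> k; rewrite (vdvd_equiv ww).
move=> x; rewrite -(vdvd_equiv ww) => /sb[c cO cs]; exists c.
  by move=> k; rewrite -(vdvd_equiv ww).
by rewrite -(vsdvd_equiv ww).
Qed.

Variable w : valuation L.

Lemma ramification_indexP e :
  ramification_index iota w e <-> exists t : 'I_e -> L, coset_reps w t.
Proof.
split=> [[b bV bP]|[t [t0 tP]]].
  have [t t0 tb] := fin_all_exists2 bV.
  have H x i : x != 0 -> (exists2 c, c != 0 & veq w x (iota c * t i)) <->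
      value_group (restrict iota w) (w x - b i).
    move=> x0; split=> -[c c0 cx]; exists c => //.
      move: cx; rewrite veqE // ?mulf_neq0 ?fmorph_eq0 // => ->.
      by rewrite val_mul ?fmorph_eq0 // tb addrK.
    rewrite veqE // ?mulf_neq0 ?fmorph_eq0 // val_mul ?fmorph_eq0 // tb.
    by rewrite [w (iota c)]cx subrK.
  exists t; split=> // x x0; have [|i [/(H _ _ x0) hi iu]] := bP (w x).
    by exists x.
  by exists i; split=> // j /(H _ _ x0)/iu.
exists (fun i => w (t i)) => [i|_ [x x0 <-]]; first by exists (t i).
have H i : (exists2 c, c != 0 & veq w x (iota c * t i)) <->
    value_group (restrict iota w) (w x - w (t i)).
  split=> -[c c0 cx]; exists c => //.
    move: cx; rewrite veqE // ?mulf_neq0 ?fmorph_eq0 // => ->.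
    by rewrite val_mul ?fmorph_eq0 // addrK.
  rewrite veqE // ?mulf_neq0 ?fmorph_eq0 // val_mul ?fmorph_eq0 //.
  by rewrite [w (iota c)]cx subrK.
have [i [/H hi iu]] := tP x x0.
by exists i; split=> // j /H/iu.
Qed.

End RamificationInertia.

Section Residues.
Variables (K : fieldType) (v : valuation K).

Definition res (x : vring v) : residue v := \pi_(residue v)%qT x.

Lemma res_eq x y : (res x = res y) <-> vsdvd v 1 (val x - val y).
Proof.
rewrite /res -[X in vsdvd v 1 X]/(val (x - y)) -max_idealE Quotient.idealrBE.
by split=> [->|/eqP]; rewrite ?eqxx.
Qed.

Lemma res_surj (y : residue v) : exists x, y = res x.
Proof. by exists (repr y)%qT; rewrite /res reprK. Qed.

Lemma res0 : res 0 = 0. Proof. exact: rmorph0. Qed.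
Lemma res1 : res 1 = 1. Proof. exact: rmorph1. Qed.
Lemma resD x y : res (x + y) = res x + res y. Proof. exact: rmorphD. Qed.
Lemma resM x y : res (x * y) = res x * res y. Proof. exact: rmorphM. Qed.
Lemma res_eq0 x : (res x == 0) = vsdvd v 1 (val x).
Proof.
have E : val x - val (0 : vring v) = val x by rewrite -rmorphB subr0.
by rewrite -E -res0; apply/eqP/idP => /res_eq.
Qed.

Lemma res_sum (I : finType) (G : I -> vring v) : res (\sum_i G i) = \sum_i res (G i).
Proof. exact: rmorph_sum. Qed.

Lemma vring_sum (I : finType) (G : I -> vring v) :
  val (\sum_i G i) = \sum_i val (G i).
Proof. exact: rmorph_sum. Qed.

Lemma res_nat n : n%:R = res n%:R.
Proof. by elim: n => [|n IHn]; rewrite ?res0 // -!natr1 resD -IHn res1. Qed.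

Lemma residue_pchar p : p \in [pchar (residue v)] = prime p && vsdvd v 1 p%:R.
Proof.
rewrite inE; congr (_ && _).
by rewrite res_nat res_eq0 rmorph_nat.
Qed.

End Residues.

Lemma residue_map_res (K L : fieldType) (iota : {rmorphism K -> L})
    (w : valuation L) (x : vring (restrict iota w)) (y : vring w) :
  val y = iota (val x) -> residue_map iota w (res x) = res y.
Proof.
move=> yx; rewrite /res residue_map_pi; congr (\pi_(residue w)%qT _).
by apply: val_inj; rewrite /= yx.
Qed.

Section ResidueDegree.
Variables (K L : fieldType) (iota : {rmorphism K -> L}) (w : valuation L).

Lemma mk_vring x : vdvd w 1 x -> exists y : vring w, val y = x.
Proof. by rewrite vdvd1 => xO; exists (VRing xO). Qed.

Lemma mk_vring_restrict c : vdvd w 1 (iota c) ->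
  exists y : vring (restrict iota w), val y = c.
Proof.
move=> c1; have cO : c \in val_ring (restrict iota w).
  by rewrite -vdvd1 vdvd_restrict rmorph1.
by exists (VRing cO).
Qed.

Lemma vring_vdvd (x : vring w) : vdvd w 1 (val x).
Proof. by rewrite vdvd1; apply: valP. Qed.

Lemma vring_restrict_vdvd (x : vring (restrict iota w)) : vdvd w 1 (iota (val x)).
Proof.
by have := valP x; rewrite -vdvd1 vdvd_restrict rmorph1.
Qed.

Lemma residue_map_sum f (c : 'I_f -> vring (restrict iota w)) (s : 'I_f -> vring w) z :
  val z = \sum_j iota (val (c j)) * val (s j) ->
  \sum_j residue_map iota w (res (c j)) * res (s j) = res z.
Proof.
move=> zE; pose c' j : vring w := vring_map (c j).
have E j : residue_map iota w (res (c j)) = res (c' j) by apply: residue_map_res.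
under eq_bigr do rewrite E -resM.
rewrite -res_sum; congr (res _); apply: val_inj; rewrite zE vring_sum.
by apply: eq_bigr.
Qed.

Lemma residue_basis_res f (s : 'I_f -> L) (r : 'I_f -> vring w) :
    residue_basis iota w s -> (forall j, val (r j) = s j) ->
  forall y, exists! c : {ffun 'I_f -> residue (restrict iota w)},
    y = \sum_j residue_map iota w (c j) * res (r j).
Proof.
move=> [[s1 sI] sB] rE.
move=> y; have [x ->] := res_surj y.
have [c cO xc] := sB _ (vring_vdvd x).
have [d dE] := fin_all_exists (fun j => mk_vring_restrict (cO j)).
pose z (d : 'I_f -> vring (restrict iota w)) := \sum_j vring_map (d j) * r j.
have zE d' : val (z d') = \sum_j iota (val (d' j)) * val (r j) by rewrite vring_sum.
exists [ffun j => res (d j)]; split.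
  under eq_bigr do rewrite ffunE.
  rewrite (residue_map_sum (zE d)); apply/res_eq; congr (vsdvd _ _ (_ - _)): xc.
  by rewrite zE; apply: eq_bigr => j _; rewrite dE rE.
move=> c' xc'; apply/ffunP => j; rewrite ffunE.
have [d' d'E] := fin_all_exists (fun j => res_surj (c' j)).
rewrite d'E; apply/res_eq; rewrite vsdvd_restrict rmorph1 rmorphB.
have := sI (fun j => val (d j) - val (d' j)).
rewrite -rmorphB; apply.
  by move=> k; rewrite rmorphB vdvdB ?vring_restrict_vdvd.
have : res x = res (z d').
  by rewrite xc' -(residue_map_sum (zE d')); apply: eq_bigr => k _; rewrite d'E.
move/res_eq => h; rewrite -[\sum_j _]opprK vsdvdNr.
have -> : - (\sum_j iota (val (d j) - val (d' j)) * s j) =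
    (val x - \sum_j iota (c j) * s j) - (val x - val (z d')).
  rewrite opprB addrC addrA subrK zE -[RHS]opprB -sumrB; congr (- _).
  by apply: eq_bigr => k _; rewrite rmorphB mulrBl dE rE.
exact: vsdvdB.
Qed.

Lemma residue_degreeP f :
  residue_degree iota w f <-> exists s : 'I_f -> L, residue_basis iota w s.
Proof.
split=> [[b bP]|[s sP]].
  have [r rE] := fin_all_exists (fun j => res_surj (b j)).
  exists (fun j => val (r j)); split; [split|].
  - by move=> j; apply: vring_vdvd.
  - move=> c cO cs j.
    have [c' c'E] := fin_all_exists (fun j => mk_vring_restrict (cO j)).
    pose z := \sum_j vring_map (c' j) * r j.
    have zE : val z = \sum_j iota (val (c' j)) * val (r j) by rewrite vring_sum.
    have z0 : res z = 0.
      apply/eqP; rewrite res_eq0 zE; congr (vsdvd _ _ _): cs.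
      by apply: eq_bigr => k _; rewrite c'E.
    have [c0 [_ uniq]] := bP 0.
    have u1 : c0 = [ffun=> 0].
      by apply: uniq; rewrite big1 // => k _; rewrite ffunE rmorph0 mul0r.
    have u2 : c0 = [ffun k => res (c' k)].
      apply: uniq; rewrite -[LHS]z0 -(residue_map_sum zE).
      by apply: eq_bigr => k _; rewrite ffunE rE.
    have : res (c' j) = 0.
      by have := congr1 (fun h : {ffun _} => h j) u2; rewrite u1 !ffunE.
    by move/eqP; rewrite res_eq0 vsdvd_restrict rmorph1 c'E.
  move=> x x1; have [y yx] := mk_vring x1.
  have [c [cE _]] := bP (res y).
  have [d dE] := fin_all_exists (fun j => res_surj (c j)).
  exists (fun j => val (d j)); first by move=> j; apply: vring_restrict_vdvd.
  pose z := \sum_j vring_map (d j) * r j.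
  have zE : val z = \sum_j iota (val (d j)) * val (r j) by rewrite vring_sum.
  rewrite -zE -yx; apply/res_eq; rewrite cE -(residue_map_sum zE).
  by apply: eq_bigr => j _; rewrite -rE -dE.
have [r rE] := fin_all_exists (fun j => mk_vring (sP.1.1 j)).
by exists (fun j => res (r j)); apply: residue_basis_res sP rE.
Qed.

End ResidueDegree.

(** * Standard bases of valued extensions *)

Section ValuationBases.
Variables (L M : fieldType) (iota : {rmorphism L -> M}) (u : valuation M).

(** Terms never cancel: the value of a combination is the least value of its
    terms. *)
Definition val_indep (J : finType) (x : J -> M) := forall (d : J -> L) j,
  vdvd u (\sum_k iota (d k) * x k) (iota (d j) * x j).

Lemma val_indep_lin (J : finType) (x : J -> M) : (forall j, x j != 0) ->
  val_indep x -> lin_indep iota x.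
Proof.
move=> x0 xP d d0 j; have := xP d j; rewrite d0 vdvd0x mulf_eq0 (negPf (x0 j)) orbF.
by rewrite fmorph_eq0 => /eqP.
Qed.

(** Let i be an index at which the expansion of 1 attains its value. Subtracting
    from theta the constant that kills its i-th coordinate is optimal, since
    that coordinate bounds the value from above. *)
Lemma best_approximation (I : finType) (b : I -> M) c theta :
  is_basis iota b c -> val_indep b ->
  exists c0, forall r, vdvd u (theta - iota r) (theta - iota c0).
Proof.
move=> bP bI; have I0 := card_basis_gt0 bP; have [j0 _] := card_gt0P I0.
have [i _ imin] := exists_vmin u (fun i => iota (c 1 i) * b i)
  (mem_enum predT j0 : j0 \in enum I).
have i1 : vdvd u (iota (c 1 i) * b i) 1.
  rewrite [X in vdvd _ _ X](basis_sum bP 1); apply: vdvd_sum => j _.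
  by apply: imin; rewrite mem_enum.
have ai0 : c 1 i != 0.
  apply: contraTneq i1 => ->.
  by rewrite rmorph0 mul0r vdvd0x oner_eq0.
exists (c theta i / c 1 i) => r.
set y := theta - iota (c theta i / c 1 i).
have yi : c y i = 0.
  rewrite (coord_basisD bP) (coord_basisN bP) -[iota _]mulr1.
  by rewrite (coord_basisZ bP) divfK // subrr.
have -> : theta - iota r = y + iota (c theta i / c 1 i - r).
  by rewrite rmorphB addrA subrK.
move: (_ / _ - r) => {}r.
have yr : vdvd u (y + iota r) (iota r).
  have := bI (c (y + iota r)) i; rewrite -(basis_sum bP) (coord_basisD bP) yi add0r.
  rewrite -{2}[iota r]mulr1 (coord_basisZ bP) rmorphM -mulrA => h.
  by apply: vdvd_trans h _; rewrite -{2}[iota r]mulr1 vdvdMl.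
by rewrite -{2}(addrK (iota r) y) vdvdB // vdvdxx.
Qed.

Section Standard.
Variables (e f : nat) (t : 'I_e -> M) (s : 'I_f -> M).

(** Divided by a coefficient of least value, the combination becomes integral
    with a nonzero residue. *)
Lemma residue_indep_combination (d : 'I_f -> L) : residue_indep iota u s ->
  (forall j, vdvd u (\sum_k iota (d k) * s k) (iota (d j))) /\
  (\sum_k iota (d k) * s k != 0 ->
    exists2 a, a != 0 & veq u (\sum_k iota (d k) * s k) (iota a)).
Proof.
move=> [s1 sI]; set S := \sum_k _.
have [j0|/forallPn[j0 dj0]] := boolP [forall j, d j == 0].
  have {}j0 j : d j = 0 by apply/eqP; move/forallP: j0; apply.
  have S0 : S = 0 by apply: big1 => k _; rewrite j0 rmorph0 mul0r.
  by split=> [j|]; rewrite ?j0 ?rmorph0 ?vdvd0 // S0 eqxx.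
have [i _ imin] := exists_vmin u (fun j => iota (d j)) (mem_enum predT j0 : j0 \in enum 'I_f).
have {}imin j : vdvd u (iota (d i)) (iota (d j)) by apply: imin; rewrite mem_enum.
have di0 : d i != 0.
  by have := vdvd_neq0 (imin j0); rewrite !fmorph_eq0; apply.
have idi0 : iota (d i) != 0 by rewrite fmorph_eq0.
have Sd : S = iota (d i) * \sum_k iota (d k / d i) * s k.
  rewrite mulr_sumr; apply: eq_bigr => k _; rewrite fmorph_div mulrA.
  by rewrite mulrCA mulfV // mulr1.
have dS : vdvd u (iota (d i)) S.
  apply: vdvd_sum => k _; rewrite -[iota (d i)]mulr1; exact: vdvdM.
have Sdi : vdvd u S (iota (d i)).
  rewrite Sd -{2}[iota (d i)]mulr1 vdvd_mul2l // -[vdvd _ _ _]negbK.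
  apply/negP => h.
  have dO k : vdvd u 1 (iota (d k / d i)).
    by rewrite fmorph_div -(vdvd_mul2r u _ _ idi0) mul1r divfK.
  by have := sI (fun k => d k / d i) dO h i; rewrite divff // rmorph1 vsdvdxx.
split=> [j|_]; first exact: vdvd_trans Sdi (imin j).
by exists (d i); rewrite // /veq Sdi.
Qed.

Lemma residue_indep_unit : residue_indep iota u s -> forall j, vdvd u (s j) 1.
Proof.
move=> sI j; have [h _] := residue_indep_combination (fun k => (k == j)%:R) sI.
have := h j; rewrite (bigD1 j) //= eqxx rmorph1 mul1r big1 ?addr0 // => k /negPf->.
by rewrite rmorph0 mul0r.
Qed.

(** Grouped by i, the sums over j have values in the value group of the base, so
    that their multiples by the t i have distinct values. *)
Lemma standard_val_indep : coset_reps iota u t -> residue_indep iota u s ->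
  (forall j, s j != 0) /\ val_indep (fun ij : 'I_e * 'I_f => t ij.1 * s ij.2).
Proof.
move=> [t0 tP] sI; have [s1 sI'] := sI.
have sj1 := residue_indep_unit sI.
split=> [j|d [i0 j0] /=]; first exact: vdvd_neq0 (sj1 j) (oner_neq0 _).
pose S i := \sum_j iota (d (i, j)) * s j.
have -> : \sum_ij iota (d ij) * (t ij.1 * s ij.2) = \sum_i S i * t i.
  rewrite (eq_bigr (fun ij => iota (d (ij.1, ij.2)) * (t ij.1 * s ij.2))); last by case.
  rewrite -(pair_bigA _ (fun i j => iota (d (i, j)) * (t i * s j))).
  apply: eq_bigr => i _ /=; rewrite mulr_suml; apply: eq_bigr => j _.
  by rewrite [t i * _]mulrC mulrA.
have h : vdvd u (\sum_i S i * t i) (S i0 * t i0).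
  apply: (vdvd_sum_distinct (G := fun i => S i * t i)) => i i' ii'.
  rewrite !mulf_eq0 !negb_or => /andP[Si _] /andP[Si' _] h1 h2.
  have [a a0 Sa] := (residue_indep_combination (fun j => d (i, j)) sI).2 Si.
  have [a' a0' Sa'] := (residue_indep_combination (fun j => d (i', j)) sI).2 Si'.
  have [k [_ kP]] := tP (iota a * t i) (mulf_neq0 (etrans (congr1 negb (fmorph_eq0 _ _)) a0) (t0 i)).
  have ia0 : iota a != 0 by rewrite fmorph_eq0.
  have ia0' : iota a' != 0 by rewrite fmorph_eq0.
  have ki : k = i by apply: kP; exists a => //; rewrite /veq vdvdxx.
  have ki' : k = i'.
    apply: kP; exists a' => //; apply: (@veq_trans _ _ (S i * t i)).
      rewrite ![_ * t i]mulrC veq_mul2l // veq_sym; exact: Sa.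
    apply: (@veq_trans _ _ (S i' * t i')); first by rewrite /veq h1 h2.
    by rewrite ![_ * t i']mulrC veq_mul2l.
  by move: ii'; rewrite -ki -ki' eqxx.
apply: vdvd_trans h _.
have [h _] := residue_indep_combination (fun j => d (i0, j)) sI.
rewrite [t i0 * _]mulrC mulrA [X in vdvd _ X](_ : _ = (S i0 * 1) * t i0) ?mulr1 //.
rewrite vdvd_mul2r // -[S i0]mulr1; apply: vdvdM; [exact: h|exact: s1].
Qed.

(** Divided by its coset representative and an element of the base, x becomes a
    unit, whose residue is expanded in the basis. *)
Lemma standard_leading x : coset_reps iota u t -> residue_basis iota u s -> x != 0 ->
  exists d : 'I_e * 'I_f -> L, vsdvd u x (x - \sum_ij iota (d ij) * (t ij.1 * s ij.2)).
Proof.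
move=> [t0 tP] [sI sB] x0; have [i [[a a0 /andP[xa ax]] _]] := tP x x0.
have ia0 : iota a != 0 by rewrite fmorph_eq0.
have at0 : iota a * t i != 0 by rewrite mulf_neq0.
have [|d dO xd] := sB (x / (iota a * t i)).
  by rewrite -(vdvd_mul2r u _ _ at0) mul1r divfK.
exists (fun ij => if ij.1 == i then a * d ij.2 else 0).
apply: (vdvd_sdvd_trans xa); rewrite -[X in vsdvd _ X]mul1r.
have -> : x - \sum_ij iota (if ij.1 == i then a * d ij.2 else 0) * (t ij.1 * s ij.2) =
  (x / (iota a * t i) - \sum_j iota (d j) * s j) * (iota a * t i).
  rewrite mulrBl divfK //; congr (_ - _).
  rewrite -(pair_bigA _ (fun i0 j => iota (if i0 == i then a * d j else 0) * (t i0 * s j))).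
  rewrite (bigD1 i) //= [X in _ + X]big1 ?addr0; last first.
    by move=> k /negPf ki; rewrite ki big1 // => j _; rewrite rmorph0 mul0r.
  rewrite eqxx mulr_suml; apply: eq_bigr => j _.
  by rewrite rmorphM mulrACA mulrC.
by rewrite vsdvd_mul2r.
Qed.

End Standard.

Section Finiteness.
Variables (I : finType) (b : I -> M) (c : M -> I -> L).
Hypothesis bP : is_basis iota b c.

Definition distinct_cosets k (t : 'I_k -> M) := (forall i, t i != 0) /\
  forall i j a, i != j -> a != 0 -> ~~ veq u (t i) (iota a * t j).

Lemma distinct_cosets_card k (t : 'I_k -> M) : distinct_cosets t -> (k <= #|I|)%N.
Proof.
move=> [t0 tD]; rewrite -[k]card_ord; apply: (lin_indep_card bP (x := t)).
apply: val_indep_lin => // d j.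
apply: (vdvd_sum_distinct (G := fun k => iota (d k) * t k)) => i i' ii'.
rewrite !mulf_eq0 !fmorph_eq0 !negb_or => /andP[di _] /andP[di' _] h1 h2.
have /negP := tD i i' (d i' / d i) ii' (mulf_neq0 di' (etrans (congr1 negb (invr_eq0 _)) di)).
have idi : iota (d i) != 0 by rewrite fmorph_eq0.
apply; rewrite -(veq_mul2l u _ _ idi) fmorph_div.
by rewrite mulrA mulrCA mulfV // mulr1 /veq h1 h2.
Qed.

(** The new element comes first, at the index ord0. *)
Definition snoc k (t : 'I_k -> M) x (i : 'I_k.+1) :=
  if unlift ord0 i is Some j then t j else x.

Lemma snoc0 k (t : 'I_k -> M) x : snoc t x ord0 = x.
Proof. by rewrite /snoc unlift_none. Qed.

Lemma snocS k (t : 'I_k -> M) x i : snoc t x (lift ord0 i) = t i.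
Proof. by rewrite /snoc liftK. Qed.

(** Elements of distinct cosets are linearly independent, so that families of
    them are bounded in size, and a maximal one meets all cosets. *)
Lemma coset_reps_exist : exists e (t : 'I_e -> M), coset_reps iota u t.
Proof.
pose P k := `[< exists t : 'I_k -> M, distinct_cosets t >].
have P0 : exists k, P k.
  by exists 0%N; apply/asboolP; exists (fun=> 1); split=> -[].
have Pmax k : P k -> (k <= #|I|)%N.
  by move=> /asboolP[t]; apply: distinct_cosets_card.
have [e /asboolP[t [t0 tD]] emax] := ex_maxnP P0 Pmax.
exists e, t; split=> // x x0.
have [i [a a0 xi]] : exists i, exists2 a, a != 0 & veq u x (iota a * t i).
  apply: contrapT => nx.
  suff /emax : P e.+1 by rewrite ltnn.
  apply/asboolP; exists (snoc t x); split=> [i|i j a].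
    by case: (unliftP ord0 i) => [j ->|->]; rewrite ?snocS ?snoc0.
  case: (unliftP ord0 i) => [i' ->|->]; case: (unliftP ord0 j) => [j' ->|->];
    rewrite ?snocS ?snoc0 ?eqxx // => ij a0; last first.
  - by apply/negP => h; apply: nx; exists j', a.
  - apply/negP => h; apply: nx; exists i', a^-1; rewrite ?invr_eq0 //.
    have ia0 : iota a != 0 by rewrite fmorph_eq0.
    by rewrite -(veq_mul2l u _ _ ia0) mulrA fmorphV mulfV // mul1r veq_sym.
  - by apply: tD => //; apply: contra ij => /eqP->.
exists i; split; first by exists a.
move=> j [d d0 xj]; apply/eqP; rewrite -[_ == _]negbK; apply/negP => ij.
have /negP := tD i j (d / a) ij (mulf_neq0 d0 (etrans (congr1 negb (invr_eq0 _)) a0)).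
have ia0 : iota a != 0 by rewrite fmorph_eq0.
apply; rewrite -(veq_mul2l u _ _ ia0); apply: (@veq_trans _ _ x).
  by rewrite veq_sym.
by rewrite mulrA -rmorphM mulrCA mulfV // mulr1.
Qed.

Lemma residue_indep_card k (s : 'I_k -> M) : residue_indep iota u s -> (k <= #|I|)%N.
Proof.
move=> sI; rewrite -[k]card_ord; apply: (lin_indep_card bP (x := s)).
move=> d d0 j; have [h _] := residue_indep_combination d sI.
by have := h j; rewrite d0 vdvd0x fmorph_eq0 => /eqP.
Qed.

Lemma residue_basis_exists : exists f (s : 'I_f -> M), residue_basis iota u s.
Proof.
pose P k := `[< exists s : 'I_k -> M, residue_indep iota u s >].
have P0 : exists k, P k.
  by exists 0%N; apply/asboolP; exists (fun=> 1); split=> [[]|d _ _ []].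
have Pmax k : P k -> (k <= #|I|)%N.
  by move=> /asboolP[t]; apply: residue_indep_card.
have [f /asboolP[s [s1 sI]] fmax] := ex_maxnP P0 Pmax.
exists f, s; split=> // x x1; apply: contrapT => nx.
suff /fmax : P f.+1 by rewrite ltnn.
apply/asboolP; exists (snoc s x); split=> [i|d dO].
  by case: (unliftP ord0 i) => [j ->|->]; rewrite ?snocS ?snoc0.
rewrite big_ord_recl snoc0; under eq_bigr do rewrite snocS.
move=> h; have d0 : vsdvd u 1 (iota (d ord0)).
  rewrite /vsdvd; apply/negP => d01; apply: nx.
  have id0 : iota (d ord0) != 0 by apply: vdvd_neq0 d01 (oner_neq0 _).
  exists (fun j => - (d (lift ord0 j) / d ord0)) => [j|].
    rewrite rmorphN vdvdNr fmorph_div -(vdvd_mul2r u _ _ id0) mul1r divfK //.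
    exact: vdvd_trans d01 (dO _).
  rewrite -(vsdvd_mul2l u _ _ id0) mulr1; apply: vdvd_sdvd_trans d01 _.
  congr (vsdvd _ _ _): h; rewrite mulrBr -[X in _ = _ - X]opprK opprK mulr_sumr -sumrN.
  congr (_ + _); apply: eq_bigr => j _.
  by rewrite rmorphN fmorph_div mulrA mulrN mulrCA mulfV // mulr1 mulNr opprK.
have hs : vsdvd u 1 (\sum_(i < f) iota (d (lift ord0 i)) * s i).
  rewrite -[\sum_(i < f) _](addKr (iota (d ord0) * x)) addrC vsdvdB //.
  by rewrite -[1]mulr1 vsdvdMr ?oner_neq0.
move=> i; case: (unliftP ord0 i) => [j ->|->] //.
by apply: (sI (fun j => d (lift ord0 j))) => // k; apply: dO.
Qed.

Lemma standard_card e f (t : 'I_e -> M) (s : 'I_f -> M) :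
  coset_reps iota u t -> residue_basis iota u s -> (e * f <= #|I|)%N.
Proof.
move=> tP [sI _]; have [s0 ts] := standard_val_indep tP sI.
rewrite -[e]card_ord -[X in (_ * X)%N]card_ord -card_prod.
apply: (lin_indep_card bP); apply: (val_indep_lin _ ts) => -[i j] /=.
by rewrite mulf_neq0 //; case: tP => + _; apply.
Qed.

Lemma standard_basis e f (t : 'I_e -> M) (s : 'I_f -> M) :
    coset_reps iota u t -> residue_basis iota u s -> #|I| = (e * f)%N ->
  exists c', is_basis iota (fun ij : 'I_e * 'I_f => t ij.1 * s ij.2) c'.
Proof.
move=> tP [sI _] n_ef; have [s0 ts] := standard_val_indep tP sI.
apply: (lin_indep_basis_card bP); last by rewrite card_prod !card_ord.
apply: (val_indep_lin _ ts) => -[i j] /=.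
by rewrite mulf_neq0 //; case: tP => + _; apply.
Qed.

End Finiteness.

End ValuationBases.

(** * Finite subextensions of algebraic extensions *)

Section SimpleExtensions.
Variables (F : fieldType) (E : fieldExtType F) (z : E) (p : {poly F}).
Hypotheses (p_irr : irreducible_poly p) (pz : root (map_poly (base_emb E) p) z).
Hypothesis E_gen : <<1; z>>%VS = fullv.

Lemma simple_extension_poly x : exists q, x = (map_poly (base_emb E) q).[z].
Proof.
have : x \in <<1; z>>%VS by rewrite E_gen memvf.
by move/Fadjoin_polyP => [_ /polyOver1P[q ->] ->]; exists q.
Qed.

Lemma simple_extension_map (F' : fieldType) (iota : {rmorphism F -> F'}) z' :
    root (map_poly iota p) z' ->
  exists2 j : {rmorphism E -> F'}, j \o base_emb E =1 iota & j z = z'.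
Proof.
move=> pz'; have [g gP] := choice simple_extension_poly.
pose ev q := (map_poly iota q).[z'].
have evP q q' : (map_poly (base_emb E) q).[z] = (map_poly (base_emb E) q').[z] ->
    ev q = ev q'.
  move=> /eqP; rewrite -subr_eq0 -hornerN -hornerD -rmorphB => qq.
  have /dvdpP[r Er] := minpoly_dvd p_irr pz qq.
  apply/eqP; rewrite -subr_eq0 /ev -hornerN -hornerD -rmorphB /= Er rmorphM hornerM.
  by rewrite (eqP pz') mulr0.
pose j x := ev (g x).
have j_zmod : zmod_morphism j.
  move=> x y; transitivity (ev (g x - g y)); last first.
    by rewrite /ev rmorphB hornerD hornerN.
  by apply: evP; rewrite -gP rmorphB hornerD hornerN -!gP.
have j_mon : monoid_morphism j.
  split=> [|x y].
    transitivity (ev 1); last by rewrite /ev rmorph1 hornerC.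
    by apply: evP; rewrite -gP rmorph1 hornerC.
  transitivity (ev (g x * g y)); last by rewrite /ev rmorphM hornerM.
  by apply: evP; rewrite -gP rmorphM hornerM -!gP.
pose jM := GRing.isZmodMorphism.Build _ _ j j_zmod.
pose jM' := GRing.isMonoidMorphism.Build _ _ j j_mon.
pose j' : {rmorphism E -> F'} := HB.pack j jM jM'.
exists j' => [a|] /=; rewrite /j.
  transitivity (ev a%:P); last by rewrite /ev map_polyC hornerC.
  by apply: evP; rewrite -gP map_polyC hornerC.
transitivity (ev 'X); last by rewrite /ev map_polyX hornerX.
by apply: evP; rewrite -gP map_polyX hornerX.
Qed.

End SimpleExtensions.

Lemma adjoin_root_model (F F' : fieldType) (iota : {rmorphism F -> F'})
    (q : {poly F}) z : q != 0 -> root (map_poly iota q) z ->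
  exists (M : fieldExtType F) (j : {rmorphism M -> F'}) (y : M),
    [/\ j \o base_emb M =1 iota, j y = z & (\dim {:M} < size q)%N].
Proof.
move=> q0 qz.
have [|p p_irr pz] := @minpoly_exists _ _ iota z; first by exists q.
have [M dimM [y py M_gen]] := irredp_FAdjoin p_irr.
have [j jb jy] := simple_extension_map p_irr py M_gen pz.
exists M, j, y; split=> //; rewrite dimM.
have := dvdp_leq q0 (minpoly_dvd p_irr pz qz).
by have [+ _] := p_irr; case: (size p).
Qed.

(** The elements of s are adjoined one at a time, and P is carried along. *)
Lemma finite_model_ind (K F : fieldType) (kappa : {rmorphism K -> F})
    (P : forall E : fieldExtType K, {rmorphism E -> F} -> Prop) :
  P K^o (kappa : {rmorphism K^o -> F}) ->
  (forall (E : fieldExtType K) (j : {rmorphism E -> F}) (p : {poly E})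
      (M : fieldExtType E) (z : M) (j' : {rmorphism M -> F}),
    j \o base_emb E =1 kappa -> P E j -> irreducible_poly p ->
    \dim {:M} = (size p).-1 -> root (map_poly (base_emb M) p) z ->
    <<1; z>>%VS = fullv -> j' \o base_emb M =1 j -> P (baseFieldType M) j') ->
  forall s : seq F, {in s, forall x, algebraicOver kappa x} ->
  exists (E : fieldExtType K) (j : {rmorphism E -> F}),
    [/\ j \o base_emb E =1 kappa, P E j & {in s, forall x, exists e, j e = x}].
Proof.
move=> P0 PS; elim=> [_|x s IHs s_alg].
  by exists K^o, (kappa : {rmorphism K^o -> F}); split=> // a; congr (kappa _); apply: mulr1.
have [|E [j [jb PE sE]]] := IHs; first by move=> y ys; apply: s_alg; rewrite inE ys orbT.
have [q q0 qx] := s_alg x (mem_head _ _).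
have [|p p_irr px] := @minpoly_exists _ _ j x.
  exists (map_poly (base_emb E) q); rewrite ?map_poly_eq0 // -map_poly_comp.
  by rewrite (eq_map_poly jb).
have [M dimM [z pz M_gen]] := irredp_FAdjoin p_irr.
have [j' jb' jz] := simple_extension_map p_irr pz M_gen px.
exists (baseFieldType M), j'; split.
- by move=> a; rewrite -jb; apply: (jb' (base_emb E a)).
- exact: (PS E j p M z j').
- move=> y; rewrite inE => /predU1P[->|/sE[e <-]]; first by exists z.
  by exists (base_emb M e); apply: jb'.
Qed.

Lemma finite_model (K F : fieldType) (F' : closedFieldType)
    (kappa : {rmorphism K -> F}) (iota : {rmorphism K -> F'}) (s : seq F) :
    {in s, forall x, algebraicOver kappa x} ->
  exists (E : fieldExtType K) (j : {rmorphism E -> F}) (j' : {rmorphism E -> F'}),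
    [/\ j \o base_emb E =1 kappa, j' \o base_emb E =1 iota &
        {in s, forall x, exists e, j e = x}].
Proof.
move=> s_alg; have [||E [j [jb [j' jb'] jE]]] := @finite_model_ind K F kappa
  (fun E _ => exists j' : {rmorphism E -> F'}, j' \o base_emb E =1 iota) _ _ s s_alg.
- by exists (iota : {rmorphism K^o -> F'}) => a; congr (iota _); apply: mulr1.
- move=> E j p M z j' _ [j1 jb1] p_irr _ pz M_gen _.
  have /closed_rootP[z' pz'] : size (map_poly j1 p) != 1.
    by rewrite size_map_poly; have [+ _] := p_irr; case: ltngtP.
  have [j2 jb2 _] := simple_extension_map p_irr pz M_gen pz'.
  by exists j2 => a; rewrite -jb1; apply: (jb2 (base_emb E a)).
by exists E, j, j'.
Qed.

(** * Traces of separable extensions *)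

Section SeparableTrace.
Variables (F : fieldType) (E : fieldExtType F) (z : E) (p : {poly F}).
Hypotheses (p_irr : irreducible_poly p) (pz : root (map_poly (base_emb E) p) z).
Hypothesis dimE : \dim {:E} = (size p).-1.

Local Notation iota := (base_emb E).

Lemma power_basis : exists c, is_basis iota (fun i : 'I_(\dim {:E}) => z ^+ i) c.
Proof.
apply: (lin_indep_basis_card (fieldExt_basis E)) => // a a0 j.
pose q := \poly_(i < \dim {:E}) (if insub i is Some k then a k else 0).
have qE (i : 'I_(\dim {:E})) : q`_i = a i by rewrite coef_poly ltn_ord valK.
have qz : root (map_poly iota q) z.
  rewrite /root (@horner_coef_wide _ (\dim {:E})) ?size_map_poly ?size_poly //.
  by apply/eqP; rewrite -[RHS]a0; apply: eq_bigr => i _; rewrite coef_map qE.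
rewrite -qE; have [->|q0] := eqVneq q 0; first by rewrite coef0.
have := dvdp_leq q0 (minpoly_dvd p_irr pz qz); rewrite leqNgt => /negP[].
rewrite (leq_ltn_trans (size_poly _ _)) // dimE prednK //.
by have [+ _] := p_irr; apply: ltnW.
Qed.

(** Euler's formula: if Q = p / (X - z), multiplication by the i-th
    coefficient of Q turns the i-th coordinate for the basis of the powers of
    z into the last one, so that the trace of x is the last coordinate of
    x * Q(z) = x * p'(z), up to the leading coefficient of p. *)
Lemma simple_separable_trace : separable_poly p ->
  exists (I : finType) (b : I -> E) c, is_basis iota b c /\
    exists x, basis_trace b c x != 0.
Proof.
move=> p_sep; have [c cP] := power_basis; move: c cP.
have p0 := irredp_neq0 p_irr; have p_gt1 : (1 < size p)%N by have [] := p_irr.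
have [d Ed] : exists d, \dim {:E} = d.+1.
  by exists (size p).-2; rewrite dimE; case: (size p) p_gt1 => [|[|n]].
have sp : size p = d.+2 by rewrite -Ed dimE prednK // ltnW.
rewrite Ed => c cP; exists 'I_d.+1, (fun i : 'I_d.+1 => z ^+ i), c; split=> //.
pose l := lead_coef p; have l0 : l != 0 by rewrite lead_coef_eq0.
have pl : p`_d.+1 = l by rewrite /l lead_coefE sp.
pose phi x := c x ord_max.
have [Q EQ] : exists Q, map_poly iota p = Q * ('X - z%:P) by apply/factor_theorem.
have Qcoef i : iota p`_i.+1 = Q`_i - z * Q`_i.+1.
  have := congr1 (fun q : {poly E} => q`_i.+1) EQ.
  by rewrite coef_map mulrBr coefB coefMX coefMC mulrC.
have Q0 : Q != 0.
  by apply: contraNneq p0 => Q0; rewrite -(map_poly_eq0 iota) EQ Q0 mul0r.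
have sQ : size Q = d.+1.
  have := size_map_poly iota p; rewrite EQ size_mul ?polyXsubC_eq0 // size_XsubC sp.
  by rewrite addn2 /= => -[].
have lE : iota l * z ^+ d.+1 = - \sum_(i < d.+1) iota p`_i * z ^+ i.
  apply/eqP; rewrite -addr_eq0 addrC; apply/eqP; rewrite -[RHS](eqP pz).
  rewrite (@horner_coef_wide _ d.+2) ?size_map_poly ?sp // [RHS]big_ord_recr /=.
  by rewrite coef_map pl; congr (_ + _); apply: eq_bigr => i _; rewrite coef_map.
have shift x (i i' : 'I_d.+1) : i.+1 = i' ->
    l * c (z * x) i' = l * c x i - phi x * p`_i'.
  move=> ii'; rewrite -(coord_basisZ cP).
  have -> : iota l * (z * x) = \sum_(k < d.+1) iota (l * c x k) * z ^+ k.+1.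
    rewrite {1}(basis_sum cP x) !mulr_sumr; apply: eq_bigr => k _.
    by rewrite rmorphM -mulrA; congr (_ * _); rewrite mulrCA exprS.
  rewrite big_ord_recr /= (_ : iota (l * c x ord_max) * z ^+ d.+1 =
    - \sum_(k < d.+1) iota (phi x * p`_k) * z ^+ k); last first.
    rewrite mulrC rmorphM mulrA [_ * iota l]mulrC lE mulNr mulrC mulr_sumr.
    by congr (- _); apply: eq_bigr => k _; rewrite rmorphM mulrA.
  rewrite (coord_basisD cP) (coord_basisN cP) (coord_basis_sum cP (fun k => phi x * p`_k)).
  congr (_ - _); rewrite (coord_basis_big cP).
  have id : (i < d)%N by have := ltn_ord i'; rewrite -ii'.
  rewrite (bigD1 (Ordinal id)) //= big1 ?addr0.
    rewrite (coord_basisZ cP) ii' (coord_basisE cP) eqxx mulr1.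
    by congr (_ * c _ _); apply: val_inj.
  move=> k ki; have kd : (k.+1 < d.+1)%N by rewrite ltnS.
  rewrite (coord_basisZ cP) -[z ^+ k.+1]/(z ^+ (Ordinal kd)) (coord_basisE cP).
  rewrite -val_eqE /= -ii' eqSS; move: ki; rewrite -val_eqE /= => /negPf->.
  by rewrite mulr0.
have Qphi k (i : 'I_d.+1) x : (i + k = d)%N -> l * c x i = c (Q`_i * x) ord_max.
  elim: k i x => [|k IHk] i x ik.
    have -> : i = ord_max by apply: val_inj; move: ik; rewrite addn0.
    have := Qcoef d; rewrite pl [Q`_d.+1]nth_default ?sQ // mulr0 subr0 => <-.
    by rewrite (coord_basisZ cP).
  have id : (i.+1 < d.+1)%N.
    have : (i < i + k.+1)%N by rewrite addnS ltnS leq_addr.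
    by rewrite ik.
  have := Qcoef i; move/eqP; rewrite eq_sym subr_eq => /eqP->.
  rewrite mulrDl (coord_basisD cP) (coord_basisZ cP) -mulrA mulrCA.
  rewrite -(IHk (Ordinal id)); last by rewrite /= addSn -addnS.
  by rewrite (shift _ i) //= addrC /phi [p`_i.+1 * _]mulrC subrK.
have trE x : l * basis_trace (fun i : 'I_d.+1 => z ^+ i) c x =
    phi (x * (map_poly iota p)^`().[z]).
  have -> : (map_poly iota p)^`().[z] = Q.[z].
    by rewrite EQ derivM derivXsubC mulr1 hornerD hornerM hornerXsubC subrr mulr0 add0r.
  rewrite (@horner_coef_wide _ d.+1) ?sQ // [x * _]mulr_sumr /phi (coord_basis_big cP).
  rewrite /basis_trace mulr_sumr; apply: eq_bigr => i _.
  have id : (i + (d - i) = d)%N by rewrite subnKC // -ltnS.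
  by rewrite (Qphi _ i _ id); congr (c _ _); apply: mulrCA.
have p'z : (map_poly iota p)^`().[z] != 0.
  rewrite deriv_map; apply: (coprimep_root _ pz).
  by rewrite coprimep_map; move: p_sep; rewrite unlock.
exists (z ^+ d / (map_poly iota p)^`().[z]); apply: contraNneq l0 => tr0.
have := trE (z ^+ d / (map_poly iota p)^`().[z]).
rewrite tr0 mulr0 divfK // /phi -[z ^+ d]/(z ^+ (ord_max : 'I_d.+1)).
by rewrite (coord_basisE cP) eqxx => /esym/eqP; rewrite oner_eq0.
Qed.

End SeparableTrace.

Section BasisTransport.
Variables (K F : fieldType).

Lemma is_basis_ext (iota iota' : {rmorphism K -> F}) (I : finType) (b : I -> F) c :
  iota =1 iota' -> is_basis iota b c -> is_basis iota' b c.
Proof.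
move=> ii [h1 h2]; split=> [x|d i].
  by rewrite {1}(h1 x); apply: eq_bigr => j _; rewrite ii.
by rewrite -[RHS](h2 d); congr (c _ _); apply: eq_bigr => j _; rewrite ii.
Qed.

Lemma is_basis_push (F' : fieldType) (iota : {rmorphism K -> F})
    (iota' : {rmorphism K -> F'}) (j : {rmorphism F -> F'}) (g : F' -> F)
    (I : finType) (b : I -> F) c :
  j \o iota =1 iota' -> cancel g j -> is_basis iota b c ->
  is_basis iota' (fun i => j (b i)) (fun x => c (g x)).
Proof.
move=> ji gK bP; have jK : cancel j g by move=> x; apply: (fmorph_inj j); rewrite gK.
split=> [x|d i].
  rewrite -{1}(gK x) {1}(basis_sum bP (g x)) rmorph_sum; apply: eq_bigr => k _.
  by rewrite rmorphM -ji.
rewrite -[RHS](coord_basis_sum bP d); congr (c _ _); rewrite -[RHS]jK; congr g.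
by rewrite rmorph_sum; apply: eq_bigr => k _; rewrite rmorphM -ji.
Qed.

Lemma field_degree_basis (iota : {rmorphism K -> F}) n (b : 'I_n -> F) :
    (forall y, exists! c : {ffun 'I_n -> K}, y = \sum_i iota (c i) * b i) ->
  exists c, is_basis iota b c.
Proof.
move=> bP.
have [c cP] := choice (fun y => let: ex_intro c h := bP y in
  ex_intro (fun c : {ffun 'I_n -> K} => y = \sum_i iota (c i) * b i) c h.1).
exists (fun y i => c y i); split=> // d i.
have [c0 [_ c0u]] := bP (\sum_j iota (d j) * b j).
have <- := c0u _ (cP _).
have -> : c0 = [ffun i => d i]; last by rewrite ffunE.
by apply: c0u; apply: eq_bigr => j _; rewrite ffunE.
Qed.

End BasisTransport.

(** The trace is a composite of traces of simple separable extensions, and these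
    are onto as soon as they do not vanish. *)
Lemma separable_trace (K F : fieldType) (kappa : {rmorphism K -> F})
    (I : finType) (b : I -> F) c :
    is_basis kappa b c -> separable_extension kappa ->
  exists x, basis_trace b c x != 0.
Proof.
move=> bP F_sep.
have [|||E [j [jb [J [d [d' [dP [x x0]]]]] jE]]] := @finite_model_ind K F kappa
  (fun E _ => exists (I : finType) (b : I -> E) c, is_basis (base_emb E) b c /\
    exists x, basis_trace b c x != 0) _ _ [seq b i | i <- enum I].
- exists unit, (fun=> 1), (fun x _ => x); split.
    split=> [x|d []]; rewrite (bigD1 tt) //= big1 ?addr0; try by case.
      by rewrite mulr1; apply/esym/mulr1.
    by rewrite mulr1; apply/mulr1.
  exists 1; rewrite /basis_trace (bigD1 tt) //= big1; last by case.
  by rewrite addr0 mulr1 oner_eq0.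
- move=> E j p M z j' jb [J [d [d' [dP [x x0]]]]] p_irr dimM pz M_gen jb'.
  have p_sep : separable_poly p.
    have [q [q_irr qz q_sep]] := F_sep (j' z).
    have : p %| map_poly (base_emb E) q.
      apply: (minpoly_dvd p_irr pz); rewrite /root -(fmorph_eq0 j') -horner_map.
      rewrite -!map_poly_comp (eq_map_poly (g := kappa)) // => a.
      exact: etrans (jb' (base_emb E a)) (jb a).
    by move=> /dvdp_separable; apply; rewrite separable_map.
  have [I' [b' [c' [bP' [y y0]]]]] := simple_separable_trace p_irr pz dimM p_sep.
  exists (J * I')%type, (tower_basis (base_emb M) d b'), (tower_coord d' c'); split.
    exact: is_basis_ext (tower_basisP dP bP').
  exists (base_emb M (x / basis_trace b' c' y) * y).
  rewrite (basis_trace_tower dP bP') (basis_traceZ bP') divfK //.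
- by move=> x _; have [q [q_irr qx _]] := F_sep x; exists q => //; apply: irredp_neq0.
have [g gK] : exists g, cancel g j.
  have jsurj y : exists e, j e = y.
    have [i|ee eeP] := @fin_all_exists I (fun=> E) (fun i e => j e = b i).
      by apply: jE; apply: map_f; rewrite mem_enum.
    exists (\sum_i base_emb E (c y i) * ee i); rewrite rmorph_sum (basis_sum bP y).
    by apply: eq_bigr => i _; rewrite rmorphM eeP -(basis_sum bP y); congr (_ * _); apply: jb.
  by have [g gP] := choice jsurj; exists g.
have bP' := is_basis_push jb gK dP.
exists (j x); rewrite (basis_trace_indep bP bP'); apply: contraNneq x0 => tr0.
have jK : cancel j g by move=> y; apply: (fmorph_inj j); rewrite gK.
rewrite -tr0; apply/eqP; apply: eq_bigr => i _.
by rewrite -rmorphM jK.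
Qed.

(** * Elements whose trace is a unit *)

Section TameTrace.
Variables (L M : fieldType) (iota : {rmorphism L -> M}) (u : valuation M).
Variables (I : finType) (b : I -> M) (c : M -> I -> L).
Hypothesis bP : is_basis iota b c.
Variables (e f : nat) (t : 'I_e -> M) (s : 'I_f -> M).
Hypotheses (tP : coset_reps iota u t) (sP : residue_basis iota u s).
Hypothesis n_ef : #|I| = (e * f)%N.
Hypothesis e_unit : ~~ vsdvd u 1 e%:R.
Hypothesis res_sep : separable_extension (residue_map iota u : {rmorphism _ -> _}).

(** In the standard basis the trace of an integral z is, up to the maximal
    ideal, e times the trace of the residue of z. *)
Lemma tame_unit_trace : exists2 z, vdvd u 1 z &
  ~~ vsdvd (restrict iota u) 1 (basis_trace b c z).
Proof.
have [c' cP'] := standard_basis bP tP sP n_ef.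
have [s0 ts] := standard_val_indep tP sP.1.
have [r rE] := fin_all_exists (fun j => mk_vring (sP.1.1 j)).
have [d dP] := field_degree_basis (residue_basis_res sP rE).
have [x] := separable_trace dP res_sep.
have [zeta ->] := res_surj x; set z := val zeta => tr0.
exists z; first exact: vring_vdvd.
have H j k := res_surj (d (res zeta * res (r j)) k).
have [gam gamE] : exists gam : 'I_f -> 'I_f -> vring (restrict iota u),
    forall j k, d (res zeta * res (r j)) k = res (gam j k).
  by have [g gE] := fin_all_exists (fun j => fin_all_exists (H j)); exists g.
pose rho j := z * s j - \sum_k iota (val (gam j k)) * s k.
have rhoP j : vsdvd u 1 (rho j).
  pose y := \sum_k vring_map (gam j k) * r k.
  have yE : val y = \sum_k iota (val (gam j k)) * val (r k) by rewrite vring_sum.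
  have : res (zeta * r j) = res y.
    rewrite resM -(residue_map_sum yE) {1}(basis_sum dP (res zeta * res (r j))).
    by apply: eq_bigr => k _; rewrite gamE.
  move/res_eq; congr (vsdvd _ _ (_ - _)); first by rewrite -rE.
  by rewrite yE; apply: eq_bigr => k _; rewrite rE.
pose del i j := c' (t i * rho j) (i, j).
have t0 i : t i != 0 by case: tP.
have delP i j : vsdvd (restrict iota u) 1 (del i j).
  rewrite vsdvd_restrict rmorph1.
  have := ts (c' (t i * rho j)) (i, j); rewrite -(basis_sum cP') /= -/(del i j).
  rewrite mulrCA vdvd_mul2l // => h.
  apply: (vsdvd_dvd_trans (rhoP j)); apply: (vdvd_trans h).
  by rewrite -[X in vdvd _ _ X]mulr1 vdvdMl // (residue_indep_unit sP.1).
have trE : basis_trace b c z = \sum_ij (val (gam ij.2 ij.2) + del ij.1 ij.2).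
  rewrite (basis_trace_indep bP cP'); apply: eq_bigr => -[i j] _ /=.
  have -> : z * (t i * s j) = \sum_k iota (val (gam j k)) * (t i * s k) + t i * rho j.
    rewrite mulrBr [t i * (z * _)]mulrCA mulr_sumr addrC.
    rewrite -addrA -[LHS]addr0; congr (_ + _).
    rewrite -sumrN -big_split big1 // => k _ /=.
    by rewrite [t i * (iota _ * _)]mulrCA addNr.
  rewrite (coord_basisD cP'); congr (_ + _); rewrite (coord_basis_big cP').
  rewrite (bigD1 j) //= (coord_basisZ cP') -[t i * s j]/(t (i, j).1 * s (i, j).2).
  rewrite (coord_basisE cP') eqxx mulr1 big1 ?addr0 // => k kj.
  rewrite (coord_basisZ cP') -[t i * s k]/(t (i, k).1 * s (i, k).2).
  by rewrite (coord_basisE cP') xpair_eqE (negPf kj) andbF mulr0.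
have trS : basis_trace b c z = e%:R * (\sum_j val (gam j j)) + \sum_ij del ij.1 ij.2.
  rewrite trE big_split /=; congr (_ + _).
  rewrite -(pair_bigA _ (fun i j => val (gam j j))) /= sumr_const card_ord.
  by rewrite mulr_natl.
apply/negP; rewrite trS => h; move: tr0; apply/negP; rewrite negbK.
have {}h : vsdvd (restrict iota u) 1 (e%:R * (\sum_j val (gam j j))).
  rewrite -[X in vsdvd _ _ X](addrK (\sum_ij del ij.1 ij.2)) vsdvdB //.
  by apply: vsdvd_sum => [|ij _]; rewrite ?oner_neq0.
have -> : basis_trace (fun j => res (r j)) d (res zeta) = res (\sum_j gam j j).
  by rewrite res_sum; apply: eq_bigr => j _; rewrite gamE.
rewrite res_eq0 vring_sum /=; apply: contraLR h => h.
rewrite /vsdvd negbK in h *; rewrite -[X in vdvd _ _ X]mulr1 negbK; apply: vdvdM => //.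
by move: e_unit; rewrite /vsdvd negbK vdvd_restrict rmorph1 rmorph_nat.
Qed.

End TameTrace.

Section TraceCriterion.
Variables (L M : fieldType) (iota : {rmorphism L -> M}).
Variables (v : valuation L) (u : valuation M).
Hypothesis vu : extends iota v u.
Hypothesis M_alg : algebraic_extension iota.
Hypothesis u_int : forall y, vdvd u 1 y -> integral_over iota v y.
Variables (I : finType) (b : I -> M) (c : M -> I -> L).
Hypothesis bP : is_basis iota b c.

(** If the standard family of e * f elements did not span, some nonzero y
    would be orthogonal to it for the trace form. But z / y is congruent to
    an element of the span, so the trace of z would lie in the maximal ideal. *)
Lemma unit_trace_defectless z : vdvd u 1 z -> ~~ vsdvd v 1 (basis_trace b c z) ->
  exists e f (t : 'I_e -> M) (s : 'I_f -> M),
    [/\ coset_reps iota u t, residue_basis iota u s & #|I| = (e * f)%N].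
Proof.
move=> z1 trz.
have [e [t tP]] := coset_reps_exist u bP; have [f [s sP]] := residue_basis_exists u bP.
exists e, f, t, s; split=> //; apply/eqP; rewrite eqn_leq (standard_card bP tP sP) andbT.
rewrite leqNgt; apply/negP => ef_n.
pose A : 'M[L]_(#|I|, #|{: 'I_e * 'I_f}|) := \matrix_(i, k)
  basis_trace b c (b (enum_val i) * (t (enum_val k).1 * s (enum_val k).2)).
have [|y y0 yA] := kernel_exists A; first by rewrite card_prod !card_ord.
pose w := \sum_i iota (y 0 (enum_rank i)) * b i.
have w0 : w != 0.
  apply: contra_neq y0 => w0; apply/rowP => i; rewrite mxE.
  rewrite -(enum_valK i) -(coord_basis_sum bP (fun i => y 0 (enum_rank i))).
  by rewrite -/w w0 (coord_basis0 bP).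
have trD := basis_traceD bP; have trZ := basis_traceZ bP.
have tr0 : basis_trace b c 0 = 0 by have := trZ 0 0; rewrite mul0r rmorph0 mul0r.
have tr_sum (J : finType) (G : J -> M) :
    basis_trace b c (\sum_j G j) = \sum_j basis_trace b c (G j).
  by apply: (big_morph _ trD tr0).
have orth ij : basis_trace b c (w * (t ij.1 * s ij.2)) = 0.
  have := congr1 (fun B : 'rV_ _ => B 0 (enum_rank ij)) yA; rewrite !mxE => <-.
  rewrite mulr_suml tr_sum (reindex (@enum_val I predT)) /=; last first.
    exact/onW_bij/enum_val_bij.
  by apply: eq_bigr => i _; rewrite !mxE -mulrA trZ enum_valK enum_rankK.
have z0 : z != 0 by apply: contraNneq trz => ->; rewrite tr0 vsdvdx0 oner_neq0.
have [d xd] := standard_leading tP sP (mulf_neq0 z0 (etrans (congr1 negb (invr_eq0 _)) w0)).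
set x := z / w in xd; pose S := \sum_ij iota (d ij) * (t ij.1 * s ij.2).
have trS : basis_trace b c (w * S) = 0.
  rewrite mulr_sumr tr_sum big1 // => ij _.
  by rewrite mulrCA trZ orth mulr0.
have Ez : basis_trace b c z = basis_trace b c (w * (x - S)).
  rewrite mulrBr -mulrN trD mulrN -mulN1r -(rmorphN1 iota) trZ trS mulr0 addr0.
  by rewrite /x mulrCA mulfV // mulr1.
move/negP: trz; apply; rewrite Ez; apply: (trace_max_ideal vu M_alg u_int bP).
apply: vdvd_sdvd_trans z1 _.
have -> : z = w * x by rewrite /x mulrCA mulfV // mulr1.
by rewrite vsdvd_mul2l.
Qed.

End TraceCriterion.

(** * Algebraic extensions of tame fields *)

Lemma algebraic_trans (K L M : fieldType) (kappa : {rmorphism K -> L})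
    (iota : {rmorphism L -> M}) :
  algebraic_extension kappa -> algebraic_extension iota ->
  algebraic_extension (iota \o kappa : {rmorphism K -> M}).
Proof.
move=> L_alg M_alg y; apply/integral_algebraic.
have /integral_algebraic[q q_mon qy] := M_alg y.
apply: (@integral_root_monic _ _ _ y (map_poly iota q)) => //.
  by rewrite map_monic.
apply/integral_poly => i; rewrite coef_map; apply: integral_rmorph.
exact/integral_algebraic.
Qed.

Lemma basis_algebraic (L M : fieldType) (iota : {rmorphism L -> M}) (I : finType)
    (b : I -> M) c : is_basis iota b c -> algebraic_extension iota.
Proof.
move=> /basis_ordinal[n [b' [c' [_ bP]]]] x.
exists (char_poly (mul_mx b' c' x)); first exact/monic_neq0/char_poly_monic.
apply/eqP; set y := _.[x].
have y0 : mul_mx b' c' y = 0 by rewrite (mul_mx_horner bP) Cayley_Hamilton.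
rewrite -[y]mulr1 (basis_sum bP 1) mulr_sumr big1 // => i _.
rewrite mulrCA (basis_sum bP (y * b' i)) big1 ?mulr0 // => j _.
have := congr1 (fun A : 'M_ _ => A i j) y0; rewrite !mxE => ->.
by rewrite rmorph0 mul0r.
Qed.

Lemma fieldExt_algebraic (L : fieldType) (M : fieldExtType L) :
  algebraic_extension (base_emb M).
Proof. exact: basis_algebraic (fieldExt_basis M). Qed.

Lemma coset_reps_unique (K L : fieldType) (iota : {rmorphism K -> L})
    (w : valuation L) e e' (t : 'I_e -> L) (t' : 'I_e' -> L) :
  coset_reps iota w t -> coset_reps iota w t' -> e = e'.
Proof.
have half n n' (r : 'I_n -> L) (r' : 'I_n' -> L) :
    coset_reps iota w r -> coset_reps iota w r' -> (n <= n')%N.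
  move=> [r0 rP] [r0' rP'].
  have [g gP] := fin_all_exists (fun i => rP' (r i) (r0 i)).
  suff /leq_card : injective g by rewrite !card_ord.
  move=> i k gik; have [[a a0 ia] _] := gP i; have [[d d0 kd] _] := gP k.
  have [j [_ jP]] := rP (r i) (r0 i); rewrite -(jP i); last first.
    by exists 1; rewrite ?oner_neq0 // rmorph1 mul1r /veq vdvdxx.
  have ia0 : iota a != 0 by rewrite fmorph_eq0.
  have id0 : iota d != 0 by rewrite fmorph_eq0.
  apply: jP; exists (a / d); first by rewrite mulf_neq0 ?invr_eq0.
  apply: veq_trans ia _; rewrite fmorph_div mulrAC -mulrA veq_mul2l //.
  rewrite -(veq_mul2l _ _ _ id0) mulrCA mulfV // mulr1 gik veq_sym.
  exact: kd.
by move=> tP tP'; apply/eqP; rewrite eqn_leq (half _ _ _ _ tP tP') (half _ _ _ _ tP' tP).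
Qed.

Lemma basis_trace_square (L M L' M' : fieldType) (iota : {rmorphism L -> M})
    (iota' : {rmorphism L' -> M'}) (g : {rmorphism L' -> L}) (h : {rmorphism M' -> M})
    (I : finType) (b : I -> M) c (b' : I -> M') c' :
    h \o iota' =1 iota \o g -> is_basis iota b c -> is_basis iota' b' c' ->
    (forall i, h (b' i) = b i) ->
  forall x, basis_trace b c (h x) = g (basis_trace b' c' x).
Proof.
move=> sq bP bP' hb x; rewrite rmorph_sum; apply: eq_bigr => i _.
rewrite -(coord_basis_sum bP (fun k => g (c' (x * b' i) k))); congr (c _ _).
rewrite -hb -rmorphM {1}(basis_sum bP' (x * b' i)) rmorph_sum.
by apply: eq_bigr => k _; rewrite rmorphM hb; congr (_ * _); apply: sq.
Qed.

Lemma base_emb_mull (L : fieldType) (M : fieldExtType L) a (x : M) :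
  base_emb M a * x = a *: x.
Proof. exact: mulr_algl. Qed.

(** When E contains the structure constants of b, the span of b over E is closed
    under multiplication, and so is a field of the same degree over E. *)
Lemma descend_basis (L M E : fieldType) (F : fieldExtType E) (iota : {rmorphism L -> M})
    (g : {rmorphism E -> L}) (h : {rmorphism F -> M}) (I : finType) (b : I -> M) c :
    h \o base_emb F =1 iota \o g -> is_basis iota b c ->
    (forall i, exists y, h y = b i) ->
    (forall k, exists a, g a = c 1 k) ->
    (forall i j k, exists a, g a = c (b i * b j) k) ->
  exists (S : fieldExtType E) (l : {rmorphism S -> F}) (b' : I -> S) c',
    [/\ l \o base_emb S =1 base_emb F, is_basis (base_emb S) b' c' &
      forall i, h (l (b' i)) = b i].
Proof.
move=> sq bP hb g1 gb.
have [be beP] := fin_all_exists hb.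
pose V := (\sum_i <[be i]>)%VS.
have lin (a : I -> E) x : h x = \sum_i iota (g (a i)) * b i ->
    x = \sum_i a i *: be i.
  move=> hx; apply: (fmorph_inj h); rewrite hx rmorph_sum; apply: eq_bigr => i _.
  rewrite -base_emb_mull rmorphM beP; congr (_ * _).
  by apply/esym; apply: sq.
have inV (a : I -> E) : \sum_i a i *: be i \in V.
  by apply: memv_sumr => i _; rewrite memvZ // memv_line.
have V1 : 1 \in V.
  have [a aP] := fin_all_exists g1; rewrite (lin a 1) //.
  by rewrite rmorph1 {1}(basis_sum bP 1); apply: eq_bigr => i _; rewrite aP.
have Vb i j : be i * be j \in V.
  have [a aP] := fin_all_exists (gb i j); rewrite (lin a (be i * be j)) //.
  by rewrite rmorphM !beP {1}(basis_sum bP (b i * b j)); apply: eq_bigr => k _; rewrite aP.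
have VE x : x \in V -> exists a, x = \sum_i a i *: be i.
  move=> /memv_sumP[y yV ->].
  have [a aP] := fin_all_exists (fun i => (vlineP _ _ (yV i isT))).
  by exists a; apply: eq_bigr => i _.
have V_asp : is_aspace V.
  rewrite /is_aspace has_algid1 //; apply/prodvP => x y /VE[a ->] /VE[d ->].
  rewrite mulr_suml memv_suml // => i _; rewrite mulr_sumr memv_suml // => j _.
  by rewrite -scalerAl -scalerAr !memvZ.
pose S : {subfield F} := ASpace V_asp.
have beS i : be i \in S.
  by rewrite memvE; apply: (sumv_sup i).
pose b' i : subvs_of S := Subvs (beS i).
have b'_indep : lin_indep (base_emb (subvs_of S)) b'.
  move=> d d0 j; apply: (fmorph_inj g); rewrite rmorph0.
  have : h (vsval (\sum_j base_emb (subvs_of S) (d j) * b' j)) = 0.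
    by rewrite d0 linear0 rmorph0.
  rewrite linear_sum rmorph_sum => E0.
  rewrite -(coord_basis_sum bP (fun i => g (d i)) j) -(coord_basis0 bP j).
  congr (c _ _); rewrite -[RHS]E0; apply: eq_bigr => i _.
  rewrite base_emb_mull linearZ /= -base_emb_mull rmorphM beP; congr (_ * _).
  by apply/esym; apply: sq.
have span (x : subvs_of S) : exists a : I -> E, x = \sum_i base_emb (subvs_of S) (a i) * b' i.
  have [a aP] := VE _ (subvsP x); exists a; apply: val_inj => /=.
  rewrite aP raddf_sum; apply: eq_bigr => i _; by rewrite base_emb_mull.
have [c' c'P] := choice span.
exists (subvs_of S), (vsval : {rmorphism subvs_of S -> F}), b', c'; split=> //.
- move=> a; congr (a *: _); exact: (rmorph1 (vsval : {rmorphism subvs_of S -> F})).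
- split=> // d i; apply/eqP; rewrite -subr_eq0; apply/eqP.
  apply: (b'_indep (fun i => c' (\sum_j base_emb _ (d j) * b' j) i - d i)).
  rewrite (eq_bigr (fun j => base_emb _ (c' (\sum_j base_emb _ (d j) * b' j) j) * b' j -
    base_emb _ (d j) * b' j)); first by rewrite sumrB -c'P subrr.
  by move=> j _; rewrite rmorphB mulrBl.
Qed.

Lemma restrict_extends (K L M : fieldType) (kappa : {rmorphism K -> L})
    (iota : {rmorphism L -> M}) (v : valuation K) (w : valuation L) (u : valuation M) :
  extends kappa v w -> extends iota w u ->
  extends (iota \o kappa : {rmorphism K -> M}) v u.
Proof.
move=> vw wu x; rewrite -!vdvd1 vdvd_restrict rmorph1 -(rmorph1 iota).
by rewrite (extends_vdvd wu) -(rmorph1 kappa) (extends_vdvd vw).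
Qed.

Lemma restrict_comp (K L M : fieldType) (kappa : {rmorphism K -> L})
    (iota : {rmorphism L -> M}) (v : valuation K) (u : valuation M)
    (tau : {rmorphism K -> M}) :
  iota \o kappa =1 tau -> extends tau v u -> extends kappa v (restrict iota u).
Proof.
move=> ik vu x; rewrite -!vdvd1 !vdvd_restrict -[iota (kappa 1)]/((iota \o kappa) 1).
by rewrite -[iota (kappa x)]/((iota \o kappa) x) !ik (extends_vdvd vu).
Qed.

Section TameImpliesDefectless.
Variables (K : fieldType) (Kt : closedFieldType) (iota : {rmorphism K -> Kt}).
Hypothesis Kt_closure : algebraic_extension iota.
Variable v : valuation K.
Hypothesis v_henselian : henselian iota v.

Section Extension.
Variables (L : fieldType) (kappa : {rmorphism K -> L}).
Hypothesis L_alg : algebraic_extension kappa.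
Variable w : valuation L.
Hypothesis vw : extends kappa v w.
Variables (M : fieldType) (lam : {rmorphism L -> M}).
Hypothesis M_alg : algebraic_extension lam.

Let comp_alg : algebraic_extension (lam \o kappa : {rmorphism K -> M}) :=
  algebraic_trans L_alg M_alg.

Lemma henselian_integral_above u : extends lam w u ->
  forall y, vdvd u 1 y -> integral_over lam w y.
Proof.
move=> wu y y1; have vu := restrict_extends vw wu.
have [p [p_mon pO py]] := henselian_integral Kt_closure v_henselian comp_alg vu y1.
exists (map_poly kappa p); rewrite map_monic -map_poly_comp; split=> //.
apply/polyOverP => i; rewrite coef_map -vdvd1 -(rmorph1 kappa) (extends_vdvd vw).
exact: polyOver_val_ring.
Qed.

Lemma henselian_unique_above u u' : extends lam w u -> extends lam w u' ->
  val_equiv u u'.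
Proof.
move=> wu wu'.
exact: (henselian_unique Kt_closure v_henselian comp_alg (restrict_extends vw wu)
  (restrict_extends vw wu')).
Qed.

End Extension.

Lemma tame_finite_unit_trace (E : fieldExtType K) (j : {rmorphism E -> Kt})
    (wt : valuation Kt) (I : finType) (b : I -> E) c :
    tame_extension iota wt -> j \o base_emb E =1 iota -> is_basis (base_emb E) b c ->
  exists2 z, vdvd (restrict j wt) 1 z &
    ~~ vsdvd (restrict (base_emb E) (restrict j wt)) 1 (basis_trace b c z).
Proof.
move=> [_ tame] jb bP; set u := restrict j wt.
have [e_p res_sep [_ [e [f [eP fP n_ef]]]]] := tame E j jb.
have [t tP] := (ramification_indexP _ _ _).1 eP.
have [s sP] := (residue_degreeP _ _ _).1 fP.
have cardI : #|I| = (e * f)%N.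
  rewrite -n_ef; apply/eqP; rewrite -[\dim _]card_ord eqn_leq.
  have indep (J J' : finType) (d : J -> E) d' (d1 : J' -> E) d1' :
      is_basis (base_emb E) d d' -> is_basis (base_emb E) d1 d1' -> (#|J| <= #|J'|)%N.
    move=> dP dP1; apply: (lin_indep_card dP1 (x := d)) => a a0 i.
    by rewrite -(coord_basis_sum dP a i) a0 (coord_basis0 dP).
  by rewrite (indep _ _ _ _ _ _ bP (fieldExt_basis E)) (indep _ _ _ _ _ _ (fieldExt_basis E) bP).
have e_gt0 : (0 < e)%N.
  by have := card_basis_gt0 bP; rewrite cardI muln_gt0 => /andP[].
apply: (tame_unit_trace bP tP sP cardI) => //.
apply/negP => e0.
have e0' : (e%:R : residue (restrict (base_emb E) u)) == 0.
  by rewrite res_nat res_eq0 vsdvd_restrict rmorph1 !rmorph_nat.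
have [p p_char] := natf0_pchar e_gt0 e0'.
have [e' e'P cop] := e_p p p_char.
have [t' t'P] := (ramification_indexP _ _ _).1 e'P.
have ee := coset_reps_unique tP t'P; move: cop; rewrite -ee coprime_sym.
rewrite prime_coprime; last by have := p_char; rewrite residue_pchar => /andP[].
by rewrite (dvdn_pcharf p_char) e0'.
Qed.

Hypothesis K_tame : tame_field iota v.

(** Let E be a finite extension of K in L that contains the structure constants
    of b, and S the space spanned over E by b, which is a field. As S is tame
    over K, it has an element z whose trace over K is a unit. This trace
    is the trace over K of the trace of z over E, so that the latter, which is
    also the trace of z over L, is a unit as well. *)
Lemma tame_unit_trace_above (L : fieldType) (kappa : {rmorphism K -> L})
    (w : valuation L) (M : fieldType) (lam : {rmorphism L -> M}) (u : valuation M)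
    (I : finType) (b : I -> M) c :
    algebraic_extension kappa -> extends kappa v w -> is_basis lam b c ->
    extends lam w u ->
  exists2 z, vdvd u 1 z & ~~ vsdvd w 1 (basis_trace b c z).
Proof.
move=> L_alg vw bP wu; have M_alg := basis_algebraic bP.
have [wt vwt _] := v_henselian; have [_ /(_ wt vwt) tame] := K_tame.
pose consts : seq L := [seq c 1 k | k <- enum I] ++
  [seq c (b ij.1 * b ij.2) k | ij <- enum {: I * I}, k <- enum I].
have [|E [g [g' [gb gb' gE]]]] := @finite_model K L Kt kappa iota consts.
  by move=> x _; apply: L_alg.
have [|F [h [h' [hb hb' hF]]]] := @finite_model E M Kt (lam \o g : {rmorphism E -> M}) g'
  [seq b i | i <- enum I].
  move=> x _; have [p p0 px] := algebraic_trans L_alg M_alg x.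
  exists (map_poly (base_emb E) p); first by rewrite map_poly_eq0.
  rewrite -map_poly_comp (eq_map_poly (g := lam \o kappa)) // => a.
  by rewrite /= -gb.
have [|k|i j k|S [l [b' [c' [lb bP' hlb]]]]] := descend_basis hb bP.
- by move=> i; apply: hF; apply: map_f; rewrite mem_enum.
- by apply: gE; rewrite mem_cat; apply/orP; left; apply: map_f; rewrite mem_enum.
- apply: gE; rewrite mem_cat; apply/orP; right.
  by apply/allpairsP; exists ((i, j), k); rewrite !mem_enum.
pose S0 : fieldExtType K := baseFieldType S.
pose j : {rmorphism S0 -> Kt} := (h' \o l : {rmorphism S -> Kt}).
pose hM : {rmorphism S -> M} := (h \o l : {rmorphism S -> M}).
have jb : j \o base_emb S0 =1 iota.
  move=> a; rewrite -gb'; apply: etrans (hb' (base_emb E a)).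
  by congr (h' _); apply: lb.
have EP := fieldExt_basis E.
have S0P := is_basis_ext (iota' := base_emb S0) (fun=> erefl) (tower_basisP EP bP').
have [z z1 trz] := tame_finite_unit_trace tame jb S0P.
have hMb : hM \o base_emb S =1 lam \o g.
  by move=> a; rewrite -hb /=; congr (h _); apply: lb.
have trE := basis_trace_square hMb bP bP' hlb z.
have lgk : (hM : {rmorphism S0 -> M}) \o base_emb S0 =1 (lam \o kappa : {rmorphism K -> M}).
  move=> a; apply: etrans (hMb (base_emb E a)) _.
  by congr (lam _); apply: gb.
have ext1 : extends (base_emb S0) v (restrict (hM : {rmorphism S0 -> M}) u).
  exact: restrict_comp lgk (restrict_extends vw wu).
have ext2 : extends (base_emb S0) v (restrict j wt) by apply: restrict_comp jb vwt.
exists (hM z).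
  have S0_alg : algebraic_extension (base_emb S0) by apply: fieldExt_algebraic.
  have := henselian_unique Kt_closure v_henselian S0_alg ext2 ext1 z.
  by rewrite -!vdvd1 z1 vdvd_restrict rmorph1 => /esym.
rewrite trE; apply: contra trz => tr1.
have extE : extends (base_emb E) v (restrict g w) by apply: restrict_comp gb vw.
have E_alg : algebraic_extension (base_emb E) by apply: fieldExt_algebraic.
have intE y : vdvd (restrict g w) 1 y -> integral_over (base_emb E) v y.
  exact: henselian_integral.
have := trace_max_ideal extE E_alg intE EP (x := basis_trace b' c' z).
rewrite vsdvd_restrict rmorph1 => /(_ tr1).
rewrite -(basis_trace_tower EP bP') -(extends_vsdvd ext2).
by rewrite -(vsdvd_restrict (base_emb S0)).
Qed.

Lemma tame_defectless (L : fieldType) (kappa : {rmorphism K -> L}) (w : valuation L) :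
  algebraic_extension kappa -> extends kappa v w -> defectless_field w.
Proof.
move=> L_alg vw M; have bP := fieldExt_basis M.
have [u wu] := extension_exists (base_emb M) w.
have M_alg : algebraic_extension (base_emb M) by apply: fieldExt_algebraic.
have u_int := henselian_integral_above L_alg vw M_alg wu.
have [z z1 trz] := tame_unit_trace_above L_alg vw bP wu.
have [e [f [t [s [tP sP n_ef]]]]] := unit_trace_defectless wu M_alg u_int bP z1 trz.
exists 1%N, (fun=> u), (fun=> e), (fun=> f); split=> //.
- by move=> i j _; rewrite !ord1.
- by move=> u' wu'; exists ord0; apply: (henselian_unique_above L_alg vw M_alg).
- move=> _; split; first by apply/ramification_indexP; exists t.
  by apply/residue_degreeP; exists s.
by rewrite big_ord1 -n_ef card_ord.
Qed.

End TameImpliesDefectless.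

(** * Elements without approximate p-th roots *)

(** The closure proof is a parameter of the type, so that the field structure
    can be found from the type alone. *)
Record subfield_of (F : fieldType) (S : {pred F}) (S_div : divring_closed S) :=
  SubfieldOf { subfield_val :> F; _ : subfield_val \in S }.

Section SubfieldModel.
Variables (F : fieldType) (S : {pred F}) (S_div : divring_closed S).

HB.instance Definition _ := GRing.isDivringClosed.Build F S S_div.
HB.instance Definition _ := [isSub of subfield_of S_div for @subfield_val F S S_div].
HB.instance Definition _ := [Choice of subfield_of S_div by <:].
HB.instance Definition _ := [SubChoice_isSubComUnitRing of subfield_of S_div by <:].
HB.instance Definition _ :=
  [SubComUnitRing_isSubIntegralDomain of subfield_of S_div by <:].
HB.instance Definition _ := [SubIntegralDomain_isSubField of subfield_of S_div by <:].

End SubfieldModel.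

Section IntermediateFields.
Variables (K F : fieldType) (iota : {rmorphism K -> F}).

Definition intermediate (S : set F) :=
  [/\ forall a, S (iota a), forall x y, S x -> S y -> S (x - y)
    & forall x y, S x -> S y -> S (x / y)].

Section Closure.
Variable S : set F.
Hypothesis S_int : intermediate S.

Lemma intermediate_base a : S (iota a). Proof. by case: S_int => h _ _; apply: h. Qed.
Lemma intermediate1 : S 1. Proof. by rewrite -(rmorph1 iota); apply: intermediate_base. Qed.
Lemma intermediate0 : S 0. Proof. by rewrite -(rmorph0 iota); apply: intermediate_base. Qed.
Lemma intermediateB x y : S x -> S y -> S (x - y).
Proof. by case: S_int => _ h _; apply: h. Qed.
Lemma intermediateD x y : S x -> S y -> S (x + y).
Proof.
move=> Sx Sy; rewrite -[y]opprK; apply: intermediateB => //.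
by rewrite -sub0r; apply: intermediateB => //; apply: intermediate0.
Qed.
Lemma intermediate_div x y : S x -> S y -> S (x / y).
Proof. by case: S_int => _ _ h; apply: h. Qed.
Lemma intermediateV x : S x -> S x^-1.
Proof. by rewrite -div1r; apply: intermediate_div; apply: intermediate1. Qed.
Lemma intermediateM x y : S x -> S y -> S (x * y).
Proof. by move=> Sx Sy; rewrite -[y]invrK; apply/intermediate_div/intermediateV. Qed.
Lemma intermediateX x n : S x -> S (x ^+ n).
Proof.
move=> Sx; elim: n => [|n IHn]; first by rewrite expr0; apply: intermediate1.
by rewrite exprS; apply: intermediateM.
Qed.

Lemma intermediate_model : exists (L : fieldType) (kappa : {rmorphism K -> L})
  (lam : {rmorphism L -> F}), lam \o kappa =1 iota /\
  forall x, S x <-> exists l, lam l = x.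
Proof.
pose V : {pred F} := fun x => `[< S x >].
have V_div : divring_closed V.
  split; first by apply/asboolP; apply: intermediate1.
    by move=> x y /asboolP Sx /asboolP Sy; apply/asboolP; apply: intermediateB.
  by move=> x y /asboolP Sx /asboolP Sy; apply/asboolP; apply: intermediate_div.
pose L : fieldType := subfield_of V_div.
pose lam : {rmorphism L -> F} := (val : subfield_of V_div -> F).
have lamP x : S x <-> exists l : L, lam l = x.
  split=> [Sx|[l <-]]; last exact/asboolP/(valP l).
  have xV : x \in V by apply/asboolP.
  by exists (SubfieldOf V_div xV).
have [k kP] := choice (fun a => (lamP _).1 (intermediate_base a)).
have k_zmod : zmod_morphism k.
  by move=> x y; apply: (fmorph_inj lam); rewrite kP [RHS]rmorphB !kP rmorphB.
have k_mon : monoid_morphism k.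
  split=> [|x y]; apply: (fmorph_inj lam); rewrite kP; first by rewrite !rmorph1.
  by rewrite [RHS]rmorphM !kP rmorphM.
pose kM := GRing.isZmodMorphism.Build _ _ k k_zmod.
pose kM' := GRing.isMonoidMorphism.Build _ _ k k_mon.
pose kappa : {rmorphism K -> L} := HB.pack k kM kM'.
by exists L, kappa, lam; split.
Qed.

End Closure.

Lemma intermediate_range (L : fieldType) (kappa : {rmorphism K -> L})
    (lam : {rmorphism L -> F}) :
  lam \o kappa =1 iota -> intermediate (fun x => exists l, lam l = x).
Proof.
move=> lk; split=> [a|_ _ [x <-] [y <-]|_ _ [x <-] [y <-]].
- by exists (kappa a); apply: lk.
- by exists (x - y); rewrite rmorphB.
- by exists (x / y); rewrite fmorph_div.
Qed.

Lemma intermediate_chain (C : set (set F)) :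
  (exists X, C X) -> (forall X, C X -> intermediate X) -> total_on C subset ->
  intermediate (\bigcup_(X in C) X)%classic.
Proof.
move=> [X0 CX0] gC Ctot.
have two a b : (\bigcup_(X in C) X)%classic a -> (\bigcup_(X in C) X)%classic b ->
    exists2 X, C X & X a /\ X b.
  move=> [X CX Xa] [Y CY Yb]; case: (Ctot _ _ CX CY) => XY.
    by exists Y => //; split=> //; apply: XY.
  by exists X => //; split=> //; apply: XY.
split=> [a|x y Sx Sy|x y Sx Sy].
- by exists X0 => //; apply: intermediate_base; apply: gC.
- have [X CX [Xx Xy]] := two _ _ Sx Sy; exists X => //.
  by apply: intermediateB => //; apply: gC.
have [X CX [Xx Xy]] := two _ _ Sx Sy; exists X => //.
by apply: intermediate_div => //; apply: gC.
Qed.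

Lemma subfield_algebraic (L : fieldType) (kappa : {rmorphism K -> L})
    (lam : {rmorphism L -> F}) : lam \o kappa =1 iota ->
  algebraic_extension iota -> algebraic_extension kappa.
Proof.
move=> lk F_alg y; have [p p0 py] := F_alg (lam y); exists p => //.
rewrite /root -(fmorph_eq0 lam) -horner_map -map_poly_comp.
by rewrite (eq_map_poly lk).
Qed.

End IntermediateFields.

Section Frobenius.
Variables (F : fieldType) (w : valuation F) (p : nat).
Hypothesis p_pr : prime p.

Lemma frobeniusD g x y : vdvd w g x -> vdvd w g y ->
  vdvd w (p%:R * g ^+ p) ((x + y) ^+ p - (x ^+ p + y ^+ p)).
Proof.
move=> gx gy; have p_gt0 := prime_gt0 p_pr.
have -> : (x + y) ^+ p - (x ^+ p + y ^+ p) =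
    \sum_(1 <= i < p) x ^+ (p - i) * y ^+ i *+ 'C(p, i).
  rewrite exprDn -(big_mkord xpredT (fun i => x ^+ (p - i) * y ^+ i *+ 'C(p, i))).
  rewrite big_nat_recr //= big_ltn // subn0 subnn bin0 binn !expr0 mulr1 mul1r !mulr1n.
  by rewrite opprD addrACA subrr addr0 addrAC subrr add0r.
rewrite big_nat_cond; apply: vdvd_sum => i /andP[/andP[i0 ip] _].
have /dvdnP[k ->] := prime_dvd_bin p_pr (etrans (congr2 andb i0 ip) isT).
have -> : g ^+ p = g ^+ (p - i) * g ^+ i by rewrite -exprD subnK // ltnW.
rewrite -[X in vdvd _ _ X]mulr_natl natrM [k%:R * _]mulrC -mulrA; apply: vdvdMl.
rewrite -[X in vdvd _ X]mul1r; by apply: vdvdM; [apply: vdvd1_nat|apply: vdvdM; apply: vdvdX].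
Qed.

Lemma frobeniusB g x y : vdvd w g x -> vdvd w g y ->
  vdvd w (p%:R * g ^+ p) ((x - y) ^+ p - (x ^+ p - y ^+ p)).
Proof.
move=> gx gy; have := frobeniusD gx (y := - y); rewrite vdvdNr => /(_ gy).
have : vdvd w (p%:R * g ^+ p) ((- y) ^+ p + y ^+ p).
  have [p2|p_odd] := even_prime p_pr.
    by rewrite p2 sqrrN -mulr2n -[X in vdvd _ _ X]mulr_natl; apply/vdvdMl/vdvdX.
  by rewrite exprNn -signr_odd p_odd expr1 mulN1r addNr vdvd0.
move=> h1 h2; have := vdvdD h2 h1.
by congr (vdvd _ _ _); rewrite !opprD opprK -!addrA addKr.
Qed.

End Frobenius.

Lemma one_unit (F : fieldType) (w : valuation F) g :
  vsdvd w 1 (g - 1) -> veq w g 1.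
Proof.
move=> g1; have E : g = 1 + (g - 1) by rewrite addrC subrK.
rewrite /veq {1}E (vsdvd_addl g1) E vdvdD ?vdvdxx //.
exact: vsdvdW.
Qed.

Section BadElements.
Variables (K F : fieldType) (iota : {rmorphism K -> F}) (w : valuation F) (p : nat).
Hypothesis p_pr : prime p.
Hypothesis p_max : vsdvd w 1 p%:R.

(** The leading term of b is not a p-th power: its value is not divisible by
    p in the value group of S or, up to a p-th power, its residue is not a
    p-th power. *)
Definition no_pth_root (S : set F) b :=
  [/\ S b, b != 0 & forall c, S c -> ~~ vsdvd w b (b - c ^+ p)].

Lemma no_pth_rootM S b g : intermediate iota S -> S g -> g != 0 ->
  no_pth_root S b -> no_pth_root S (b * g ^+ p).
Proof.
move=> S_int Sg g0 [Sb b0 nb]; have gp0 : g ^+ p != 0 by rewrite expf_neq0.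
split; first by apply: (intermediateM S_int) => //; apply: (intermediateX S_int).
  exact: mulf_neq0.
move=> c Sc; have := nb (c / g) (intermediate_div S_int Sc Sg).
apply: contra; rewrite -(vsdvd_mul2r w b _ gp0).
by rewrite mulrBl expr_div_n divfK.
Qed.

Hypothesis F_int : forall (L M : fieldType) (kappa : {rmorphism K -> L})
  (mu : {rmorphism L -> M}) (lam : {rmorphism M -> F}),
  lam \o mu \o kappa =1 iota ->
  forall y, vdvd (restrict lam w) 1 y -> integral_over mu (restrict (lam \o mu) w) y.

(** Let N be the norm of the extension generated by the root y of
    X ^ p - b, of degree m <= p. If y = h ^+ p * (1 + x) with x in the maximal
    ideal, then N y is a p-th power up to a factor in 1 + the maximal ideal, and
    (N y) ^+ p = b ^+ m. So b is a p-th power if m < p, while for m = p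
    it is N y up to a p-th root of unity, whose residue is 1. *)
Lemma no_pth_root_root S b y : intermediate iota S -> no_pth_root S b -> y ^+ p = b ->
  exists S', [/\ intermediate iota S', subset S S', S' y & no_pth_root S' y].
Proof.
move=> S_int [Sb b0 nb] yb; have p_gt0 := prime_gt0 p_pr.
have [L [kappa [lam [lk SL]]]] := intermediate_model S_int.
have [bL bE] := (SL b).1 Sb.
pose q : {poly L} := 'X^p - bL%:P.
have sq : size q = p.+1 by rewrite size_XnsubC.
have q0 : q != 0 by rewrite -size_poly_gt0 sq.
have qy : root (map_poly lam q) y.
  by rewrite rmorphB /= map_polyXn map_polyC /root !hornerE /= yb bE subrr.
have [M [j [eta [jb jeta]]]] := adjoin_root_model q0 qy; rewrite sq ltnS => dimM.
have jbk : j \o base_emb M \o kappa =1 iota by move=> a; rewrite -lk; apply: jb.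
exists (fun x => exists l, j l = x).
have y0 : y != 0 by apply: contraNneq b0 => y0; rewrite -yb y0 expr0n gtn_eqF.
split; [|by move=> x /SL[l <-]; exists (base_emb M l); apply: jb|by exists eta|].
  exact: (@intermediate_range _ _ iota M (base_emb M \o kappa : {rmorphism K -> M}) j jbk).
split; [by exists eta|by []|move=> _ [h <-]; apply/negP => yh].
set u := restrict j w; set v := restrict (j \o base_emb M) w.
have vu : extends (base_emb M) v u by [].
have etah : vsdvd u eta (eta - h ^+ p) by rewrite vsdvd_restrict rmorphB rmorphXn jeta.
have eta0 : eta != 0 by rewrite -(fmorph_eq0 j) jeta.
have h0 : h != 0.
  by apply: contraTneq etah => ->; rewrite expr0n gtn_eqF // subr0 vsdvdxx.
have hp0 : h ^+ p != 0 by rewrite expf_neq0.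
pose x := (eta - h ^+ p) / h ^+ p.
have etaE : eta = h ^+ p * (1 + x).
  by rewrite mulrDr mulr1 /x mulrCA mulfV // mulr1 addrC subrK.
have x1 : vsdvd u 1 x.
  rewrite -(vsdvd_mul2r u _ _ hp0) divfK // mul1r.
  apply: (vdvd_sdvd_trans _ etah).
  have : vdvd u (eta - (eta - h ^+ p)) eta by apply: vsdvd_addl; rewrite vsdvdNr.
  by rewrite opprB addrC subrK.
have [n [d [d' [dimE dP]]]] := basis_ordinal (fieldExt_basis M).
rewrite card_ord in dimE.
have M_alg : algebraic_extension (base_emb M) by apply: fieldExt_algebraic.
have u_int y' : vdvd u 1 y' -> integral_over (base_emb M) v y' by apply: F_int jbk y'.
pose N z := \det (mul_mx d d' z).
have NM z z' : N (z * z') = N z * N z' by rewrite /N (mul_mxM dP) det_mulmx.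
have NX z k : N (z ^+ k) = N z ^+ k.
  elim: k => [|k IHk]; first by rewrite !expr0 /N (mul_mx1 dP) det1.
  by rewrite !exprS NM IHk.
have N1x := det_one_unit vu M_alg u_int dP x1; rewrite -/(N (1 + x)) in N1x.
have Neta : N eta ^+ p = bL ^+ n.+1.
  have -> : bL ^+ n.+1 = N (base_emb M bL) by rewrite /N (mul_mxC dP) det_scalar.
  rewrite -NX; congr N; apply: (fmorph_inj j); rewrite rmorphXn jeta yb -bE.
  exact/esym/jb.
have bL0 : bL != 0 by rewrite -(fmorph_eq0 lam) bE.
(* It remains to see that b is a p-th power up to a factor in 1 + m. *)
suff [c [g [bcg g1]]] : exists c g, bL = c ^+ p * g /\ vsdvd v 1 (g - 1).
  have Sc : S (lam c) by apply/SL; exists c.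
  move/negP: (nb _ Sc); apply; have c0 : c ^+ p != 0.
    by apply: contraNneq bL0; rewrite bcg => ->; rewrite mul0r.
  rewrite -bE -rmorphXn -rmorphB.
  have -> : bL - c ^+ p = c ^+ p * (g - 1) by rewrite mulrBr mulr1 -bcg.
  have /andP[gl _] := one_unit g1.
  rewrite -(vsdvd_restrict lam) -(vsdvd_equiv (v := v)); last first.
    by apply: restrict_comp jb _.
  rewrite {1}bcg vsdvd_mul2l //; exact: vdvd_sdvd_trans gl g1.
have Neta0 : N eta != 0.
  apply: contraTneq (expf_neq0 n.+1 bL0) => N0.
  by rewrite -Neta N0 expr0n gtn_eqF // eqxx.
have NetaE : N eta = N h ^+ p * N (1 + x) by rewrite -NX -NM -etaE.
have : (n.+1 <= p)%N by rewrite -dimE.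
rewrite leq_eqVlt => /orP[/eqP np|np].
  pose z := N eta / bL.
  have zp : z ^+ p = 1 by rewrite expr_div_n Neta np divff // expf_neq0.
  have z_eq1 : veq v z 1 
    by rewrite /veq -(vdvd_exp v z 1 p_gt0) -(vdvd_exp v 1 z p_gt0) zp expr1n vdvdxx.
  have /andP[z1l z1r] := z_eq1; have z0 := vdvd_neq0 z1l (oner_neq0 _).
  have v1p : vsdvd v 1 p%:R by rewrite vsdvd_restrict rmorph1 rmorph_nat.
  have z1 : vsdvd v 1 (z - 1).
    have := frobeniusB p_pr z1r (vdvdxx v 1).
    rewrite zp !expr1n mulr1 !subrr subr0 => /(vsdvd_dvd_trans v1p).
    by rewrite -{1}(expr1n _ p) vsdvd_exp.
  exists (N h), (N (1 + x) / z); split.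
    by rewrite mulrA -NetaE /z invf_div mulrCA mulfV ?mulr1.
  rewrite -(vsdvd_mul2r v _ _ z0) mul1r mulrBl divfK // mul1r.
  apply: vdvd_sdvd_trans z1l _.
  have -> : N (1 + x) - z = (N (1 + x) - 1) - (z - 1) by rewrite opprB addrA subrK.
  exact: vsdvdB.
have cop : coprime n.+1 p.
  by rewrite coprime_sym prime_coprime // gtnNdvd.
have [[k l] kl] : exists kl : nat * nat, (kl.1 * n.+1 = kl.2 * p + 1)%N.
  have [k l] := egcdnP p (ltn0Sn n); rewrite (eqP cop) => kl _; by exists (k, l).
exists (N eta ^+ k / bL ^+ l), 1; split; last by rewrite subrr vsdvdx0 oner_neq0.
rewrite mulr1 expr_div_n.
have -> : (N eta ^+ k) ^+ p = bL * (bL ^+ l) ^+ p.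
  by rewrite exprAC Neta -!exprM mulnC kl /= addn1 exprS.
by rewrite mulfK // !expf_neq0.
Qed.

End BadElements.

(** * Artin-Schreier extensions without best approximations *)

(** As v has a single extension to M, the sum in the fundamental equality has a
    single term, and its two factors depend on the valuation ring alone. *)
Lemma defectless_standard (L : fieldType) (v : valuation L) (M : fieldExtType L)
    (u : valuation M) :
    defectless_field v -> extends (base_emb M) v u ->
    (forall u', extends (base_emb M) v u' -> val_equiv u' u) ->
  exists e f (t : 'I_e -> M) (s : 'I_f -> M),
    [/\ coset_reps (base_emb M) u t, residue_basis (base_emb M) u s &
        \dim {:M} = (e * f)%N].
Proof.
move=> /(_ M)[g [w [e [f [wE wI wA ef dimE]]]]] vu uniq.
have [i0 ui0] := wA u vu.
have all_i0 i : i = i0 by apply: wI => x; rewrite (uniq _ (wE i)) ui0.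
have [eP fP] := ef i0.
have [t tP] := (ramification_indexP _ _ _).1 eP.
have [s sP] := (residue_degreeP _ _ _).1 fP.
have ww : val_equiv (w i0) u by apply: uniq.
exists (e i0), (f i0), t, s; split; first exact: coset_reps_equiv ww tP.
  exact: residue_basis_equiv ww sP.
rewrite dimE (bigD1 i0) //= big1 ?addn0 // => i; by rewrite (all_i0 i) eqxx.
Qed.

Section DefectlessImpliesPerfect.
Variables (K : fieldType) (Kt : closedFieldType) (iota : {rmorphism K -> Kt}).
Hypothesis Kt_closure : algebraic_extension iota.
Variable v : valuation K.
Hypothesis v_henselian : henselian iota v.
Hypothesis all_defectless : forall (L : fieldType) (kappa : {rmorphism K -> L}),
  algebraic_extension kappa ->
  forall w : valuation L, extends kappa v w -> defectless_field w.
Variable w : valuation Kt.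
Hypothesis vw : extends iota v w.

Lemma closure_integral (L M : fieldType) (kappa : {rmorphism K -> L})
    (mu : {rmorphism L -> M}) (lam : {rmorphism M -> Kt}) :
    lam \o mu \o kappa =1 iota ->
  forall y, vdvd (restrict lam w) 1 y -> integral_over mu (restrict (lam \o mu) w) y.
Proof.
move=> lk.
have L_alg : algebraic_extension kappa.
  exact: (@subfield_algebraic _ _ iota L kappa (lam \o mu : {rmorphism L -> Kt}) lk Kt_closure).
have M_algK : algebraic_extension (mu \o kappa : {rmorphism K -> M}).
  exact: (@subfield_algebraic _ _ iota M (mu \o kappa : {rmorphism K -> M}) lam lk Kt_closure).
have M_alg : algebraic_extension mu.
  move=> y; have [q q0 qy] := M_algK y; exists (map_poly kappa q).
    by rewrite map_poly_eq0.
  by rewrite -map_poly_comp.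
have vL : extends kappa v (restrict (lam \o mu) w) by apply: restrict_comp lk vw.
exact: (henselian_integral_above Kt_closure v_henselian L_alg vL M_alg).
Qed.

Variable p : nat.
Hypothesis p_pr : prime p.
Hypothesis p_max : vsdvd w 1 p%:R.

Local Notation no_root := (no_pth_root w p).

Section ArtinSchreier.
Variables (S1 : set Kt) (a : Kt).
Hypothesis S1_int : intermediate iota S1.
Hypothesis a_bad : no_root S1 a.
Hypothesis a1 : vsdvd w a 1.
Hypothesis pa : vdvd w 1 (p%:R * a).

Variable theta : Kt.
Hypothesis theta_root : theta ^+ p - theta = a.

Let p_gt0 : (0 < p)%N := prime_gt0 p_pr.
Let p_gt1 : (1 < p)%N := prime_gt1 p_pr.

Lemma pow_lt x : vsdvd w x 1 -> vsdvd w (x ^+ p) x.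
Proof.
move=> x1; have x0 := vsdvd_neq0 x1.
have -> : x ^+ p = x * x ^+ p.-1 by rewrite -exprS prednK.
rewrite -[X in vsdvd _ _ X]mulr1 vsdvd_mul2l // -(expr1n _ p.-1) vsdvdX //.
by rewrite -ltnS prednK.
Qed.

Lemma theta1 : vsdvd w theta 1.
Proof.
apply/negP => t1; move: a1; rewrite /vsdvd => /negP; apply.
by rewrite -theta_root vdvdB // vdvd1X.
Qed.

Lemma theta_a : veq w (theta ^+ p) a.
Proof.
have t := pow_lt theta1; rewrite -theta_root /veq vsdvd_addl ?vsdvdNr // andbT.
by rewrite vdvdB ?vdvdxx // vsdvdW.
Qed.

(** The defect of additivity of the p-th power map is divisible by
    p * theta ^+ p, which has the value of p * a. *)
Lemma frobenius_int x y : vdvd w theta x -> vdvd w theta y ->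
  vdvd w 1 ((x - y) ^+ p - (x ^+ p - y ^+ p)).
Proof.
move=> tx ty; apply: vdvd_trans (frobeniusB p_pr tx ty).
apply: vdvd_trans pa _; apply: vdvdMl.
by have /andP[] := theta_a.
Qed.

Definition no_approx (S : set Kt) := forall c, S c -> vsdvd w (theta - c) 1.

Lemma no_approx_start : no_approx S1.
Proof.
move=> c Sc; apply/negP => tc; have [_ _ /(_ c Sc) /negP] := a_bad; apply.
have t1 := theta1.
have dc : vdvd w theta c.
  rewrite -(subKr theta c) vdvdB ?vdvdxx //; apply: vdvd_trans tc; exact: vsdvdW.
have h := frobenius_int (vdvdxx w theta) dc.
have E : a - c ^+ p = (theta - c) ^+ p
   - ((theta - c) ^+ p - (theta ^+ p - c ^+ p)) - theta.
  by rewrite subKr -theta_root addrAC.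
have /andP[ta at_] := theta_a.
apply: (vdvd_sdvd_trans at_); apply: (vsdvd_dvd_trans (pow_lt t1)).
rewrite E vdvdB ?vdvdxx //; apply: (vdvd_trans (vsdvdW t1)).
by rewrite vdvdB ?vdvd1X.
Qed.

Variable S : set Kt.
Hypothesis S_int : intermediate iota S.
Hypothesis S1S : subset S1 S.
Hypothesis S_no : no_approx S.
Hypothesis S_max : forall B, subset S B -> intermediate iota B -> no_approx B ->
  subset B S.

(** Let d = theta - c, so that d ^+ p = b + d up to
    integral elements with b in S. If b is close to the p-th power of g, then
    c + g is better. Otherwise a p-th root y of b generates a larger field,
    which has an integral approximation of theta, hence of d - y. But
    (d - y) ^+ p = y + (d - y) up to integral elements, so that y would be
    close to a p-th power, against no_pth_root_root. *)
Lemma no_best_approximation c : S c -> exists2 c', S c' &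
  vsdvd w (theta - c) (theta - c').
Proof.
move=> Sc; have t1 := theta1.
have [tdc|ndc] := boolP (vdvd w theta (theta - c)); last first.
  by exists 0; [apply: intermediate0 S_int|rewrite subr0].
have tc : vdvd w theta c by rewrite -(subKr theta c) vdvdB ?vdvdxx.
set d := theta - c; have d1 : vsdvd w d 1 by apply: S_no.
have d0 := vsdvd_neq0 d1; have dpd := pow_lt d1.
have dp1 : vsdvd w (d ^+ p) 1 by apply: vsdvd_trans dpd d1.
pose b := a + c - c ^+ p.
have Sb : S b.
  have Sa : S a by apply: S1S; case: a_bad.
  by apply: (intermediateB S_int); [apply: (intermediateD S_int)|apply: (intermediateX S_int)].
pose r := d ^+ p - (theta ^+ p - c ^+ p).
have r1 : vdvd w 1 r := frobenius_int (vdvdxx w theta) tc.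
have dE : d ^+ p = b + (d + r).
  have -> : d ^+ p = r + (theta ^+ p - c ^+ p) by rewrite subrK.
  have -> : theta ^+ p = a + theta by rewrite -theta_root subrK.
  by rewrite /b /d; ring.
have dr : vsdvd w (d ^+ p) (d + r) by rewrite vsdvdD // (vsdvd_dvd_trans dp1).
have /andP[bd db] : veq w b (d ^+ p).
  have bE : b = d ^+ p - (d + r) by rewrite dE addrK.
  by rewrite /veq bE vsdvd_addl ?vsdvdNr // vdvdB ?vdvdxx // vsdvdW.
have b0 : b != 0 by apply: vdvd_neq0 bd _; rewrite expf_neq0.
have [[g Sg bg]|nb] := pselect (exists2 g, S g & vsdvd w b (b - g ^+ p)).
  exists (c + g); first exact: (intermediateD S_int).
  have dg : vdvd w d g.
    rewrite -(vdvd_exp w _ _ p_gt0); apply: (vdvd_trans db).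
    by rewrite -(subKr b (g ^+ p)) vdvdB ?vdvdxx // vsdvdW.
  have h := frobenius_int tdc (vdvd_trans tdc dg); rewrite -/d in h.
  have -> : theta - (c + g) = d - g by rewrite opprD addrA.
  rewrite -(vsdvd_exp w _ _ p_gt0).
  rewrite -(subrK (d ^+ p - g ^+ p) ((d - g) ^+ p)) vsdvdD //.
    exact: vsdvd_dvd_trans dp1 h.
  rewrite [X in vsdvd _ _ (X - _)]dE addrAC vsdvdD //; exact: vdvd_sdvd_trans db bg.
have b_bad : no_root S b.
  by split=> // g Sg; apply/negP => bg; apply: nb; exists g.
have [y yb] : exists y, y ^+ p = b.
  have /closed_rootP[y] : size ('X^p - b%:P) != 1 by rewrite size_XnsubC // eqSS gtn_eqF.
  rewrite /root !hornerE subr_eq0 => /eqP yb; by exists y.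
have [S' [S'_int SS' S'y [_ y0 y_bad]]] :=
  no_pth_root_root p_pr p_max closure_integral S_int b_bad yb.
have [c' Sc' tc'] : exists2 c', S' c' & vdvd w 1 (theta - c').
  apply: contrapT => nex; have S'S : subset S' S.
    apply: S_max => // c' Sc'; apply/negP => tc'; apply: nex; exists c' => //.
  by have [_ _ /(_ y (S'S _ S'y))] := b_bad; rewrite yb subrr vsdvdx0 b0.
pose h := c' - c - y; have S'h : S' h.
  by do 2!apply: (intermediateB S'_int) => //; apply: SS'.
pose d' := d - y; have d'h : vdvd w 1 (d' - h).
  by rewrite (_ : d' - h = theta - c') // /d' /h /d; ring.
have /andP[yd dy] : veq w y d.
  by rewrite /veq -(vdvd_exp w y d p_gt0) -(vdvd_exp w d y p_gt0) yb bd db.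
have ty := vdvd_trans tdc dy.
have y1 : vsdvd w y 1 := vdvd_sdvd_trans yd d1.
have td' : vdvd w theta d' by rewrite vdvdB.
pose r' := d' ^+ p - (d ^+ p - y ^+ p).
have r'1 : vdvd w 1 r' := frobenius_int tdc ty.
have d'E : d' ^+ p = y + (d' + (r + r')).
  have -> : d' ^+ p = r' + (d ^+ p - y ^+ p) by rewrite subrK.
  by rewrite yb dE /d'; ring.
have rr1 : vdvd w 1 (r + r') by rewrite vdvdD.
have yd' : vsdvd w y d'.
  apply/negP => d'y; have d'1 : vsdvd w d' 1 by apply: vdvd_sdvd_trans d'y y1.
  have dpd' := pow_lt d'1.
  have : vsdvd w (d' ^+ p) (d' ^+ p).
    rewrite [X in vsdvd _ _ X]d'E vsdvdD //; first exact: vsdvd_dvd_trans dpd' d'y.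
    rewrite vsdvdD //; apply: vsdvd_dvd_trans rr1; exact: vsdvd_trans dpd' d'1.
  by rewrite vsdvdxx.
have /negP := y_bad h S'h; case.
have td'h : vdvd w theta (d' - h) by apply: vdvd_trans (vsdvdW t1) d'h.
have := frobenius_int td' td'h; rewrite subKr.
set r'' := h ^+ p - _ => r''1.
have -> : y - h ^+ p = (d' - h) ^+ p - (r'' + (d' + (r + r'))).
  have -> : h ^+ p = r'' + (d' ^+ p - (d' - h) ^+ p) by rewrite subrK.
  by rewrite d'E; ring.
have y_int z : vdvd w 1 z -> vsdvd w y z by apply: vsdvd_dvd_trans y1.
apply: vsdvdB; first exact/y_int/vdvd1X.
by apply: vsdvdD; [apply: y_int|apply: vsdvdD => //; apply: y_int].
Qed.

End ArtinSchreier.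

(** A maximal subfield of the closure with no integral approximation of a
    root theta of X ^ p - X - a has no optimal approximation either, which
    a defectless field cannot have. *)
Lemma small_no_pth_root S1 a : intermediate iota S1 -> no_root S1 a ->
  vsdvd w a 1 -> vdvd w 1 (p%:R * a) -> False.
Proof.
move=> S1_int a_bad a1 pa; have p_gt1 := prime_gt1 p_pr.
have size_AS (F : fieldType) (x : F) : size ('X^p - 'X - x%:P) = p.+1.
  by rewrite -addrA -opprD size_polyDl ?size_polyXn // size_polyN size_XaddC.
have [theta theta_root] : exists theta, theta ^+ p - theta = a.
  have /closed_rootP[y] : size ('X^p - 'X - a%:P) != 1.
    by rewrite size_AS eqSS gtn_eqF // ltnW.
  by rewrite /root !hornerE subr_eq0 => /eqP ya; exists y.
pose good S := intermediate iota S /\ no_approx theta S.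
have good1 : good S1 by split=> //; apply: (no_approx_start a_bad).
have [C [X0 CX0] gC Ctot|S [S1S [S_int S_no] S_max]] := zorn_above good1.
  split; first by apply: intermediate_chain => //; [exists X0|move=> X /gC[]].
  by move=> c [X /gC[_]]; apply.
have no_best := no_best_approximation a_bad a1 pa theta_root S_int S1S S_no
  (fun B SB B_int B_no => S_max B SB (conj B_int B_no)).
have [L [kappa [lam [lk SL]]]] := intermediate_model S_int.
have L_alg := subfield_algebraic lk Kt_closure.
have vL : extends kappa v (restrict lam w) by apply: restrict_comp lk vw.
have Sa : S a by apply: S1S; case: a_bad.
have [aL aE] := (SL a).1 Sa.
have qtheta : root (map_poly lam ('X^p - 'X - aL%:P)) theta.
  rewrite !rmorphB /= map_polyXn map_polyX map_polyC /root !hornerE /=.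
  by rewrite aE -theta_root subrr.
have q0 : 'X^p - 'X - aL%:P != 0 by rewrite -size_poly_gt0 size_AS.
have [M [j [th [jb jth _]]]] := adjoin_root_model q0 qtheta.
pose u := restrict j w.
have wu : extends (base_emb M) (restrict lam w) u by apply: (restrict_comp jb).
have M_alg : algebraic_extension (base_emb M) by apply: fieldExt_algebraic.
have uniq u' : extends (base_emb M) (restrict lam w) u' -> val_equiv u' u.
  move=> wu'; exact: (henselian_unique_above Kt_closure v_henselian L_alg vL M_alg wu' wu).
have [e [f [t [s [tP sP dimM]]]]] := defectless_standard (all_defectless L_alg vL) wu uniq.
have cardM : #|'I_(\dim {:M})| = (e * f)%N by rewrite card_ord.
have [c' c'P] := standard_basis (fieldExt_basis M) tP sP cardM.
have [_ ts] := standard_val_indep tP sP.1.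
have [c0 best] := best_approximation th c'P ts.
have [c1 Sc1 /negP] := no_best (lam c0) ((SL _).2 (ex_intro _ c0 erefl)); apply.
have [l lE] := (SL c1).1 Sc1.
have := best l; rewrite vdvd_restrict !rmorphB jth -lE.
by rewrite -[lam l]jb -[lam c0]jb.
Qed.

End DefectlessImpliesPerfect.

(** * Approximate p-th roots in the base field *)

Section PthRoots.
Variables (K : fieldType) (Kt : closedFieldType) (iota : {rmorphism K -> Kt}).
Hypothesis Kt_closure : algebraic_extension iota.
Variable v : valuation K.
Hypothesis v_nontrivial : nontrivial v.
Hypothesis v_henselian : henselian iota v.
Hypothesis v_mixed : mixed_characteristic v -> archimedean_value_group v.
Hypothesis all_defectless : forall (L : fieldType) (kappa : {rmorphism K -> L}),
  algebraic_extension kappa ->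
  forall w : valuation L, extends kappa v w -> defectless_field w.
Variable w : valuation Kt.
Hypothesis vw : extends iota v w.
Variable p : nat.
Hypothesis p_pr : prime p.
Hypothesis p_max : vsdvd v 1 p%:R.

Local Notation no_root := (no_pth_root w p).

Let p_maxw : vsdvd w 1 p%:R.
Proof.
by rewrite -(rmorph_nat iota) -[X in vsdvd _ X _](rmorph1 iota) (extends_vsdvd vw).
Qed.

Lemma no_pth_root_negative S b : intermediate iota S -> no_root S b -> ~~ veq w b 1 ->
  exists2 a, no_root S a & vsdvd w a 1.
Proof.
move=> S_int b_bad; have [Sb b0 _] := b_bad; rewrite /veq negb_and => /orP[b1|b1].
  exists (b * b^-1 ^+ p).
    apply: (no_pth_rootM S_int) => //; last by rewrite invr_eq0.
    exact: (intermediateV S_int Sb).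
  have p_gt1 := prime_gt1 p_pr.
  have -> : b * b^-1 ^+ p = b^-1 ^+ p.-1.
    by rewrite -[in LHS](@prednK p) ?prime_gt0 // exprS mulrA divff // mul1r.
  rewrite -[1](expr1n _ p.-1) vsdvdX //; first by rewrite -ltnS prednK // ltnW.
  by rewrite -[X in vsdvd _ _ X]invr1 vsdvdV ?oner_neq0.
by exists b.
Qed.

Lemma no_pth_root_iter n S b : intermediate iota S -> no_root S b ->
  exists S' y, [/\ intermediate iota S', no_root S' y & y ^+ (p ^ n) = b].
Proof.
move=> S_int b_bad; elim: n => [|n [S' [y [S'_int y_bad yb]]]].
  by exists S, b; rewrite expn0 expr1.
have [z zy] : exists z, z ^+ p = y.
  have /closed_rootP[z] : size ('X^p - y%:P) != 1.
    by rewrite size_XnsubC ?prime_gt0 // eqSS gtn_eqF ?prime_gt0.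
  by rewrite /root !hornerE subr_eq0 => /eqP zy; exists z.
have [S'' [S''_int _ _ z_bad]] := no_pth_root_root p_pr p_maxw
  (closure_integral Kt_closure v_henselian vw) S'_int y_bad zy.
by exists S'', z; split=> //; rewrite expnS exprM zy.
Qed.

Lemma archimedean_multiple a : archimedean_value_group v -> p%:R != 0 :> K ->
  a != 0 -> exists n, vdvd v 1 (p%:R ^+ n * a).
Proof.
move=> arch p0 a0.
have vX n : v (p%:R ^+ n) = v p%:R *+ n.
  elim: n => [|n IHn]; first by rewrite expr0 mulr0n Defs.val1.
  by rewrite exprS mulrS val_mul ?expf_neq0 // IHn.
have [|||n an] := arch (v p%:R) (v a^-1).
- by exists p%:R.
- by exists a^-1; rewrite ?invr_eq0.
- by move: p_max; rewrite /vsdvd vdvdE ?oner_neq0 // Defs.val1 oag_leNgt negbK.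
exists n; have ai0 : a^-1 != 0 by rewrite invr_eq0.
by rewrite -(vdvd_mul2r v _ _ ai0) mulfK // mul1r vdvdE ?expf_neq0 // vX.
Qed.

Lemma negative_element : exists2 t : K, t != 0 & vsdvd v t 1.
Proof.
have [_ [x x0 <-] vx] := v_nontrivial.
have [x1|x1] := boolP (vsdvd v x 1); first by exists x.
exists x^-1; first by rewrite invr_eq0.
rewrite -[X in vsdvd _ _ X]invr1 vsdvdV ?oner_neq0 //.
move: x1; rewrite /vsdvd negbK => x1; apply/negP => x1'; case/negP: vx.
move: x1 x1'; rewrite !vdvdE ?oner_neq0 // Defs.val1 => h1 h2.
by apply/eqP/le_anti; rewrite h1 h2.
Qed.

(** Otherwise some element a of an algebraic extension has no approximate
    p-th root and satisfies - v p <= v a < 0. In mixed characteristic the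
    bound is reached by passing from a to a ^ (1 / p ^ n) for n large, unless
    only units lack a p-th root: then p itself is close to some c ^+ p, and a
    unit b is replaced by b / c ^+ p. *)
Lemma approximate_pth_root b : b != 0 -> exists c, vsdvd v b (b - c ^+ p).
Proof.
move=> b0; apply: contrapT => nb.
have small := small_no_pth_root Kt_closure v_henselian all_defectless vw p_pr p_maxw.
pose S0 : set Kt := fun x => exists a, iota a = x.
have S0_int : intermediate iota S0.
  exact: (@intermediate_range _ _ iota K (idfun : {rmorphism K -> K}) iota (fun=> erefl)).
have b_bad : no_root S0 (iota b).
  split; [by exists b|by rewrite fmorph_eq0|move=> _ [c <-]].
  apply/negP; rewrite -rmorphXn -rmorphB (extends_vsdvd vw) => bc.
  by apply: nb; exists c.
have [p0|p0] := eqVneq (p%:R : K) 0.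
  have pt0 x : vdvd w 1 (p%:R * x).
    by rewrite -(rmorph_nat iota) p0 rmorph0 mul0r vdvd0.
  have [b1|b1] := boolP (veq w (iota b) 1); last first.
    by have [a a_bad a1] := no_pth_root_negative S0_int b_bad b1; apply: (small S0 a).
  have [t t0 t1] := negative_element.
  apply: (small S0 (iota b * iota t ^+ p)) => //.
    by apply: (no_pth_rootM S0_int) => //; [exists t|rewrite fmorph_eq0].
  have /andP[_ b1'] := b1; rewrite -[X in vsdvd _ _ X]mul1r.
  have tp1 : vsdvd w (iota t ^+ p) 1.
    rewrite -[X in vsdvd _ _ X](expr1n _ p) vsdvd_exp ?prime_gt0 //.
    by rewrite -(rmorph1 iota) (extends_vsdvd vw).
  by have /andP[h _] := b1; apply: vsdvdMl => //; rewrite fmorph_eq0.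
have arch : archimedean_value_group v.
  apply: v_mixed => /(_ p); rewrite residue_pchar p_pr p_max inE p_pr.
  by rewrite (negPf p0).
have [[x x_bad x1]|nunit] := pselect (exists2 x, no_root S0 x & ~~ veq w x 1).
  have [a a_bad a1] := no_pth_root_negative S0_int x_bad x1.
  have [[a' a'E] a0 _] := a_bad.
  have a'0 : a' != 0 by rewrite -(fmorph_eq0 iota) a'E.
  have [n pna] := archimedean_multiple arch p0 a'0.
  have [S [y [S_int y_bad ya]]] := no_pth_root_iter n S0_int a_bad.
  have pn0 : (0 < p ^ n)%N by rewrite expn_gt0 prime_gt0.
  apply: (small S y) => //.
    by rewrite -(vsdvd_exp w _ _ pn0) ya expr1n.
  rewrite -(vdvd_exp w _ _ pn0) expr1n exprMn ya.
  rewrite -(subnK (ltnW (ltn_expl n (prime_gt1 p_pr)))) exprD -mulrA.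
  apply: vdvd1M; first by rewrite vdvd1X // vdvd1_nat.
  by rewrite -a'E -(rmorph_nat iota) -rmorphXn -rmorphM -(rmorph1 iota) (extends_vdvd vw).
have unit x : no_root S0 x -> veq w x 1.
  by move=> x_bad; rewrite -[veq _ _ _]negbK; apply/negP => x1; apply: nunit; exists x.
have [[c pc]|np] := pselect (exists c : K, vsdvd v p%:R (p%:R - c ^+ p)); last first.
  have /unit/andP[h _] : no_root S0 (iota p%:R).
    split; [by exists p%:R|by rewrite fmorph_eq0|move=> _ [c <-]].
    apply/negP; rewrite -rmorphXn -rmorphB (extends_vsdvd vw) => pc.
    by apply: np; exists c.
  by move: p_maxw; rewrite /vsdvd -(rmorph_nat iota) h.
have /andP[pc1 cp1] : veq v p%:R (c ^+ p).
  rewrite -(subKr p%:R (c ^+ p)); apply/andP; split.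
    by rewrite vdvdB ?vdvdxx // vsdvdW.
  by apply: vsdvd_addl; rewrite vsdvdNr.
have c0 : c != 0.
  apply: contraTneq cp1 => ->; rewrite expr0n gtn_eqF ?prime_gt0 //= vdvd0x.
  exact: p0.
have cp0 : iota c ^+ p != 0 by rewrite expf_neq0 // fmorph_eq0.
have /andP[b1 b1'] := unit _ b_bad.
have cV : (iota c)^-1 != 0 by rewrite invr_eq0 fmorph_eq0.
apply: (small S0 (iota b * (iota c)^-1 ^+ p)) => //.
- apply: (no_pth_rootM S0_int) => //; apply: (intermediateV S0_int); by exists c.
- rewrite exprVn -(vsdvd_mul2r w _ _ cp0) divfK // mul1r.
  apply: (vdvd_sdvd_trans b1); rewrite -rmorphXn -(rmorph1 iota) (extends_vsdvd vw).
  exact: vsdvd_dvd_trans p_max pc1.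
rewrite exprVn -(vdvd_mul2r w _ _ cp0) mul1r mulrA divfK //.
rewrite -[X in vdvd _ X]mulr1; apply: vdvdM => //.
by rewrite -rmorphXn -(rmorph_nat iota) (extends_vdvd vw).
Qed.

End PthRoots.

(** * Tame ramification and separable residue extensions *)

(** The cosets form a group of order e, realised here by the permutations that
    its elements induce on the representatives. If p divided e, Cauchy's theorem
    would give an element of order p, which tors excludes. *)
Lemma Cauchy_coset_reps (K L : fieldType) (iota : {rmorphism K -> L})
    (u : valuation L) e (t : 'I_e -> L) p :
    prime p -> coset_reps iota u t ->
    (forall x a, x != 0 -> a != 0 -> veq u (x ^+ p) (iota a) ->
      exists2 c, c != 0 & veq u x (iota c)) ->
  coprime e p.
Proof.
move=> p_pr [t0 tP] tors; rewrite coprime_sym prime_coprime //; apply/negP => pe.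
pose same x y := exists2 c, c != 0 & veq u x (iota c * y).
have same_refl x : same x x by exists 1; rewrite ?oner_neq0 // rmorph1 mul1r /veq vdvdxx.
have ine c : c != 0 -> iota c != 0 by rewrite fmorph_eq0.
have same_trans x y z : same x y -> same y z -> same x z.
  move=> [c c0 xy] [d d0 yz]; exists (c * d); first exact: mulf_neq0.
  by apply: veq_trans xy _; rewrite rmorphM -mulrA veq_mul2l // ine.
have same_sym x y : same x y -> same y x.
  move=> [c c0 xy]; exists c^-1; rewrite ?invr_eq0 //.
  by rewrite -(veq_mul2l u _ _ (ine _ c0)) mulrA fmorphV mulfV ?ine // mul1r veq_sym.
have sameM x y z : z != 0 -> same (z * x) (z * y) <-> same x y.
  by move=> z0; split=> -[c c0 xy]; exists c => //; move: xy; rewrite mulrCA veq_mul2l.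
have [idx idxP] : exists idx : L -> 'I_e, forall x, x != 0 ->
    same x (t (idx x)) /\ forall j, same x (t j) -> idx x = j.
  have H x : exists i : 'I_e, x != 0 -> same x (t i) /\ forall j, same x (t j) -> i = j.
    have [->|x0] := eqVneq x 0.
      by have [i _] := tP 1 (oner_neq0 _); exists i.
    by have [i [h1 h2]] := tP x x0; exists i.
  by have [g gP] := choice H; exists g.
have idx_eq x y : x != 0 -> y != 0 -> same x y -> idx x = idx y.
  move=> x0 y0 xy; have [_ h] := idxP x x0; have [h' _] := idxP y y0.
  exact/h/(same_trans _ _ _ xy).
have idx_same x y : x != 0 -> y != 0 -> idx x = idx y -> same x y.
  move=> x0 y0 xy; have [h _] := idxP x x0; have [h' _] := idxP y y0.
  by apply: same_trans h _; rewrite xy; apply: same_sym.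
pose f x i := idx (x * t i).
have f_inj x : x != 0 -> injective (f x).
  move=> x0 i j /idx_same; rewrite !mulf_neq0 // => /(_ isT isT)/(sameM _ _ _ x0) ij.
  have [_ h] := idxP (t i) (t0 i); rewrite -(h j ij); apply/esym.
  exact: h.
pose s i : {perm 'I_e} := perm (f_inj (t i) (t0 i)).
have idxt j : idx (t j) = j by have [_ h] := idxP (t j) (t0 j); apply: h.
have same_idx x : x != 0 -> same x (t (idx x)) by move=> x0; have [] := idxP x x0.
have idx_mul x y : x != 0 -> y != 0 -> idx (x * t (idx y)) = idx (x * y).
  move=> x0 y0; apply: idx_eq; rewrite ?mulf_neq0 //; apply/sameM => //.
  exact/same_sym/same_idx.
have sE i j : s i j = idx (t i * t j) by rewrite permE.
have sM i k : (s i * s k)%g = s (idx (t k * t i)).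
  apply/perm.permP => j; rewrite permM !sE idx_mul ?mulf_neq0 //.
  by rewrite [t (idx _) * _]mulrC idx_mul ?mulf_neq0 // [in RHS]mulrC mulrA.
have s1 : s (idx 1) = 1%g.
  by apply/perm.permP => j; rewrite sE mulrC idx_mul ?oner_neq0 // mulr1 idxt perm1.
pose G := [set s i | i : 'I_e].
have G_group : group_set G.
  apply/group_setP; split; first by rewrite -s1 imset_f.
  by move=> _ _ /imsetP[i _ ->] /imsetP[k _ ->]; rewrite sM imset_f.
have s_inj : injective s.
  move=> i k /perm.permP/(_ (idx 1)); rewrite !sE.
  by rewrite (idx_mul _ _ (t0 i) (oner_neq0 _)) (idx_mul _ _ (t0 k) (oner_neq0 _)) !mulr1 !idxt.
have [x] : {x | x \in group G_group & #[x]%g = p}.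
  by apply: Cauchy; rewrite //= card_imset ?card_ord.
move=> /imsetP[i _ ->] si_p.
have sX n j : (s i ^+ n)%g j = idx (t i ^+ n * t j).
  elim: n j => [|n IHn] j; first by rewrite expg0 perm1 expr0 mul1r idxt.
  rewrite expgS permM IHn sE idx_mul ?mulf_neq0 ?expf_neq0 //.
  by rewrite mulrA exprSr.
have tip : same (t i ^+ p) 1.
  have tp0 : t i ^+ p != 0 by rewrite expf_neq0.
  have := sX p (idx 1); rewrite -si_p expg_order perm1 si_p idx_mul ?oner_neq0 //.
  rewrite mulr1 => h; apply: idx_same => //; exact: oner_neq0.
have ti1 : same (t i) 1.
  have [c c0] := tip; rewrite mulr1 => tc.
  have [d d0 td] := tors (t i) c (t0 i) c0 tc.
  by exists d; rewrite // mulr1.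
have si1 : s i = 1%g.
  rewrite -s1; congr s; rewrite -(idxt i); apply: idx_eq => //; exact: oner_neq0.
by move: p_pr; rewrite -si_p si1 order1.
Qed.

(** An inseparable irreducible polynomial has a vanishing derivative, and over a
    perfect field this makes it a p-th power. *)
Lemma perfect_separable (k : fieldType) (q : {poly k}) :
  (forall p, p \in [pchar k] -> forall a : k, exists b, b ^+ p = a) ->
  irreducible_poly q -> separable_poly q.
Proof.
move=> k_perf q_irr; have [q_gt1 q_min] := q_irr; have q0 := irredp_neq0 q_irr.
rewrite unlock; apply: contraT => ncop.
have : gcdp q q^`() %= q by apply: q_min; rewrite ?dvdp_gcdl.
rewrite eqp_sym => q_gcd.
have q_dq' : q %| q^`() by rewrite (eqp_dvdl _ q_gcd) dvdp_gcdr.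
have dq0 : q^`() = 0.
  apply/eqP; apply: contraT => dq; have := dvdp_leq dq q_dq'.
  by rewrite leqNgt lt_size_deriv.
have coefq i : q`_i *+ i = 0.
  by case: i => [|i]; rewrite ?mulr0n // -coef_deriv dq0 coef0.
have n0 : (0 < (size q).-1)%N by case: (size q) q_gt1 => [|[]].
have [|p p_char] := @natf0_pchar k (size q).-1 n0.
  have := coefq (size q).-1; rewrite -[LHS]mulr_natr => /eqP.
  by rewrite mulf_eq0 -lead_coefE lead_coef_eq0 (negPf q0).
have p_pr := pcharf_prime p_char; have p_gt0 := prime_gt0 p_pr.
have [g gP] := choice (k_perf p p_char).
pose r := \poly_(j < size q) g q`_(p * j).
have rq : r ^+ p = q.
  have p_charP : p \in [pchar {poly k}] by rewrite pchar_poly.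
  rewrite -(pFrobenius_autE p_charP) /r poly_def rmorph_sum; apply/polyP => i.
  have termE (j : 'I_(size q)) :
      (pFrobenius_aut p_charP (g q`_(p * j) *: 'X^j))`_i = q`_(p * j) * (i == p * j)%N%:R.
    by rewrite pFrobenius_autE exprZn gP -exprM mulnC coefZ coefXn.
  rewrite coef_sum; have [pi|npi] := boolP (p %| i)%N; last first.
    rewrite big1 => [|j _].
      have := coefq i; rewrite -[LHS]mulr_natr => /eqP; rewrite mulf_eq0 -(dvdn_pcharf p_char).
      by rewrite (negPf npi) orbF => /eqP->.
    rewrite termE; case: eqP => [ij|]; last by rewrite mulr0.
    by move: npi; rewrite ij dvdn_mulr.
  have /dvdnP[m im] := pi; rewrite mulnC in im.
  have [mq|mq] := ltnP m (size q).
    rewrite (bigD1 (Ordinal mq)) // termE /= -im eqxx mulr1 big1 ?addr0 // => j jm.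
    rewrite termE im eqn_mul2l gtn_eqF //=; case: eqP => [mj|]; last by rewrite mulr0.
    by move: jm; rewrite -val_eqE /= mj eqxx.
  rewrite nth_default; last by rewrite im (leq_trans mq) // leq_pmull.
  apply: big1 => j _; rewrite termE im eqn_mul2l (gtn_eqF p_gt0) /=.
  by rewrite (gtn_eqF (leq_trans (ltn_ord j) mq)) mulr0.
have : r %| q by rewrite -rq -(prednK p_gt0) exprS dvdp_mulr.
move=> r_q; have r_size : size r != 1.
  apply: contraTneq q_gt1 => /eqP/size_poly1P[c _ rc].
  by rewrite -rq rc -polyC_exp -leqNgt size_polyC_leq1.
have /eqp_size sr := q_min r r_size r_q.
have := size_exp r p; rewrite rq sr => /eqP; rewrite eq_sym => /eqP n_np.
have := ltn_Pmulr (prime_gt1 p_pr) n0; by rewrite n_np ltnn.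
Qed.


Lemma veq_pth (K : fieldType) (v : valuation K) a c : vsdvd v a (a - c) -> veq v a c.
Proof.
move=> ac; rewrite -(subKr a c); apply/andP; split.
  by rewrite vdvdB ?vdvdxx // vsdvdW.
by apply: vsdvd_addl; rewrite vsdvdNr.
Qed.

Section PerfectResidue.
Variables (K E : fieldType) (iota : {rmorphism K -> E}) (u : valuation E).
Local Notation v := (restrict iota u).
Hypothesis u_int : forall y, vdvd u 1 y -> integral_over iota v y.
Hypothesis roots : forall p, prime p -> vsdvd v 1 p%:R ->
  forall b, b != 0 -> exists c, vsdvd v b (b - c ^+ p).

Lemma perfect_residue p : p \in [pchar (residue v)] ->
  forall a : residue v, exists b, b ^+ p = a.
Proof.
rewrite residue_pchar => /andP[p_pr p1] a; have p_gt0 := prime_gt0 p_pr.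
have [z ->] := res_surj a; have [z0|z0] := eqVneq (val z) 0.
  exists 0; rewrite expr0n gtn_eqF //; apply/esym/eqP.
  by rewrite res_eq0 z0 vsdvdx0 oner_neq0.
have [c zc] := roots p_pr p1 z0; have /andP[zcp _] := veq_pth zc.
have z1 : vdvd v 1 (val z) by apply: vring_vdvd.
have c1 : vdvd v 1 c by rewrite -(vdvd_exp v _ _ p_gt0) expr1n (vdvd_trans z1).
have [y yc] := mk_vring c1; exists (res y).
have -> : res y ^+ p = res (y ^+ p).
  by elim: (p) => [|n IHn]; rewrite ?expr0 ?res1 // !exprS resM IHn.
apply/esym/res_eq; rewrite (_ : val (y ^+ p) = c ^+ p); last by rewrite -yc; apply: rmorphXn.
exact: vdvd_sdvd_trans z1 zc.
Qed.

Lemma residue_separable : separable_extension (residue_map iota u : {rmorphism _ -> _}).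
Proof.
move=> y; have [x ->] := res_surj y.
have [f [f_mon fO /eqP fx]] := u_int (vring_vdvd x).
have [g gE] := fin_all_exists (fun i : 'I_(size f) => @mk_vring _ v _ (polyOver_val_ring fO i)).
pose q : {poly (residue v)} := \poly_(i < size f) (if insub i is Some k then res (g k) else 0).
have qE (i : 'I_(size f)) : q`_i = res (g i) by rewrite coef_poly ltn_ord valK.
have qx : root (map_poly (residue_map iota u) q) (res x).
  rewrite /root (@horner_coef_wide _ (size f)) ?size_map_poly ?size_poly //.
  pose z := \sum_(i < size f) vring_map (g i) * x ^+ i.
  have zE : val z = \sum_(i < size f) iota (val (g i)) * val (x ^+ i).
    by rewrite vring_sum.
  have z0 : res z = 0.
    apply/eqP; rewrite res_eq0 zE [X in vsdvd _ _ X](_ : _ = 0) ?vsdvdx0 ?oner_neq0 //.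
    rewrite -[RHS]fx (@horner_coef_wide _ (size f)) ?size_map_poly //.
    by apply: eq_bigr => i _; rewrite coef_map gE; congr (_ * _); apply: rmorphXn.
  apply/eqP; rewrite -[RHS]z0 -(residue_map_sum zE); apply: eq_bigr => i _.
  rewrite coef_map qE; congr (_ * _).
  by elim: (i : nat) => [|n IHn]; rewrite ?expr0 ?res1 // !exprS resM IHn.
have q0 : q != 0.
  have fd : ((size f).-1 < size f)%N.
    by rewrite prednK // lt0n size_poly_eq0 monic_neq0.
  apply: contraTneq isT => q0; have /eqP := qE (Ordinal fd).
  rewrite q0 coef0 eq_sym res_eq0 gE /= -lead_coefE (monicP f_mon).
  by rewrite vsdvdxx.
have [p p_irr px] := minpoly_exists (ex_intro2 _ _ q q0 qx).
by exists p; split=> //; apply: perfect_separable p_irr; apply: perfect_residue.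
Qed.

End PerfectResidue.

Theorem theorem1p1 (K : fieldType) (Kt : closedFieldType)
    (iota : {rmorphism K -> Kt}) (Kt_closure : algebraic_extension iota)
    (v : valuation K) (v_nontrivial : nontrivial v)
    (v_henselian : henselian iota v)
    (v_mixed : mixed_characteristic v -> archimedean_value_group v) :
  tame_field iota v <->
  (forall (L : fieldType) (kappa : {rmorphism K -> L}),
     algebraic_extension kappa ->
     forall w : valuation L, extends kappa v w -> defectless_field w).
Proof.
split=> [K_tame L kappa L_alg w vw|all_defectless].
  exact: (tame_defectless Kt_closure v_henselian K_tame L_alg vw).
split=> // w vw; split=> // E j jb u.
have roots p (p_pr : prime p) (p1 : vsdvd v 1 p%:R) b (b0 : b != 0) :=
  approximate_pth_root Kt_closure v_nontrivial v_henselian v_mixed all_defectless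
    vw p_pr p1 b0.
have vu : extends (base_emb E) v u by apply: restrict_comp jb vw.
have E_alg : algebraic_extension (base_emb E) by apply: fieldExt_algebraic.
have K_alg : algebraic_extension (idfun : {rmorphism K -> K}) by move=> y; apply: algebraic_id.
have K_defectless : defectless_field v by apply: (all_defectless K idfun).
have uniq u' : extends (base_emb E) v u' -> val_equiv u' u.
  by move=> vu'; apply: (henselian_unique Kt_closure v_henselian E_alg vu' vu).
have [e [f [t [s [tP sP dimE]]]]] := defectless_standard K_defectless vu uniq.
have ramE : ramification_index (base_emb E) u e by apply/ramification_indexP; exists t.
split=> [p||].
- rewrite residue_pchar (vsdvd_equiv vu) => /andP[p_pr p1]; exists e => //.
  apply: (Cauchy_coset_reps p_pr tP) => x a x0 a0 xa.
  have p_gt0 := prime_gt0 p_pr.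
  have [c ac] := roots p p_pr p1 a a0; have /andP[acp cpa] := veq_pth ac.
  have c0 : c != 0.
    by apply: contraTneq cpa => ->; rewrite expr0n gtn_eqF // vdvd0x.
  exists c => //; move: xa; rewrite /veq -!(extends_vdvd vu) in acp cpa *.
  rewrite rmorphXn in acp cpa * => /andP[xa ax].
  rewrite -(vdvd_exp u x _ p_gt0) -(vdvd_exp u _ x p_gt0).
  by rewrite (vdvd_trans xa acp) (vdvd_trans cpa ax).
- apply: residue_separable => [y y1|p p_pr p1 b b0].
    have [q [q_mon qO qy]] := henselian_integral Kt_closure v_henselian E_alg vu y1.
    exists q; split=> //; apply/polyOverP => i.
    by rewrite vu; apply/polyOverP: i.
  move: p1; rewrite (vsdvd_equiv vu) => p1; have [c bc] := roots p p_pr p1 b b0.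
  by exists c; rewrite (vsdvd_equiv vu).
split.
  exists u; first by [].
  move=> u' vu' x; apply/esym/uniq => y; by rewrite vu' vu.
exists e, f; split=> //; by apply/residue_degreeP; exists s.
Qed.
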